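(* Let $m,n\in\mathbb{N}$. For any compact discrete valuation ring $\mathfrak{o}$ (of arbitrary characteristic), with residue field cardinality $q$, $$\zeta^{\triangleleft}_{L_{m,n}(\mathfrak{o})}(s) = \zeta_{\mathfrak{o}^{d(m,n)}}(s)\cdot I_n\left(q^{-1};\left(q^{a_i^{\triangleleft}(m,n)-s\,b_i^{\triangleleft}(m,n)}\right)_{i=n-1}^{0}\right),$$ where, for $i\in\{0,1,\dots,n-1\}$, $$a_i^{\triangleleft}(m,n)=(n-i)(i+d(m,n)),\qquad b_i^{\triangleleft}(m,n)=n-i+e(m,n)+\sum_{j=i+1}^{n}e(m,j).$$
   Context: $\mathbb{N}=\{1,2,\dots\}$, $\mathbb{N}_0=\mathbb{N}\cup\{0\}$. The Lie ring $L_{m,n}$: put $\mathbf{E}=\{\mathbf{e}\in\mathbb{N}_0^n \mid e_1+\dots+e_n=m-1\}$ and $\mathbf{F}=\{\mathbf{f}\in\mathbb{N}_0^n\mid f_1+\dots+f_n=m\}$. $L_{m,n}$ is the class-2-nilpotent Lie ring which is free as a $\mathbb{Z}$-module on the elements $x_{\mathbf{e}}$ ($\mathbf{e}\in\mathbf{E}$), $y_{\mathbf{f}}$ ($\mathbf{f}\in\mathbf{F}$), $z_1,\dots,z_n$, with $[x_{\mathbf{e}},y_{\mathbf{f}}]=-[y_{\mathbf f},x_{\mathbf e}]=z_i$ if $\mathbf{f}-\mathbf{e}$ is the $i$-th standard basis vector of $\mathbb{Z}^n$, $[x_{\mathbf{e}},y_{\mathbf{f}}]=0$ if $\mathbf{f}-\mathbf{e}$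 is not a standard basis vector, and all other brackets of basis elements equal to $0$. For a commutative ring $R$, $L_{m,n}(R)=L_{m,n}\otimes_{\mathbb{Z}}R$. Numbers: $e(m,n)=\binom{n+m-2}{n-1}$, $f(m,n)=\binom{n+m-1}{n-1}$, $d(m,n)=e(m,n)+f(m,n)$. Zeta functions: for an $\mathfrak{o}$-Lie algebra $L$ that is free of finite rank, $\zeta_L^{\triangleleft}(s)=\sum_{I\triangleleft L}|L:I|^{-s}$, the sum being over the $\mathfrak{o}$-ideals $I$ of finite index in $L$ ($s$ a complex variable). $\zeta_{\mathfrak{o}^d}(s)$ is the analogous series enumerating all $\mathfrak{o}$-submodules of finite index in $\mathfrak{o}^d$; it equals $\prod_{i=0}^{d-1}(1-q^{i-s})^{-1}$. Igusa function of degree $n$: $$I_n(Y;X_1,\dots,X_n)=\sum_{I\subseteq\{1,\dots,n\}}\binom{n}{I}_Y\prod_{i\in I}\frac{X_i}{1-X_i},$$ where for $I=\{i_1<\dots<i_l\}$ one sets $\binom{n}{I}_Y=\binom{n}{i_l}_Y\binom{i_l}{i_{l-1}}_Y\cdots\binom{i_2}{i_1}_Y$ (equal to $1$ for $I=\emptyset$) and $\binom{a}{b}_Y=\frac{\prod_{i=a-b+1}^{a}(1-Y^i)}{\prod_{i=1}^{b}(1-Y^i)}$. The notation $I_n(Y;(x_i)_{i=n-1}^{0})$ means $I_n(Y;x_{n-1},x_{n-2},\dots,x_0)$, i.e. $X_1=x_{n-1},\dots,X_n=x_0$. *)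

(* Defs.v *)
From HB Require Import structures.
From mathcomp Require Import all_boot all_order all_algebra ring_quotient.
From mathcomp Require Import all_classical all_reals all_analysis.
From mathcomp Require Import finmap complex.
From mathcomp.analysis.showcase Require summability.
Set Implicit Arguments.
Unset Strict Implicit.
Unset Printing Implicit Defensive.
Import Order.TTheory GRing.Theory Num.Theory.
Import numFieldNormedType.Exports.
Local Open Scope classical_set_scope.
Local Open Scope ring_scope.

Definition cosets (V : zmodType) (M : set V) : set (set V) :=
  range (fun x => [set x + y | y in M]).

Definition finite_index (V : zmodType) (M : set V) : Prop :=
  finite_set (cosets M).

(* The junk value is 0 when M has infinite index. *)
Definition subgroup_index (V : zmodType) (M : set V) : nat :=
  #|` fset_set (cosets M)|%fset.

(* A principal ideal domain with a unique nonzero prime ideal. The library's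
   [idealr_closed] describes proper ideals; the unit ideal is always principal. *)
Definition discrete_valuation_ring (A : idomainType) : Prop :=
  (forall I : set A, idealr_closed (mem I) -> exists a, I = range ( *%R a)) /\
  (exists! P : set A,
     [/\ idealr_closed (mem P), prime_idealr_closed (mem P) & P <> [set 0]]).

(* The set of nonunits, which is the maximal ideal when A is local. *)
Definition max_ideal (A : unitRingType) : set A :=
  [set x | x \isn't a GRing.unit].

(* The coefficients c make the power of exponent 0 the unit ideal. *)
Definition ideal_power (A : comNzRingType) (I : set A) (k : nat) : set A :=
  [set x | exists r (c : 'I_r -> A) (a : 'I_r -> 'I_k -> A),
     (forall i j, I (a i j)) /\ x = \sum_i c i * \prod_j a i j].

Lemma ideal_powerS (A : comNzRingType) (I : set A) k :
  ideal_power I k.+1 `<=` ideal_power I k.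
Proof.
move=> x [r [c [a [Ia ->]]]].
exists r, (fun i => c i * a i ord0), (fun i j => a i (lift ord0 j)); split=> //.
by apply: eq_bigr => i _; rewrite big_ord_recl mulrA.
Qed.

Lemma ideal_power_le (A : comNzRingType) (I : set A) k l :
  (k <= l)%N -> ideal_power I l `<=` ideal_power I k.
Proof.
move=> /subnK <-; elim: (l - k)%N => [//|j IHj] x.
by rewrite addSn => /ideal_powerS; apply: IHj.
Qed.

(* A copy of A carrying the I-adic topology, in which the sets x + I^k form a
   neighbourhood basis of each point x. *)
Definition adic (A : comNzRingType) (I : set A) : Type := A.

HB.instance Definition _ (A : comNzRingType) (I : set A) :=
  Choice.on (adic I).

Definition adic_open (A : comNzRingType) (I : set A) (U : set (adic I)) :=
  forall x : A, U x ->
    exists k, forall y : A, ideal_power I k y -> U (x + y).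

Section AdicTopology.
Variables (A : comNzRingType) (I : set A).

Lemma adic_openT : adic_open (setT : set (adic I)).
Proof. by move=> x _; exists 0. Qed.

Lemma adic_openI : setI_closed (@adic_open A I).
Proof.
move=> U V oU oV x [/oU[k Uk] /oV[l Vl]]; exists (maxn k l) => y Iy.
by split; [apply: Uk | apply: Vl]; apply: ideal_power_le Iy;
  rewrite ?leq_maxl ?leq_maxr.
Qed.

Lemma adic_open_bigU (J : Type) (f : J -> set (adic I)) :
  (forall i, adic_open (f i)) -> adic_open (\bigcup_i f i).
Proof.
by move=> of_ x [i _ /of_[k fk]]; exists k => y /fk; exists i.
Qed.

HB.instance Definition _ :=
  isOpenTopological.Build (adic I) adic_openT adic_openI adic_open_bigU.

End AdicTopology.

Definition compact_dvr (A : idomainType) : Prop :=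
  discrete_valuation_ring A /\ compact [set: adic (@max_ideal A)].

Section ComplexPower.
Variable R : realType.

Definition cexp (z : R[i]) : R[i] :=
  (expR (complex.Re z))%:C%C *
  (cos (complex.Im z) +i* sin (complex.Im z))%C.

(* Meaningful for x > 0 only. *)
Definition cpow (x : R) (s : R[i]) : R[i] := cexp ((ln x)%:C%C * s).

End ComplexPower.

Section Zeta.
Variables (R : realType) (V : zmodType).
(* All members of P are meant to be subgroups of finite index. *)
Variable P : set (set V).

Definition zeta_term (s : R[i]) (M : P) : R[i]^o :=
  cpow (subgroup_index (val M))%:R (- s).

(* Absolute convergence; the real part only casts the modulus to R. *)
Definition zeta_converges (s : R[i]) : Prop :=
  summable [set: P] (fun M => (complex.Re `|zeta_term s M|)%:E).

(* The limit of the net of finite partial sums. *)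
Definition zeta (s : R[i]) : R[i] := summability.sum (zeta_term s).

End Zeta.

Section Submodules.
Variables (A : nzRingType) (V : lmodType A).

Definition finite_index_submodules : set (set V) :=
  [set M : set V | GRing.submod_closed (mem M) /\ finite_index M].

(* Here br is the bracket of a Lie algebra structure on V. *)
Definition finite_index_ideals (br : V -> V -> V) : set (set V) :=
  [set M : set V | [/\ GRing.submod_closed (mem M),
               forall x y, M y -> M (br x y) & finite_index M]].

End Submodules.

(* The n-tuples of natural numbers with sum k; their entries are at most k. *)
Definition tuples_of_sum (n k : nat) : Type :=
  {e : {ffun 'I_n -> 'I_k.+1} | (\sum_i e i == k)%N}.

HB.instance Definition _ n k := Finite.on (tuples_of_sum n k).

Definition Eset (m n : nat) : finType := tuples_of_sum n m.-1.
Definition Fset (m n : nat) : finType := tuples_of_sum n m.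

(* The summands index the x_e, the y_f and the z_i respectively. *)
Definition Lbasis (m n : nat) : finType := (Eset m n + Fset m n + 'I_n)%type.

Definition differ_by_std (m n : nat) (e : Eset m n) (f : Fset m n) (i : 'I_n) :=
  [forall j, (val f j == val e j + (j == i) :> nat)%N].

(* The coefficient of the basis element c in the bracket [a, b]. *)
Definition Lstruct (m n : nat) (a b c : Lbasis m n) : int :=
  match a, b, c with
  | inl (inl e), inl (inr f), inr i => (differ_by_std e f i)%:Z
  | inl (inr f), inl (inl e), inr i => - (differ_by_std e f i)%:Z
  | _, _, _ => 0
  end.

(* L_{m,n} tensored with A: the free A-module on the basis of L_{m,n}. *)
Definition Lmn (m n : nat) (A : comNzRingType) : lmodType A :=
  {ffun Lbasis m n -> A^o}.

Definition Lbracket (m n : nat) (A : comNzRingType) (u v : Lmn m n A) :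
    Lmn m n A :=
  [ffun c => \sum_a \sum_b u a * v b * (Lstruct a b c)%:~R].

Section LieRing.
Variables (m n : nat) (A : comNzRingType).
Implicit Types u v w : Lmn m n A.

Lemma Lbracket_linearl v : linear (fun u => Lbracket u v).
Proof.
move=> k u w; apply/ffunP => c; rewrite !ffunE scaler_sumr -big_split /=.
apply: eq_bigr => a _; rewrite scaler_sumr -big_split /=.
by apply: eq_bigr => b _; rewrite !ffunE !mulrDl !scalerAl.
Qed.

Lemma LstructC (a b c : Lbasis m n) : Lstruct a b c = - Lstruct b a c.
Proof.
by case: a b c => [[e|f]|i] [[e'|f']|i'] [[e''|f'']|i''];
  rewrite /Lstruct ?oppr0 ?opprK.
Qed.

Lemma Lbracket_antisym u v : Lbracket u v = - Lbracket v u.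
Proof.
apply/ffunP => c; rewrite !ffunE exchange_big -sumrN /=.
apply: eq_bigr => a _; rewrite -sumrN; apply: eq_bigr => b _.
by rewrite LstructC mulrNz mulrN [v a * _]mulrC.
Qed.

Lemma Lbracket_alt u : Lbracket u u = 0.
Proof.
apply/ffunP => c; rewrite !ffunE.
pose F a b := u a * u b * (Lstruct a b c)%:~R : A.
have FN a b : F a b = - F b a.
  by rewrite /F LstructC mulrNz mulrN [u a * _]mulrC.
have sum0 (Q : Lbasis m n -> bool) :
    \sum_(a | Q a) \sum_(b | ~~ Q b) F a b +
    \sum_(a | ~~ Q a) \sum_(b | Q b) F a b = 0.
  rewrite [X in _ + X]exchange_big -big_split big1 // => a _.
  by rewrite -big_split big1 //= => b _; rewrite FN addNr.
have F0 (Q : Lbasis m n -> bool) :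
    (forall a b, Q a = Q b -> F a b = 0) -> \sum_a \sum_b F a b = 0.
  move=> Q0; rewrite -[RHS](sum0 Q) (bigID Q) /=.
  congr (_ + _); apply: eq_bigr => a Qa; rewrite (bigID Q) /=.
    by rewrite big1 ?add0r // => b Qb; apply: Q0; rewrite Qa Qb.
  rewrite [X in _ + X]big1 ?addr0 // => b Qb.
  by apply: Q0; rewrite (negbTE Qa) (negbTE Qb).
apply: (F0 (fun a => if a is inl (inl _) then true else false)).
move=> [[e|f]|i] [[e'|f']|i'] //= _;
  by case: c @F {FN sum0 F0} => [[?|?]|?] F; rewrite /F /= mulr0.
Qed.

Lemma Lbracket_nil2 u v w : Lbracket (Lbracket u v) w = 0.
Proof.
apply/ffunP => c; rewrite !ffunE big1 // => a _; rewrite big1 // => b _.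
case: a => [a|i]; last by case: b c => [[?|?]|?] [[?|?]|?]; rewrite /= mulr0.
rewrite ffunE big1 ?mul0r // => a' _; rewrite big1 // => b' _.
by case: a' b' => [[?|?]|?] [[?|?]|?]; case: a => ?; rewrite /= mulr0.
Qed.

End LieRing.

(* e(m,n), f(m,n) and d(m,n); the truncated subtractions are exact for positive
   m and n. *)
Definition num_e (m n : nat) : nat := 'C(n + m - 2, n - 1).
Definition num_f (m n : nat) : nat := 'C(n + m - 1, n - 1).
Definition num_d (m n : nat) : nat := (num_e m n + num_f m n)%N.

(* The exponents a_i(m,n) and b_i(m,n), for i < n. *)
Definition num_a (m n i : nat) : nat := ((n - i) * (i + num_d m n))%N.
Definition num_b (m n i : nat) : nat :=
  (n - i + num_e m n + \sum_(i.+1 <= j < n.+1) num_e m j)%N.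

Section Igusa.
Variable F : fieldType.

(* For b <= a. *)
Definition gauss_binom (Y : F) (a b : nat) : F :=
  (\prod_((a - b).+1 <= i < a.+1) (1 - Y ^+ i)) /
  (\prod_(1 <= i < b.+1) (1 - Y ^+ i)).

(* The argument s lists the set I in decreasing order. *)
Fixpoint gauss_multinom (Y : F) (n : nat) (s : seq nat) : F :=
  if s is i :: s' then gauss_binom Y n i * gauss_multinom Y i s' else 1.

(* Subsets of {1, ..., n} are subsets of 'I_n.+1 without 0, and [enum] lists
   their elements in increasing order. *)
Definition igusa (n : nat) (Y : F) (X : nat -> F) : F :=
  \sum_(I : {set 'I_n.+1} | ord0 \notin I)
    gauss_multinom Y n (rev (map val (enum I))) *
    \prod_(i in I) (X i / (1 - X i)).

End Igusa.

(* Main.v *)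
Require Import Defs.
From HB Require Import structures.
From mathcomp Require Import all_boot all_order all_algebra.
From mathcomp Require Import all_classical all_reals all_analysis.
From mathcomp Require Import finmap complex ring_quotient.
From mathcomp Require Import ring zify.
From mathcomp Require mpoly.
From mathcomp.analysis.showcase Require summability.
Set Implicit Arguments.
Unset Strict Implicit.
Unset Printing Implicit Defensive.
Import Order.TTheory GRing.Theory Num.Theory.
Import numFieldNormedType.Exports.
Import (canonicals) mpoly.
Local Open Scope classical_set_scope.
Local Open Scope ring_scope.

(** Let Z be the span of the z_i, of rank n, and V the span of the x_e and y_f,
    of rank d, so that the Lie algebra is the sum of V and Z and [V, V] lies in
    Z. For a lattice M of Z let stab M be the lattice of those v in V whose
    brackets with the whole algebra lie in M. An ideal I of finite index amounts
    to the lattice M, its intersection with Z, to a sublattice of stab M, the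
    image of I in V, and to a linear map from this sublattice to Z / M. Since
    stab M is free of rank d, the sum over the ideals factors as the zeta
    function of o^d times the sum over all lattices M of
      |Z : M|^(d - s) * |V : stab M|^(-s)
    (ideal_fiber, ideal_fibers, fiber_sum).

    The second factor is computed along the chain M, pi_div M, ..., where pi is
    a uniformizer and pi_div M is the set of all x with pi x in M. Let c be the
    corank of M, the dimension of Z / (M + pi Z) over the residue field. Passing
    from pi_div M to M multiplies |Z : M| by q^c, and |V : stab M| by a power of
    q that depends only on c. For the latter one computes stab M modulo pi
    (stab_mod_index): its x-part vanishes unless c = 0, polynomials over a field
    having no zero divisors; its y-part is the m-th divided power of the
    reduction of M, and lifts to the y-part of stab M because the pivot rows of
    an echelon form of M lift to M. On the other hand, the number of lattices M
    of corank c with pi_div M = N is the number of subspaces of dimension n - c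
    in an n-dimensional space that meet a given space of dimension corank N
    trivially (latt_fiber, card_subspaces). Hence the sums G c over the lattices
    of corank c satisfy a triangular linear system (sum_corank_rec), which is
    solved by the sums over the subsets with largest element c in the Igusa
    function (igusa_recursion).

    Every rearrangement is along a map with finite fibres (has_sum_fibers). The
    same recursion settles convergence: for large Re s the fibre sums are at most
    half the weight of the base, which bounds all partial sums by 2
    (weight_bounded); and whenever the sum over the ideals converges absolutely,
    the recursion for the moduli gives |X c| < 1, so that the denominators of the
    Igusa function do not vanish (igusa_var_lt1). *)

(** * Unordered sums *)

Section NetSums.
Variable K : numFieldType.
Implicit Types I J : choiceType.

(** The limit of the net of finite partial sums, in a form that applies to the
    real and to the complex numbers alike. *)
Definition has_sum I (f : I -> K) (l : K) :=
  forall e : K, 0 < e -> exists F0 : {fset I}, forall F : {fset I},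
    (F0 `<=` F)%fset -> `|\sum_(i <- F) f i - l| < e.

Lemma has_sum_unique I (f : I -> K) l l' :
  has_sum f l -> has_sum f l' -> l = l'.
Proof.
move=> fl fl'; apply/eqP; rewrite -subr_eq0 -normr_le0.
rewrite real_leNgt ?real0 ?normr_real//; apply/negP => d_gt0.
have h_gt0 : 0 < `|l - l'| / 2 by rewrite divr_gt0.
have [F0 hF0] := fl _ h_gt0; have [F1 hF1] := fl' _ h_gt0.
have := ltrD (hF0 _ (fsubsetUl F0 F1)) (hF1 _ (fsubsetUr F0 F1)).
rewrite -splitr; apply/negP; rewrite -real_leNgt ?realD ?normr_real//.
rewrite (distrC _ l); apply: le_trans (ler_normD _ _).
by rewrite addrA subrK.
Qed.

Lemma eq_has_sum I (f g : I -> K) l : f =1 g -> has_sum f l -> has_sum g l.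
Proof.
move=> fg fl e /fl [F0 hF0]; exists F0 => F /hF0.
by under eq_bigr do rewrite fg.
Qed.

Lemma has_sumD I (f g : I -> K) l l' :
  has_sum f l -> has_sum g l' -> has_sum (fun i => f i + g i) (l + l').
Proof.
move=> fl gl' e e0; have h0 : 0 < e / 2 by rewrite divr_gt0.
have [F0 hF0] := fl _ h0; have [F1 hF1] := gl' _ h0.
exists (F0 `|` F1)%fset => F; rewrite fsubUset => /andP[/hF0 l1 /hF1 l2].
rewrite big_split opprD addrACA (splitr e).
exact: le_lt_trans (ler_normD _ _) (ltrD l1 l2).
Qed.

Lemma has_sumZ I (f : I -> K) l (c : K) :
  has_sum f l -> has_sum (fun i => c * f i) (c * l).
Proof.
move=> fl e e0; have c0 : 0 < `|c| + 1 by rewrite ltr_wpDl.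
have [F0 hF0] := fl _ (divr_gt0 e0 c0); exists F0 => F /hF0 lt_e.
rewrite -mulr_sumr -mulrBr normrM.
apply: le_lt_trans (_ : _ <= (`|c| + 1) * `|\sum_(i <- F) f i - l|) _.
  by rewrite ler_wpM2r// lerDl.
by rewrite mulrC -ltr_pdivlMr.
Qed.

Lemma has_sum0 I : has_sum (fun _ : I => 0) 0.
Proof.
move=> e e0; exists fset0 => F _.
by rewrite big1 ?subrr ?normr0.
Qed.

Lemma has_sum_sum I (r : seq nat) (f : nat -> I -> K) (l : nat -> K) :
  (forall c, c \in r -> has_sum (f c) (l c)) ->
  has_sum (fun i => \sum_(c <- r) f c i) (\sum_(c <- r) l c).
Proof.
elim: r => [|c r IHr] fl.
  rewrite big_nil; apply: eq_has_sum (has_sum0 _) => i.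
  by rewrite big_nil.
rewrite big_cons; apply: (@eq_has_sum _ (fun i => f c i +
  \sum_(d <- r) f d i)) => [i|]; first by rewrite big_cons.
apply: has_sumD; first by apply: fl; rewrite mem_head.
by apply: IHr => d rd; apply: fl; rewrite inE rd orbT.
Qed.

Lemma has_sum_point I (f : I -> K) i0 :
  (forall i, i != i0 -> f i = 0) -> has_sum f (f i0).
Proof.
move=> f0 e e0; exists [fset i0]%fset => F; rewrite fsub1set => Fi0.
rewrite (bigD1_seq i0) ?fset_uniq//= big1 ?addr0 ?subrr ?normr0//.
Qed.

Lemma sum_fibers (A : nmodType) I J (p : I -> J) (fib : J -> {fset I})
    (f : I -> A) (G : {fset J}) :
  (forall i j, (i \in fib j) = (p i == j)) ->
  \sum_(j <- G) \sum_(i <- fib j) f i =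
  \sum_(i <- (\bigcup_(j <- G) fib j)%fset) f i.
Proof.
move=> fibP; rewrite partition_disjoint_bigfcup// => j k _ _ jk.
apply/fdisjointP => i; rewrite !fibP => /eqP->.
by apply: contra jk => /eqP->.
Qed.

(** Unordered sums may be regrouped along a map with finite fibres, because the
    preimages of finite sets are then finite and eventually contain any given
    finite set. *)
Lemma has_sum_fibers I J (p : I -> J) (fib : J -> {fset I}) (f : I -> K) l :
  (forall i j, (i \in fib j) = (p i == j)) -> has_sum f l ->
  has_sum (fun j => \sum_(i <- fib j) f i) l.
Proof.
move=> fibP fl e /fl[F0 hF0]; exists [fset p i | i in F0]%fset => G F0G.
rewrite (sum_fibers _ _ fibP); apply: hF0; apply/fsubsetP => i F0i.
apply/bigfcupP; exists (p i); last by rewrite fibP.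
by rewrite andbT; apply: (fsubsetP F0G); apply/imfsetP; exists i.
Qed.

Lemma has_sum_dist_le I (f : I -> K) l x e (F0 : {fset I}) :
  (forall F, (F0 `<=` F)%fset -> `|\sum_(i <- F) f i - x| <= e) ->
  has_sum f l -> `|l - x| <= e.
Proof.
move=> fx fl; apply/ler_addgt0Pl => d d0; have [F1 hF1] := fl _ d0.
set S := \sum_(i <- (F0 `|` F1)%fset) f i.
apply: (@le_trans _ _ (`|S - l| + `|S - x|)).
  by rewrite (distrC _ l); apply: le_trans (ler_normD _ _); rewrite addrA subrK.
by apply: lerD; [apply/ltW/hF1/fsubsetUr | apply/fx/fsubsetUl].
Qed.

Lemma sum_fsetM (A : pzSemiRingType) I J (F : {fset I}) (G : {fset J})
    (f : I -> A) (g : J -> A) :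
  \sum_(x <- (F `*` G)%fset) f x.1 * g x.2 =
  (\sum_(i <- F) f i) * (\sum_(j <- G) g j).
Proof.
rewrite big_distrlr /= (perm_big [seq (i, j) | i <- F, j <- G]) /=.
  by rewrite big_allpairs.
apply: uniq_perm; rewrite ?fset_uniq ?allpairs_uniq ?fset_uniq//.
  by move=> [? ?] [? ?].
move=> [i j]; rewrite in_fsetM/=; apply/andP/allpairsP => [[Fi Gj]|].
  by exists (i, j).
by move=> [[i' j'] [Fi Gj [-> ->]]].
Qed.

(** The rectangles F * G eventually contain any given finite set of pairs, so
    the double sum is the iterated limit of the sums over rectangles. *)
Lemma has_sum_prod I J (u : I -> K) (v : J -> K) U V l :
  has_sum u U -> has_sum v V ->
  has_sum (fun x : I * J => u x.1 * v x.2) l -> l = U * V.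
Proof.
move=> uU vV uvl; apply/eqP; rewrite eq_sym -subr_eq0 -normr_le0.
apply/ler_addgt0Pl => e e0; rewrite addr0; have [P0 hP0] := uvl _ e0.
pose G0 := [fset x.2 | x in P0]%fset; pose F0 := [fset x.1 | x in P0]%fset.
apply: (@has_sum_dist_le _ (fun j => U * v j) _ _ _ G0); last exact: has_sumZ.
move=> G G0G; rewrite -mulr_sumr mulrC.
apply: (@has_sum_dist_le _ (fun i => (\sum_(j <- G) v j) * u i) _ _ _ F0).
  move=> F F0F; rewrite -mulr_sumr mulrC big_distrlr /= ltW//.
  have /hP0 : (P0 `<=` F `*` G)%fset.
    apply/fsubsetP => x P0x; rewrite in_fsetM (fsubsetP F0F) ?(fsubsetP G0G)//.
      by apply/imfsetP; exists x.
    by apply/imfsetP; exists x.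
  by rewrite sum_fsetM big_distrlr.
exact: has_sumZ.
Qed.

End NetSums.

Section AbsoluteSums.
Variable R : realType.
Implicit Types I : choiceType.
Local Open Scope complex_scope.

Lemma fset_sum_le I (f : I -> R) (F G : {fset I}) : (forall i, 0 <= f i) ->
  (F `<=` G)%fset -> \sum_(i <- F) f i <= \sum_(i <- G) f i.
Proof.
move=> f0 FG; rewrite [leRHS](big_fsetID _ (mem F))/=.
rewrite [X in _ <= X + _](_ : _ = \sum_(i <- F) f i) ?lerDl ?sumr_ge0//.
apply: eq_fbigl => i; rewrite !inE/= andbC; apply: andb_idr.
exact: (fsubsetP FG).
Qed.

Lemma has_sum_nonneg I (f : I -> R) B : (forall i, 0 <= f i) ->
  (forall F : {fset I}, \sum_(i <- F) f i <= B) -> exists l, has_sum f l.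
Proof.
move=> f0 fB; pose S := [set x | exists F : {fset I}, x = \sum_(i <- F) f i].
have ubS : has_ubound S by exists B => _ [F ->].
have S0 : S !=set0 by exists (\sum_(i <- fset0) f i), fset0.
exists (sup S) => e e0.
have [_ [F0 ->] ltF0] := sup_adherent e0 (conj S0 ubS).
exists F0 => F F0F; rewrite distrC ger0_norm ?subr_ge0; last first.
  by apply: ub_le_sup => //; exists F.
rewrite ltrBlDl -ltrBlDr; apply: lt_le_trans ltF0 _.
exact: fset_sum_le.
Qed.

(** The summand f is the difference of |f| + f and |f|, whose partial sums are
    both nondecreasing and bounded. *)
Lemma has_sum_abs_real I (f : I -> R) B :
  (forall F : {fset I}, \sum_(i <- F) `|f i| <= B) -> exists l, has_sum f l.
Proof.
move=> fB; have [a fa] := has_sum_nonneg (fun i => normr_ge0 (f i)) fB.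
have [||b fb] := @has_sum_nonneg _ (fun i => `|f i| + f i) (B + B).
- by move=> i; rewrite addrC -lerBlDr sub0r lerNl -normrN ler_norm.
- move=> F; apply: le_trans (_ : \sum_(i <- F) (`|f i| + `|f i|) <= _).
    by apply: ler_sum => i _; rewrite lerD2l ler_norm.
  by rewrite big_split lerD.
exists (b + (-1) * a); apply: eq_has_sum (has_sumD fb (has_sumZ (-1) fa)) => i.
by rewrite mulN1r addrAC subrr add0r.
Qed.

Lemma has_sum_real_complex I (f : I -> R) l :
  has_sum f l -> has_sum (fun i => (f i)%:C) l%:C.
Proof.
move=> fl e e0; have [er e0'] : e = (complex.Re e)%:C /\ 0 < complex.Re e.
  by case: e e0 => a b; rewrite ltcE/= => /andP[/eqP -> a0]; split.
have [F0 hF0] := fl _ e0'; exists F0 => F /hF0.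
rewrite -(raddf_sum (real_complex R)) -(raddfB (real_complex R)) er.
by rewrite normc_def/= expr0n addr0 sqrtr_sqr ltcR.
Qed.

Lemma has_sum_abs I (f : I -> R[i]) (B : R) :
  (forall F : {fset I}, \sum_(i <- F) complex.Re `|f i| <= B) ->
  exists l, has_sum f l.
Proof.
move=> fB.
have leRe (z : R[i]) : `|complex.Re z| <= complex.Re `|z|.
  case: z => a b; rewrite normc_def/= -[leLHS]sqrtr_sqr ler_wsqrtr//.
  by rewrite lerDl sqr_ge0.
have leIm (z : R[i]) : `|complex.Im z| <= complex.Re `|z|.
  case: z => a b; rewrite normc_def/= -[leLHS]sqrtr_sqr ler_wsqrtr//.
  by rewrite lerDr sqr_ge0.
have [|a fa] := @has_sum_abs_real _ (fun i => complex.Re (f i)) B.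
  by move=> F; apply: le_trans (fB F); apply: ler_sum => i _.
have [|b fb] := @has_sum_abs_real _ (fun i => complex.Im (f i)) B.
  by move=> F; apply: le_trans (fB F); apply: ler_sum => i _.
exists (a%:C + 'i%C * b%:C).
have := has_sumD (has_sum_real_complex fa)
                 (has_sumZ 'i%C (has_sum_real_complex fb)).
apply: eq_has_sum => i; by case: (f i) => x y; simpc.
Qed.

Lemma sum_has_sum I (f : I -> R[i]^o) l : has_sum f l -> summability.sum f = l.
Proof.
move=> fl; apply: (@cvg_lim _ _ _ _ (@summability.totally_filter I)).
  exact: norm_hausdorff.
apply: (proj2 (@cvgrPdist_lt R[i] R[i]^o _ _
  (@summability.totally_filter I) _ _)) => e e0.
have [F0 hF0] := fl _ e0.
exists F0 => // F /= /hF0; rewrite distrC /summability.partial_sum.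
by rewrite big_seq_fsetE.
Qed.

Lemma summableP I (f : I -> R) : (forall i, 0 <= f i) ->
  reflect (exists B, forall F : {fset I}, \sum_(i <- F) f i <= B)
          (summable [set: I] (fun i => (f i)%:E)).
Proof.
move=> f0; have f0E (i : I) : `|(f i)%:E|%E = (f i)%:E.
  by rewrite abse_EFin ger0_norm.
have sumE (F : {fset I}) :
    (\sum_(i \in [set` F]) `|(f i)%:E| = (\sum_(i <- F) f i)%:E)%E.
  by rewrite -fsbig_seq ?fset_uniq// -sumEFin; apply: eq_bigr => i _.
apply: (iffP idP) => [sf|[B fB]].
  exists (fine (\esum_(i in [set: I]) `|(f i)%:E|%E)) => F.
  rewrite -lee_fin fineK; last by rewrite -summableE.
  by rewrite -sumE; apply: esum_ge; exists [set` F]; [split | exact: lexx].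
apply: (@le_lt_trans _ _ B%:E); last exact: ltry.
apply: ge_ereal_sup => _ [F [finF _] <-].
by rewrite -(fset_setK finF) sumE lee_fin.
Qed.

End AbsoluteSums.

(** * Indices of subgroups *)

Section Index.
Implicit Types U V : zmodType.

Definition subgroup V (M : set V) := M 0 /\ forall x y, M x -> M y -> M (x - y).

Lemma subgroupN V (M : set V) x : subgroup M -> M x -> M (- x).
Proof. by move=> [M0 MB] Mx; rewrite -sub0r; apply: MB. Qed.

Lemma subgroupD V (M : set V) x y : subgroup M -> M x -> M y -> M (x + y).
Proof.
move=> gM Mx My; rewrite -[y]opprK; apply: (proj2 gM) => //.
exact: subgroupN.
Qed.

Lemma subgroupC V (M : set V) x y : subgroup M -> M (x - y) -> M (y - x).
Proof. by move=> gM /(subgroupN gM); rewrite opprB. Qed.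

Definition quotient_map V (T : Type) (M : set V) (c : V -> T) :=
  (forall t, exists x, c x = t) /\ (forall x y, c x = c y <-> M (x - y)).

(** The quotient by M is described through its classifying maps onto finite
    types, which compose more easily than sets of cosets. *)
Definition has_index V (M : set V) (k : nat) :=
  exists (T : finType) (c : V -> T), quotient_map M c /\ #|T| = k.

Lemma quotient_map_subgroup V T (M : set V) (c : V -> T) :
  quotient_map M c -> subgroup M.
Proof.
move=> [_ cP]; have M0 : M 0 by rewrite -(subrr 0); apply/cP.
split=> // x y Mx My; apply/cP; transitivity (c 0).
  by apply/cP; rewrite subr0.
by apply/esym/cP; rewrite subr0.
Qed.

Lemma has_index_subgroup V (M : set V) k : has_index M k -> subgroup M.
Proof. by move=> [T [c [cP _]]]; apply: quotient_map_subgroup cP. Qed.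

Lemma has_index_gt0 V (M : set V) k : has_index M k -> (0 < k)%N.
Proof. by move=> [T [c [_ <-]]]; apply/card_gt0P; exists (c 0). Qed.

Lemma has_index_finite V (M : set V) k :
  has_index M k -> finite_index M /\ subgroup_index M = k.
Proof.
move=> [T [c [[c_surj cP] <-]]].
pose g (t : T) : set V := [set x | c x = t].
have cosetsE : cosets M = g @` [set` T].
  rewrite /cosets eqEsubset; split=> [_ [x _ <-]|_ [t _ <-]].
    exists (c x) => //; rewrite /g eqEsubset; split=> [y /= cy|_ [y My <-]] /=.
      by exists (y - x); [apply/cP | rewrite addrC subrK].
    by apply/cP; rewrite addrC addKr.
  have [x <-] := c_surj t; exists x => //.
  rewrite /g eqEsubset; split=> [_ [y My <-]|y /= cy] /=.
    by apply/cP; rewrite addrC addKr.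
  by exists (y - x); [apply/cP | rewrite addrC subrK].
have finT : finite_set [set` T] by exact: finite_finset.
have fin : finite_index M by rewrite /finite_index cosetsE; apply: finite_image.
split=> //; rewrite /subgroup_index cosetsE fset_set_image//.
rewrite card_in_imfset/=; last first.
  move=> t t' _ _ gt; have [x xt] := c_surj t.
  by rewrite -xt; have gtx : g t x := xt; rewrite gt in gtx.
rewrite cardE; apply/perm_size/uniq_perm; rewrite ?fset_uniq ?enum_uniq// => x.
by rewrite mem_enum in_fset_set//; exact: mem_set.
Qed.

Lemma finite_has_index V (M : set V) :
  subgroup M -> finite_index M -> has_index M (subgroup_index M).
Proof.
move=> gM fM; pose S := fset_set (cosets M).
have cS x : [set x + y | y in M] \in S.
  by rewrite in_fset_set//; apply: mem_set; exists x.
exists S, (fun x => [` cS x]%fset); split; last by rewrite -cardfE.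
split=> [[A AS]|x y].
  have : A \in cosets M by rewrite -in_fset_set.
  move=> /set_mem[x _ xA].
  by exists x; apply: val_inj.
split=> [[/seteqP[xy _]]|Mxy].
  have [|z Mz yz] := xy x; first by exists 0; [exact: (proj1 gM) | rewrite addr0].
  by rewrite -yz addrC addKr.
apply: val_inj => /=; rewrite eqEsubset; split=> _ [z Mz <-].
  exists (x - y + z); first exact: subgroupD.
  by rewrite addrA [y + _]addrC subrK.
exists (y - x + z); last by rewrite addrA [x + _]addrC subrK.
by apply: subgroupD => //; apply: subgroupC.
Qed.

Lemma has_index_unique V (M : set V) k k' :
  has_index M k -> has_index M k' -> k = k'.
Proof. by move=> /has_index_finite[_ <-] /has_index_finite[_ <-]. Qed.

(** A class of M is a union of classes of the map f, and the latter are finite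
    in number; so the quotient by M is a type of sets of values of f. *)
Lemma has_index_coarse V (T : finType) (M : set V) (f : V -> T) :
  subgroup M -> (forall x y, f x = f y -> M (x - y)) ->
  exists k, has_index M k.
Proof.
move=> gM fM; pose g x := finset.finset (fun t =>
  `[< exists2 y, f y = t & M (x - y) >]).
have gP x y : g x = g y <-> M (x - y).
  split=> [/finset.setP/(_ (f x))|Mxy].
    have -> : f x \in g x.
      by rewrite inE; apply/asboolP; exists x => //; rewrite subrr; exact: (proj1 gM).
    rewrite inE => /esym/asboolP[z fz Myz].
    rewrite -(subrK z x) -addrA; apply: subgroupD => //.
      by apply: fM.
    exact: subgroupC.
  apply/finset.setP => t; rewrite !inE; apply/asboolP/asboolP=> -[z fz Mz];
    exists z => //.
    rewrite -(subrK x y) -addrA; apply: subgroupD => //; exact: subgroupC.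
  by rewrite -(subrK y x) -addrA; apply: subgroupD.
pose T' : finType := {s : {set T} | `[< exists x, g x = s >]}.
have gT x : `[< exists y, g y = g x >] by apply/asboolP; exists x.
exists #|T'|, T', (fun x => exist _ (g x) (gT x) : T'); split=> //;
  split=> [[s sP]|x y].
  have [x gx] := asboolP _ sP; exists x; exact: val_inj.
rewrite -gP; split=> [/(congr1 val)//|gxy]; exact: val_inj.
Qed.

Lemma has_index_sup V (M M' : set V) k :
  has_index M k -> subgroup M' -> M `<=` M' -> exists k', has_index M' k'.
Proof.
move=> [T [c [[_ cP] _]]] gM' MM'; apply: (@has_index_coarse _ T _ c) => //.
by move=> x y /cP /MM'.
Qed.

Lemma has_index_setT V : has_index [set: V] 1.
Proof.
exists unit, (fun=> tt); split; last by rewrite card_unit.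
by split=> [[]|//]; exists 0.
Qed.

Section Split.
Variables (U V : zmodType) (psi : {additive U -> V}) (M : set V).
Hypothesis gM : subgroup M.

Lemma subgroup_preimage : subgroup (psi @^-1` M).
Proof.
split=> [|x y]; rewrite /= ?raddf0 ?raddfB; [exact: (proj1 gM)|exact: (proj2 gM)].
Qed.

(** The subgroup M + psi(U). *)
Definition sum_range : set V := [set x | exists u, M (x - psi u)].

Lemma subgroup_sum_range : subgroup sum_range.
Proof.
split=> [|x y [u Mu] [v Mv]]; first by exists 0; rewrite raddf0 subr0;
  exact: (proj1 gM).
exists (u - v); rewrite raddfB opprB addrA.
have -> : x - y + psi v - psi u = (x - psi u) - (y - psi v).
  by rewrite opprB !addrA [RHS](ACl (1*4*3*2)).
exact: (proj2 gM).
Qed.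

(** Each class of M is determined by its class modulo M + psi(U) and, within
    that class, by an element of U modulo the preimage of M. *)
Lemma index_split a b :
  has_index sum_range a -> has_index (psi @^-1` M) b -> has_index M (a * b).
Proof.
move=> [S [c [[c_surj cP] <-]]] [T [d [[d_surj dP] <-]]].
have /choice[rep repP] : forall s, exists x, c x = s by [].
have /choice[u uP] : forall x, exists u, M (x - rep (c x) - psi u).
  by move=> x; apply/cP; rewrite repP.
exists (S * T)%type, (fun x => (c x, d (u x))); split; last by rewrite card_prod.
split=> [[s t]|x y].
  have [v dv] := d_surj t; exists (rep s + psi v).
  have crs : c (rep s + psi v) = s.
    rewrite -{2}[s]repP; apply/cP; exists v.
    by rewrite [rep s + _]addrC addrK subrr; exact: (proj1 gM).
  congr (_, _) => //; rewrite -dv; apply/dP => /=; rewrite raddfB.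
  apply: subgroupC => //; have := uP (rep s + psi v); rewrite crs.
  by rewrite [rep s + _]addrC addrK.
split=> [[cxy /dP /=]|Mxy].
  rewrite raddfB => Muxy.
  have := proj2 gM _ _ (uP x) (uP y); rewrite cxy.
  move=> /(subgroupD gM Muxy).
  suff -> : psi (u x) - psi (u y) +
    (x - rep (c y) - psi (u x) - (y - rep (c y) - psi (u y))) = x - y by [].
  rewrite !opprD !opprK !addrA [LHS](ACl (3*6*(1*5)*(8*2)*(7*4))).
  by rewrite /= !subrr !addr0.
have cxy : c x = c y.
  by apply/cP; exists 0; rewrite raddf0 subr0.
congr (_, _) => //; apply/dP; rewrite /= raddfB.
have := proj2 gM _ _ (uP y) (uP x); rewrite cxy.
move=> /(subgroupD gM Mxy).
suff -> : x - y + (y - rep (c y) - psi (u y) - (x - rep (c y) - psi (u x))) =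
   psi (u x) - psi (u y) by [].
rewrite !opprD !opprK !addrA [LHS](ACl (8*5*(1*6)*(3*2)*(7*4))).
by rewrite /= !subrr !addr0.
Qed.

Lemma index_split_inv k : has_index M k -> exists a b,
  [/\ has_index sum_range a, has_index (psi @^-1` M) b & k = (a * b)%N].
Proof.
move=> Mk; have [T [c [[_ cP] _]]] := Mk.
have [a ha] : exists a, has_index sum_range a.
  apply: has_index_sup Mk _ _; first exact: subgroup_sum_range.
  by move=> x Mx; exists 0; rewrite raddf0 subr0.
have [b hb] : exists b, has_index (psi @^-1` M) b.
  apply: (@has_index_coarse _ T _ (c \o psi)); first exact: subgroup_preimage.
  by move=> x y /= /cP; rewrite -raddfB.
by exists a, b; split=> //; apply: has_index_unique Mk _; apply: index_split.
Qed.

Lemma index_preimage k : (forall y, exists x, psi x = y) ->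
  has_index M k <-> has_index (psi @^-1` M) k.
Proof.
move=> psi_surj.
have sT : sum_range = setT.
  apply/seteqP; split=> // x _; have [u ux] := psi_surj x.
  by exists u; rewrite ux subrr; exact: (proj1 gM).
split=> [/index_split_inv[a [b []]]|kM].
  rewrite sT => /has_index_unique/(_ (has_index_setT V)) ->.
  by move=> bM ->; rewrite mul1n.
by rewrite -[k]mul1n; apply: index_split => //; rewrite sT; exact: has_index_setT.
Qed.

End Split.

End Index.

(** * A recursion for the Igusa function *)

Section IgusaRecursion.

(** The subsets of {0, ..., k - 1} as decreasing lists, sorted out by their
    largest element; this is the shape on which gauss_multinom recurses. *)
Fixpoint decreasing_seqs (k : nat) : seq (seq nat) :=
  if k is k'.+1
  then decreasing_seqs k' ++ map (cons k') (decreasing_seqs k')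
  else [:: [::]].

Lemma mem_decreasing_seqs k s :
  (s \in decreasing_seqs k) = sorted gtn s && all (gtn k) s.
Proof.
elim: k s => [|k IHk] s /=.
  by rewrite inE; case: s => [//|i s]; rewrite /= andbF.
rewrite mem_cat IHk; case: s => [|i s] /=.
  by [].
have -> : (i :: s \in map (cons k) (decreasing_seqs k)) =
    (i == k) && (s \in decreasing_seqs k).
  apply/mapP/andP => [[t kt [-> ->]]|[/eqP-> ks]] //.
  by exists s.
have gtn_trans : transitive gtn by move=> a b c /= ab bc; exact: ltn_trans bc ab.
have allS : all (gtn k) s -> all (gtn k.+1) s.
  by apply: sub_all => j /= jk; apply: ltnW; rewrite ltnS.
rewrite IHk !(path_sortedE gtn_trans) ltnS.
case: (ltngtP i k) => [ik|ik|->] /=.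
- rewrite orbF; case: (boolP (all (gtn i) s)) => //= si.
  have ks : all (gtn k) s by apply: sub_all si => j /= /ltn_trans; apply.
  by rewrite ks allS.
- by rewrite !andbF.
rewrite andbF/= andbC; case: (boolP (all (gtn k) s)) => //= ks.
by rewrite (allS ks) andbT.
Qed.

Lemma decreasing_seqs_uniq k : uniq (decreasing_seqs k).
Proof.
elim: k => [//|k IHk] /=; rewrite cat_uniq IHk map_inj_uniq ?IHk; last by move=> ? ? [].
rewrite andbT; apply/hasPn => _ /mapP[s _ ->]; rewrite mem_decreasing_seqs/=.
by rewrite ltnn !andbF.
Qed.

Lemma sum_subsets (F : nmodType) k (phi : seq nat -> F) :
  \sum_(I : {set 'I_k}) phi (rev (map val (enum I))) =
  \sum_(s <- decreasing_seqs k) phi s.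
Proof.
pose h (I : {set 'I_k}) := rev (map val (enum I)).
rewrite -[LHS]/(\sum_I phi (h I)) -(big_map h xpredT phi); apply: perm_big.
have memh (I : {set 'I_k}) (i : 'I_k) : (val i \in h I) = (i \in I).
  by rewrite mem_rev mem_map ?mem_enum//; exact: val_inj.
have ltn_tr : transitive ltn by move=> a b c /=; exact: ltn_trans.
have sorted_enum (I : {set 'I_k}) : sorted ltn (map val (enum I)).
  rewrite sorted_map /enum_mem; apply: sorted_filter.
    by move=> a b c; exact: ltn_tr.
  by rewrite -sorted_map -enumT val_enum_ord; exact: iota_ltn_sorted.
apply: uniq_perm; last 1 first.
- move=> s; rewrite mem_decreasing_seqs;
  apply/mapP/andP => [[I _ ->]|[s_sorted /allP sk]].
    rewrite /h rev_sorted sorted_enum; split=> //.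
    by apply/allP => i; rewrite mem_rev => /mapP[j _ ->] /=.
  exists (finset (fun i : 'I_k => val i \in s)); first exact: mem_index_enum.
  rewrite -[s]revK; congr rev; apply: (irr_sorted_eq ltn_tr ltnn) => //.
    by rewrite rev_sorted.
  move=> i; rewrite mem_rev; apply/idP/mapP => [si|[j]].
    by exists (Ordinal (sk _ si : (i < k)%N)) => //;
      rewrite mem_enum finset.in_set revK.
  by rewrite mem_enum finset.in_set revK => js ->.
- rewrite map_inj_uniq ?index_enum_uniq// => I J IJ; apply/finset.setP => i.
  by rewrite -!memh IJ.
- exact: decreasing_seqs_uniq.
Qed.

Variables (F : fieldType) (Y : F).
Hypothesis Y_nroot : forall i, (0 < i)%N -> 1 - Y ^+ i != 0.

Definition qfact k : F := \prod_(1 <= i < k.+1) (1 - Y ^+ i).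

Lemma qfact_neq0 k : qfact k != 0.
Proof.
rewrite /qfact prodf_seq_neq0; apply/allP => i.
by rewrite mem_index_iota => /andP[i0 _]; exact: Y_nroot.
Qed.

Lemma qfact0 : qfact 0 = 1.
Proof. by rewrite /qfact big_geq. Qed.

Lemma gauss_binomE a b : (b <= a)%N ->
  gauss_binom Y a b = qfact a / (qfact b * qfact (a - b)).
Proof.
move=> ba; rewrite /gauss_binom -[X in _ / X]/(qfact b).
rewrite [qfact a](@big_cat_nat _ _ _ (a - b).+1) ?ltnS ?leq_subr//=.
rewrite -/(qfact (a - b)); set P := \prod_(_ <= _ < _) _.
by field; rewrite !qfact_neq0.
Qed.

(** The part of the sum over the subsets of {1, ..., k}, with a as the top entry
    of the outermost binomial coefficient. *)
Definition igusa_partial (Z : nat -> F) (a k : nat) : F :=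
  \sum_(s <- decreasing_seqs k.+1 | 0%N \notin s)
    gauss_multinom Y a s * \prod_(i <- s) Z i.

Lemma igusa_partial0 Z a : igusa_partial Z a 0 = 1.
Proof.
by rewrite /igusa_partial /= big_cons big_cons big_nil /= big_nil addr0 mulr1.
Qed.

Lemma igusa_partialS Z a k : igusa_partial Z a k.+1 =
  igusa_partial Z a k + gauss_binom Y a k.+1 * (Z k.+1 * igusa_partial Z k.+1 k).
Proof.
rewrite {1}/igusa_partial [decreasing_seqs _]/= big_cat/= -/(decreasing_seqs k.+1).
congr (_ + _); rewrite big_map mulrA mulr_sumr.
apply: eq_big => [s|s _]; first by rewrite inE.
by rewrite /= big_cons mulrACA.
Qed.

Lemma igusa_partialE n (X : nat -> F) :
  igusa n Y X = igusa_partial (fun i => X i / (1 - X i)) n n.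
Proof.
rewrite /igusa_partial big_mkcond /= -(@sum_subsets _ n.+1) [LHS]big_mkcond/=.
apply: eq_bigr => I _; rewrite mem_rev.
have -> : (0%N \notin map val (enum I)) = (ord0 \notin I).
  by rewrite -[0%N]/(val (@ord0 n)) mem_map ?mem_enum//; exact: val_inj.
case: ifP => // _; congr (_ * _).
by rewrite (perm_big (map val (enum I))) ?perm_rev//= big_map big_enum.
Qed.

(** Peeling off the largest element of a subset shows that the partial sums with
    largest element c obey the same triangular system as the K c, up to the
    factors qfact that turn quotients of K into Gauss binomials. *)
Lemma igusa_recursion n (X K : nat -> F) :
  K 0%N = qfact n -> (forall c, (0 < c <= n)%N -> 1 - X c != 0) ->
  (forall c, (0 < c <= n)%N ->
     (1 - X c) * K c = X c * \sum_(0 <= j < c) K j / qfact (c - j)) ->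
  \sum_(0 <= c < n.+1) K c / qfact (n - c) = igusa n Y X.
Proof.
move=> K0 X1 rec; rewrite igusa_partialE; pose Z i := X i / (1 - X i); rewrite -/Z.
pose h c := K c * qfact c / qfact n.
have IH k a : (k <= a)%N -> (k <= n)%N ->
    igusa_partial Z a k = \sum_(0 <= c < k.+1) gauss_binom Y a c * h c.
  elim: k a => [|k IHk] a ka kn.
    rewrite igusa_partial0 big_nat1 gauss_binomE// subn0 qfact0 mul1r.
    by rewrite divff ?qfact_neq0// mul1r /h K0 qfact0 mulr1 divff ?qfact_neq0.
  rewrite igusa_partialS big_nat_recr//= IHk ?(ltnW ka) ?(ltnW kn)//.
  congr (_ + _ * _); rewrite IHk ?(ltnW kn)//.
  have Xk : 1 - X k.+1 != 0 by apply: X1; rewrite kn.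
  have Kk : K k.+1 = Z k.+1 * \sum_(0 <= j < k.+1) K j / qfact (k.+1 - j).
    by rewrite /Z mulrAC -rec ?kn// mulrC mulKf.
  rewrite {2}/h Kk -!mulrA; congr (_ * (_ * _)); rewrite mulr_suml.
  rewrite !big_mkord; apply: eq_bigr => j _; rewrite gauss_binomE; last first.
    exact: ltnW.
  by rewrite /h; field; rewrite !qfact_neq0.
rewrite IH//; apply: eq_big_nat => c /andP[_]; rewrite ltnS => cn.
by rewrite gauss_binomE// /h; field; rewrite !qfact_neq0.
Qed.

End IgusaRecursion.

(** * The residue field of a discrete valuation ring *)

Section ResidueField.

(** A finite quotient of a ring by its nonunits, seen through a classifying
    map; the field structure is transported along this map. *)
Record residue_data (A : comUnitRingType) := ResidueData {
  rd_type : finType;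
  rd_map : A -> rd_type;
  rd_quotient : quotient_map (max_ideal (A := A)) rd_map }.

Definition residue (A : comUnitRingType) (d : residue_data A) : Type :=
  rd_type d.

Variables (A : comUnitRingType) (d : residue_data A).
Local Notation k := (residue d).
HB.instance Definition _ := Finite.copy k (rd_type d).

Definition residue_map (x : A) : k := rd_map d x.

Lemma residue_surj t : exists x, residue_map x == t.
Proof. by have [x <-] := proj1 (rd_quotient d) t; exists x. Qed.

Definition residue_lift (t : k) : A := xchoose (residue_surj t).

Lemma residue_liftK : cancel residue_lift residue_map.
Proof. by move=> t; apply/eqP; exact: (xchooseP (residue_surj t)). Qed.

Lemma residue_mapE x y :
  residue_map x = residue_map y <-> x - y \isn't a GRing.unit.
Proof. exact: (proj2 (rd_quotient d)). Qed.

Lemma nonunit_subgroup : subgroup (max_ideal (A := A)).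
Proof. exact: quotient_map_subgroup (rd_quotient d). Qed.

Lemma nonunitM (x y : A) : x \isn't a GRing.unit -> x * y \isn't a GRing.unit.
Proof. by rewrite unitrM => /negPf->. Qed.

Lemma residue_lift_sub x : residue_lift (residue_map x) - x \isn't a GRing.unit.
Proof. by apply/residue_mapE; rewrite residue_liftK. Qed.

Definition residue_add (t u : k) := residue_map (residue_lift t + residue_lift u).
Definition residue_opp (t : k) := residue_map (- residue_lift t).
Definition residue_mul (t u : k) := residue_map (residue_lift t * residue_lift u).
Definition residue_inv (t : k) := residue_map (residue_lift t)^-1.

Lemma residue_addE x y :
  residue_add (residue_map x) (residue_map y) = residue_map (x + y).
Proof.
apply/residue_mapE; rewrite opprD addrACA.
by apply: (subgroupD nonunit_subgroup); exact: residue_lift_sub.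
Qed.

Lemma residue_oppE x : residue_opp (residue_map x) = residue_map (- x).
Proof.
apply/residue_mapE; rewrite -opprD.
by apply: (subgroupN nonunit_subgroup); exact: residue_lift_sub.
Qed.

Lemma residue_mulE x y :
  residue_mul (residue_map x) (residue_map y) = residue_map (x * y).
Proof.
apply/residue_mapE; set x' := residue_lift _; set y' := residue_lift _.
have -> : x' * y' - x * y = (x' - x) * y' + (y' - y) * x by ring.
by apply: (subgroupD nonunit_subgroup); apply: nonunitM; exact: residue_lift_sub.
Qed.

Lemma residue_ind (Q : k -> Prop) : (forall x, Q (residue_map x)) -> forall t, Q t.
Proof. by move=> Qx t; rewrite -[t]residue_liftK. Qed.

Lemma residue_addA : associative residue_add.
Proof.
elim/residue_ind=> x; elim/residue_ind=> y; elim/residue_ind=> z.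
by rewrite !residue_addE addrA.
Qed.

Lemma residue_addC : commutative residue_add.
Proof.
by elim/residue_ind=> x; elim/residue_ind=> y; rewrite !residue_addE addrC.
Qed.

Lemma residue_add0 : left_id (residue_map 0) residue_add.
Proof. by elim/residue_ind=> x; rewrite residue_addE add0r. Qed.

Lemma residue_addN : left_inverse (residue_map 0) residue_opp residue_add.
Proof. by elim/residue_ind=> x; rewrite residue_oppE residue_addE addNr. Qed.

HB.instance Definition _ :=
  GRing.isZmodule.Build k residue_addA residue_addC residue_add0 residue_addN.

Lemma residue_mulA : associative residue_mul.
Proof.
elim/residue_ind=> x; elim/residue_ind=> y; elim/residue_ind=> z.
by rewrite !residue_mulE mulrA.
Qed.

Lemma residue_mulC : commutative residue_mul.
Proof.
by elim/residue_ind=> x; elim/residue_ind=> y; rewrite !residue_mulE mulrC.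
Qed.

Lemma residue_mul1 : left_id (residue_map 1) residue_mul.
Proof. by elim/residue_ind=> x; rewrite residue_mulE mul1r. Qed.

Lemma residue_mulD : left_distributive residue_mul +%R.
Proof.
have addE x y : residue_map x + residue_map y = residue_map (x + y).
  exact: residue_addE.
elim/residue_ind=> x; elim/residue_ind=> y; elim/residue_ind=> z.
by rewrite addE !residue_mulE addE mulrDl.
Qed.

Lemma residue_neq0 : residue_map 1 != 0.
Proof. by apply/eqP => /residue_mapE; rewrite subr0 unitr1. Qed.

HB.instance Definition _ := GRing.Zmodule_isComNzRing.Build k
  residue_mulA residue_mulC residue_mul1 residue_mulD residue_neq0.

Lemma residue_mapB : zmod_morphism residue_map.
Proof.
by move=> x y; rewrite -residue_addE -residue_oppE.
Qed.

Lemma residue_mapM : monoid_morphism residue_map.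
Proof. by split=> // x y; rewrite -residue_mulE. Qed.

HB.instance Definition _ :=
  GRing.isZmodMorphism.Build A k residue_map residue_mapB.
HB.instance Definition _ :=
  GRing.isMonoidMorphism.Build A k residue_map residue_mapM.

Lemma residue_mulV (t : k) : t != 0 -> residue_inv t * t = 1.
Proof.
move=> t0; rewrite -{2}[t]residue_liftK -rmorphM mulVr ?rmorph1//.
apply: contraNT t0 => nu; apply/eqP; rewrite -[t]residue_liftK.
by apply/residue_mapE; rewrite subr0.
Qed.

Lemma residue_inv0 : residue_inv 0 = 0.
Proof.
rewrite /residue_inv; apply/residue_mapE; rewrite subr0 unitrV -[residue_lift _]subr0.
by apply/residue_mapE; rewrite residue_liftK.
Qed.

HB.instance Definition _ :=
  GRing.ComNzRing_isField.Build k residue_mulV residue_inv0.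

End ResidueField.

Section ValuationRing.
Variable A : idomainType.
Implicit Types P Q I : set A.

Lemma mem_set_mem (T : Type) (I : set T) x : reflect (I x) (x \in mem I).
Proof. by apply: (iffP idP) => [/set_mem|/mem_set]. Qed.

Lemma idealr_closedP I : idealr_closed (mem I) <->
  [/\ I 0, ~ I 1 & forall a u v, I u -> I v -> I (a * u + v)].
Proof.
split=> [[/mem_set_mem I0 /negP I1 Icl]|[I0 I1 Icl]]; split=> //.
- by move=> /mem_set_mem.
- by move=> a u v /mem_set_mem Iu /mem_set_mem Iv; exact/mem_set_mem/Icl.
- exact/mem_set_mem.
- by apply/negP => /mem_set_mem.
- by move=> a u v /mem_set_mem Iu /mem_set_mem Iv; exact/mem_set_mem/Icl.
Qed.

Lemma prime_idealr_closedP I : prime_idealr_closed (mem I) <->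
  forall u v, I (u * v) -> I u \/ I v.
Proof.
split=> Ip u v.
  by move=> /mem_set_mem/Ip/orP[] /mem_set_mem; [left | right].
by move=> /mem_set_mem/Ip[] /mem_set_mem ->; rewrite ?orbT.
Qed.

(** Krull's theorem: an ideal maximal among the proper ideals containing x is
    prime. *)
Lemma prime_ideal_containing (x : A) : x \isn't a GRing.unit ->
  exists P, [/\ idealr_closed (mem P), prime_idealr_closed (mem P) & P x].
Proof.
move=> xN.
pose fam I := I = set0 \/ idealr_closed (mem I) /\ I x.
have fam_chain (F : set (set A)) : F `<=` fam -> total_on F subset ->
    fam (\bigcup_(X in F) X).
  move=> Ffam Ftot; case: (pselect (exists2 I, F I & I <> set0)); last first.
    move=> F0; left; apply/seteqP; split=> // y [I FI Iy]; case: F0.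
    by exists I => // I0; move: Iy; rewrite I0.
  move=> [I FI I0]; right.
  have [//|[/idealr_closedP[I_0 _ _] Ix]] := Ffam _ FI.
  split; last by exists I.
  apply/idealr_closedP; split; first by exists I.
    move=> [J FJ J1]; have [J0|[/idealr_closedP[_ + _] _]] := Ffam _ FJ.
      by rewrite J0 in J1.
    by apply.
  move=> a u v [J FJ Ju] [J' FJ' J'v].
  have [K FK [Ku Kv]] : exists2 K, F K & K u /\ K v.
    have [JJ'|J'J] := Ftot _ _ FJ FJ'; [exists J' | exists J] => //; split=> //.
      exact: JJ'.
    exact: J'J.
  have [K0|[/idealr_closedP[_ _ Kcl] _]] := Ffam _ FK; first by rewrite K0 in Ku.
  by exists K => //; apply: Kcl.
have [P [famP maxP]] := Zorn_bigcup fam_chain.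
pose gen Q (u : A) : set A := [set y | exists r, Q (y - r * u)].
have gen_ideal Q u : Q 0 -> (forall a v w, Q v -> Q w -> Q (a * v + w)) ->
    ~ gen Q u 1 -> idealr_closed (mem (gen Q u)).
  move=> Q0 Qcl g1; apply/idealr_closedP; split=> //.
    by exists 0; rewrite mul0r subr0.
  move=> a v w [r Qv] [t Qw]; exists (a * r + t).
  have -> : a * v + w - (a * r + t) * u = a * (v - r * u) + (w - t * u) by ring.
  exact: Qcl.
have [P_closed Px] : idealr_closed (mem P) /\ P x.
  case: famP => // P0; exfalso.
  have gx : gen [set 0] x x by exists 1; rewrite mul1r subrr.
  apply: (maxP (gen [set 0] x)).
    by rewrite P0; split=> // /(_ x gx).
  right; split=> //; apply: gen_ideal => // [a v w -> ->|[r /eqP]].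
    by rewrite mulr0 addr0.
  rewrite subr_eq0 => /eqP rx; move: xN.
  by have := unitr1 A; rewrite rx unitrM => /andP[_ ->].
exists P; split=> //; apply/prime_idealr_closedP => u v Puv.
move/idealr_closedP: P_closed => [P0 P1 Pcl].
case: (pselect (P u)) => [|Pu]; [by left | right; apply: contrapT => Pv].
have gP1 : ~ gen P u 1.
  move=> [r Pr]; apply: Pv.
  have -> : v = v * (1 - r * u) + (r * (u * v) + 0) by ring.
  by apply: (Pcl _ _ _ Pr); apply: Pcl.
have gu : gen P u u by exists 1; rewrite mul1r subrr.
apply: (maxP (gen P u)).
  split=> [y Py|/(_ u gu)//]; by exists 0; rewrite mul0r subr0.
right; split; first exact: gen_ideal.
by exists 0; rewrite mul0r subr0.
Qed.

Lemma discrete_valuation_residue q : discrete_valuation_ring A ->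
  (cosets (@max_ideal A) #= `I_q)%card ->
  exists (k : finFieldType) (rho : {rmorphism A -> k}) (pi : A),
    [/\ pi != 0, forall x, rho x = 0 <-> exists y, x = pi * y,
        forall t, exists x, rho x = t,
        forall x, rho x != 0 -> x \is a GRing.unit & #|k| = q].
Proof.
move=> [pid [P [[P_ideal P_prime P_neq0] P_uniq]]] card_q.
have /idealr_closedP[P0 P1 Pcl] := P_ideal.
have nonunitP x : x \isn't a GRing.unit <-> P x.
  split=> [xN|Px].
    have [->//|x0] := eqVneq x 0.
    have [Q [Q_ideal Q_prime Qx]] := prime_ideal_containing xN.
    rewrite (P_uniq Q)//; split=> // Q0.
    by move: Qx x0; rewrite Q0 => ->; rewrite eqxx.
  apply/negP => xU; apply: P1.
  by have := Pcl x^-1 _ _ Px P0; rewrite addr0 mulVr.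
have [pi P_pi] := pid _ P_ideal.
have nonunit_group : subgroup (@max_ideal A).
  split=> [|x y /nonunitP Px /nonunitP Py]; first exact/nonunitP.
  by apply/nonunitP; rewrite addrC -mulN1r; exact: Pcl.
have fin : finite_index (@max_ideal A).
  by apply/finite_setP; exists q.
have [T [c [cP cardT]]] := finite_has_index nonunit_group fin.
pose d := ResidueData cP.
have rhoE x : residue_map d x = 0 <-> x \isn't a GRing.unit.
  by have := residue_mapE d x 0; rewrite subr0.
exists (residue d), (residue_map d), pi; split.
- apply/eqP => pi0; apply: P_neq0; rewrite P_pi pi0; apply/seteqP.
  split=> [_ [y _ <-]|_ ->]; first by rewrite /= mul0r.
  by exists 0 => //; rewrite /= mul0r.
- move=> x; rewrite rhoE nonunitP P_pi; split=> [[y _ <-]|[y ->]]; by exists y.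
- by move=> t; have [x /eqP] := residue_surj t; exists x.
- by move=> x; apply: contraNT => xN; apply/eqP/rhoE.
- have -> : q = #|T| by rewrite cardT -(card_fset_set card_q).
  by apply: (@bij_eq_card (residue d) T (fun x => x)); exists (fun x => x).
Qed.

End ValuationRing.

(** * Counting subspaces over a finite field *)

Section SubspaceCount.
Local Open Scope set_scope.
Local Notation inset := finset.in_set.
Variable k : finFieldType.
Local Notation q := #|k|.

Lemma card_submx m n (M : 'M[k]_(m, n)) :
  #|[set v : 'rV[k]_n | (v <= M)%MS]| = (q ^ \rank M)%N.
Proof.
pose h (w : 'rV[k]_(\rank M)) := w *m row_base M.
have h_inj : injective h by apply: row_free_inj; exact: row_base_free.
have -> : [set v : 'rV[k]_n | (v <= M)%MS] = h @: [set: 'rV[k]_(\rank M)].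
  apply/finset.setP => v; rewrite inset -(eq_row_base M).
  apply/submxP/imsetP => [[w ->]|[w _ ->]]; last by exists w.
  by exists w; rewrite ?finset.in_setT.
by rewrite card_imset// cardsT card_mx mul1n.
Qed.

Lemma mxrank_adds_row m n (v : 'rV[k]_n) (M : 'M[k]_(m, n)) :
  \rank (v + M)%MS = (~~ (v <= M)%MS + \rank M)%N.
Proof.
case: (boolP (v <= M)%MS) => vM.
  by rewrite add0n (addsmx_idPr vM).
have [le1 _] := mxrank_adds_leqif v M; have := rank_leq_row v.
have [le2 eq2] := mxrank_leqif_sup (addsmxSr v M).
rewrite addsmx_sub (negPf vM)/= in eq2.
by move/eqP: eq2 le1 le2; set a := \rank (v + M)%MS; lia.
Qed.

(** The number of ways of extending U by r vectors independent modulo U: the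
    i-th vector avoids a space of dimension \rank U + i. *)
Lemma card_extensions m n (U : 'M[k]_(m, n)) r :
  #|[set B : 'M[k]_(r, n) | \rank (B + U)%MS == (r + \rank U)%N]| =
  (\prod_(i < r) (q ^ n - q ^ (\rank U + i)))%N.
Proof.
elim: r => [|r IHr].
  rewrite big_ord0; apply/eqP/cards1P; exists 0; apply/finset.setP => B.
  by rewrite inset [B]flatmx0 adds0mx add0n eqxx finset.in_set1 eqxx.
rewrite big_ord_recr/= -IHr.
set X := [set B : 'M[k]_(r, n) | _].
pose Y (B : 'M[k]_(r, n)) := [set v : 'rV[k]_n | ~~ (v <= B + U)%MS].
have rankS (v : 'rV[k]_n) (B : 'M[k]_(r, n)) :
    (\rank (col_mx v B + U)%MS == r.+1 + \rank U)%N = (B \in X) && (v \in Y B).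
  have -> : \rank (col_mx v B + U)%MS = \rank (v + (B + U))%MS.
    by rewrite addsmxA (adds_eqmx (addsmxE v B) (eqmx_refl U)).
  rewrite !inset mxrank_adds_row.
  have [le1 _] := mxrank_adds_leqif B U; have le2 := rank_leq_row B.
  move: le1 le2; set a := \rank (B + U)%MS; set b := \rank B.
  by case: (v <= B + U)%MS => /=; lia.
have cardY B : B \in X -> #|Y B| = (q ^ n - q ^ (\rank U + r))%N.
  rewrite inset => /eqP rB.
  have -> : Y B = ~: [set v | (v <= B + U)%MS] by apply/finset.setP => v;
    rewrite !inset.
  by rewrite cardsCs finset.setCK card_mx mul1n card_submx rB addnC.
pose h (x : 'M[k]_(r, n) * 'rV[k]_n) : 'M[k]_(r.+1, n) := col_mx x.2 x.1.
have h_inj : injective h.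
  by move=> [B v] [B' v']; rewrite /h/= => e;
    have [-> ->] := @eq_col_mx _ 1 r n _ _ _ _ e.
transitivity #|h @: [set x : 'M[k]_(r, n) * 'rV[k]_n | (x.1 \in X) && (x.2 \in Y x.1)]|.
  congr #|pred_of_set _|; apply/finset.setP => B; rewrite inset.
  apply/idP/imsetP => [rB|[[B' v] + ->]]; last by rewrite inset /= -rankS.
  exists (@dsubmx _ 1 r n B, @usubmx _ 1 r n B); last by rewrite /h/= vsubmxK.
  by rewrite inset/= -rankS vsubmxK.
rewrite card_imset// -sum1dep_card (eq_bigl (fun x =>
  (x.1 \in X) && (x.2 \in Y x.1)))//.
rewrite -(pair_big_dep (fun B => B \in X) (fun B v => v \in Y B) (fun _ _ => 1%N))/=.
rewrite (eq_bigr (fun=> (q ^ n - q ^ (\rank U + r))%N)); last first.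
  by move=> B XB; rewrite sum1_card cardY.
by rewrite sum_nat_const.
Qed.

Lemma card_bases n (A : 'M[k]_n) :
  #|[set B : 'M[k]_(\rank A, n) | (B == A)%MS && row_free B]| =
  (\prod_(i < \rank A) (q ^ \rank A - q ^ i))%N.
Proof.
set r := \rank A; pose U0 : 'M[k]_(0, r) := 0.
have rU0 : \rank U0 = 0%N by rewrite mxrank0.
have := card_extensions U0 r; rewrite rU0 => <-.
pose h (G : 'M[k]_r) := G *m row_base A.
have h_inj : injective h by apply: row_free_inj; exact: row_base_free.
rewrite -[RHS](card_imset _ h_inj); congr #|pred_of_set _|.
apply/finset.setP => B; rewrite inset; apply/andP/imsetP => [[BA rB]|[G + ->]].
  have [G BE] : exists G, B = G *m row_base A.
    by apply/submxP; rewrite eq_row_base; case/andP: BA.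
  exists G; rewrite // inset addn0 (addsmx_idPl _) ?flatmx0 ?sub0mx//.
  by rewrite eqn_leq rank_leq_row/= -{1}(eqP rB) BE mxrankM_maxl.
rewrite inset addn0 (addsmx_idPl _) ?flatmx0 ?sub0mx// => rG.
have hA : (h G :=: A)%MS.
  apply: eqmx_trans (eq_row_base A); apply: eqmxMfull.
  by rewrite -[row_full _]/(\rank G == r).
by split; [apply/eqmxP | rewrite /row_free hA].
Qed.

Lemma card_subspaces m n (U : 'M[k]_(m, n)) r :
  (#|[set A : 'M[k]_n | [&& (<<A>>%MS == A), \rank A == r &
        (A :&: U)%MS == 0%R]]| * \prod_(i < r) (q ^ r - q ^ i) =
   \prod_(i < r) (q ^ n - q ^ (\rank U + i)))%N.
Proof.
rewrite -card_extensions; set D := finset _; set X := finset _.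
have XP B : (B \in X) = row_free B && ((B :&: U)%MS == 0).
  rewrite inset /row_free -mxrank_eq0.
  have := mxrank_sum_cap B U; have := rank_leq_row B.
  set a := \rank (B + U)%MS; set b := \rank B; set c := \rank (B :&: U)%MS; lia.
rewrite -[RHS]sum1_card (partition_big (fun B => <<B>>%MS) (fun A => A \in D)) /=.
  rewrite -sum_nat_const; apply: eq_bigr => A; rewrite inset => /and3P[gA rA AU].
  have <- : #|[set B : 'M[k]_(r, n) | (B == A)%MS && row_free B]| =
      (\prod_(i < r) (q ^ r - q ^ i))%N.
    by rewrite -(eqP rA); exact: card_bases.
  rewrite sum1dep_card; apply: eq_card => B; rewrite inset [RHS]inset XP.
  have -> : (<<B>>%MS == A) = (B == A)%MS.
    by rewrite -{1}(eqP gA); apply/eqP/idP => /genmxP.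
  case: (boolP (B == A)%MS) => [/eqmxP BA|_]; last by rewrite andbF.
  rewrite andbT/=; have -> : (B :&: U)%MS = 0; last by rewrite eqxx andbT.
  by apply/eqP; rewrite -mxrank_eq0 (cap_eqmx BA (eqmx_refl U)) mxrank_eq0.
move=> B; rewrite XP inset => /andP[rB BU].
rewrite genmx_id eqxx mxrank_gen -/(row_free B) rB -mxrank_eq0/=.
by rewrite (cap_eqmx (genmxE B) (eqmx_refl U)) mxrank_eq0.
Qed.

End SubspaceCount.

(** * Submodules and their reductions *)

(** The ring enters only through reduction modulo a uniformizer and through the
    invertibility of the elements that survive it. *)
Record uniformized (o : idomainType) := Uniformized {
  res_field : finFieldType;
  res_map : {rmorphism o -> res_field};
  uniformizer : o;
  uniformizer_neq0 : uniformizer != 0;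
  res_eq0 : forall x, res_map x = 0 <-> exists y, x = uniformizer * y;
  res_surj : forall t, exists x, res_map x = t;
  res_unit : forall x, res_map x != 0 -> x \is a GRing.unit }.

Arguments res_eq0 {o} u x.
Arguments res_surj {o} u t.
Arguments res_unit {o} u [x] _.

Definition submod (A : nzRingType) (V : lmodType A) (M : set V) :=
  M 0 /\ forall a x y, M x -> M y -> M (a *: x + y).

Section Submodules.
Variables (A : nzRingType) (V : lmodType A).
Implicit Types M : set V.

Lemma submodP M : GRing.submod_closed (mem M) <-> submod M.
Proof.
split=> [[/mem_set_mem M0 Mcl]|[M0 Mcl]]; split=> //.
- by move=> a x y /mem_set_mem Mx /mem_set_mem My; exact/mem_set_mem/Mcl.
- exact/mem_set_mem.
- by move=> a x y /mem_set_mem Mx /mem_set_mem My; exact/mem_set_mem/Mcl.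
Qed.

Lemma submodZ M a x : submod M -> M x -> M (a *: x).
Proof. by move=> [M0 Mcl] Mx; rewrite -[_ *: _]addr0; exact: Mcl. Qed.

Lemma submodD M x y : submod M -> M x -> M y -> M (x + y).
Proof. by move=> [M0 Mcl] Mx My; rewrite -[x]scale1r; exact: Mcl. Qed.

Lemma submod_subgroup M : submod M -> subgroup M.
Proof.
move=> [M0 Mcl]; split=> // x y Mx My.
by rewrite addrC -scaleN1r; exact: Mcl.
Qed.

Lemma submod_sum M (I : Type) (r : seq I) (P : pred I) (F : I -> V) :
  submod M -> (forall i, P i -> M (F i)) -> M (\sum_(i <- r | P i) F i).
Proof.
move=> sM FM; elim/big_ind: _ => //; first exact: (proj1 sM).
by move=> x y; exact: submodD.
Qed.

Lemma submod_preimage (W : lmodType A) (f : {linear W -> V}) M :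
  submod M -> submod (f @^-1` M).
Proof.
move=> [M0 Mcl]; split=> [|a x y Mx My]; rewrite /= ?linear0 ?linearP//.
exact: Mcl.
Qed.

End Submodules.

Section Echelon.
Variables (o : idomainType) (u : uniformized o).
Local Notation k := (res_field u).
Local Notation rho := (res_map u).
Local Notation pi := (uniformizer u).

Definition submod_red n (L : set 'rV[o]_n) : set 'rV[k]_n := map_mx rho @` L.

Lemma red_surj m n (v : 'M[k]_(m, n)) : exists x : 'M[o]_(m, n), map_mx rho x = v.
Proof.
have [f fP] := choice (fun t => res_surj u t).
by exists (map_mx f v); apply/matrixP => i j; rewrite !mxE fP.
Qed.

Lemma red_eq0 m n (x : 'M[o]_(m, n)) :
  map_mx rho x = 0 -> exists y, x = pi *: y.
Proof.
move=> x0.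
have /choice[f fP] : forall ij : 'I_m * 'I_n, exists y, x ij.1 ij.2 = pi * y.
  by move=> [i j]; apply/(res_eq0 u); move/matrixP/(_ i j): x0; rewrite !mxE.
exists (\matrix_(i, j) f (i, j)); apply/matrixP => i j.
by rewrite !mxE -fP.
Qed.

Lemma red_pi m n (y : 'M[o]_(m, n)) : map_mx rho (pi *: y) = 0.
Proof.
apply/matrixP => i j; rewrite !mxE rmorphM.
have -> : rho pi = 0 by apply/(res_eq0 u); exists 1; rewrite mulr1.
by rewrite mul0r.
Qed.

(** Subspaces of k^n are represented by matrices, in order to use ranks and
    pivots. *)
Lemma submod_red_mx n (L : set 'rV[o]_n) : submod L ->
  exists A : 'M[k]_n, forall v, (v <= A)%MS <-> submod_red L v.
Proof.
move=> sL; pose S := [pred v | `[< submod_red L v >]].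
pose A := \matrix_(i < #|S|) (enum_val i : 'rV[k]_n).
have SP v : v \in S <-> submod_red L v by rewrite inE; split=> /asboolP.
exists <<A>>%MS => v; rewrite genmxE; split=> [/submxP[c ->]|/SP Sv].
  rewrite mulmx_sum_row.
  have : forall i, exists x, L x /\ map_mx rho x = row i A.
    move=> i; have /SP[x Lx xi] := enum_valP i.
    by exists x; split; rewrite ?rowK.
  move=> /choice[x xP]; have [d dP] := red_surj c.
  exists (\sum_i d 0 i *: x i).
    by apply: submod_sum => // i _; apply: submodZ => //; exact: (xP i).1.
  rewrite raddf_sum; apply: eq_bigr => i _ /=.
  by rewrite map_mxZ (xP i).2 -dP mxE.
have -> : v = row (enum_rank_in Sv v) A by rewrite rowK enum_rankK_in.
exact: row_sub.
Qed.

(** J is the set of pivots of a row echelon form of L modulo pi, lifted to L: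
    the rows of 1 + N indexed by J lie in L, and generate it modulo pi. *)
Record echelon n (L : set 'rV[o]_n) (J : {set 'I_n}) (N : 'M[o]_n) : Prop :=
  Echelon {
    echelon_supp : forall j i, ~~ ((j \in J) && (i \notin J)) -> N j i = 0;
    echelon_row : forall j, j \in J -> L (row j (1%:M + N));
    echelon_red : forall x, L x -> forall i, i \notin J ->
      rho (x 0 i) = rho ((x *m N) 0 i) }.

(** The pivots come from an invertible maximal minor of the reduction of L. The
    same minor of a lift to L has a unit determinant, so the lift can be
    normalized over the ring itself, not only modulo pi. *)
Lemma echelon_exists n (L : set 'rV[o]_n) : submod L ->
  exists J N, echelon L J N.
Proof.
move=> sL; have [A AP] := submod_red_mx sL.
set r := \rank A; pose B : 'M[k]_(r, n) := row_base A.
have [f f_inj fU] : exists2 f : 'I_r -> 'I_n, injective f &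
    colsub f B \in unitmx.
  have BT : row_full B^T by rewrite /row_full mxrank_tr; exact: row_base_free.
  exists (fullrankfun BT); first exact: fullrankfun_inj.
  rewrite -unitmx_tr; have -> : (colsub (fullrankfun BT) B)^T =
      rowsub (fullrankfun BT) B^T by apply/matrixP => i j; rewrite !mxE.
  exact: fullrowsub_unit.
have [U rowU redU] : exists2 U : 'M[o]_(r, n), forall a, L (row a U) &
    map_mx rho U = B.
  have : forall a, exists x, L x /\ map_mx rho x = row a B.
    move=> a; have /AP[x Lx xa] : (row a B <= A)%MS.
      by rewrite -(eq_row_base A) row_sub.
    by exists x.
  move=> /choice[x xP]; exists (\matrix_a x a) => [a|].
    by rewrite rowK; exact: (xP a).1.
  by apply/row_matrixP => a; rewrite -map_row rowK (xP a).2.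
have cU : colsub f U \in unitmx.
  rewrite unitmxE; apply: (res_unit u).
  by rewrite -det_map_mx map_mxsub redU -unitfE -unitmxE.
pose V := invmx (colsub f U) *m U.
have rowV a : L (row a V).
  rewrite row_mul mulmx_sum_row; apply: submod_sum => // i _.
  exact: submodZ.
have fV : colsub f V = 1%:M.
  by rewrite /V -mulmx_colsub mulVmx.
have Vf a b : V a (f b) = (a == b)%:R.
  by move/matrixP/(_ a b): fV; rewrite !mxE.
have redV : (map_mx rho V :=: A)%MS.
  apply: eqmx_trans (eq_row_base A); apply: eqmx_sym.
  have -> : row_base A = colsub f B *m map_mx rho V.
    by rewrite -/B -redU -map_mxsub -map_mxM mulKVmx.
  by apply: eqmxMfull; rewrite row_full_unit.
clearbody V.
pose J := f @: 'I_r.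
pose N : 'M[o]_n := \matrix_(j, i)
  if i \in J then 0 else \sum_(a | f a == j) V a i.
have fJ a : f a \in J by exact: imset_f.
have Nf a i : i \notin J -> N (f a) i = V a i.
  move=> iJ; rewrite mxE (negPf iJ) (big_pred1 a)// => b.
  by rewrite (inj_eq f_inj).
exists J, N; split.
- move=> j i; rewrite mxE; case: ifP => // iJ; rewrite andbT => jJ.
  rewrite big1// => a /eqP fa; by rewrite -fa fJ in jJ.
- move=> j /imsetP[a _ ->].
  have <- : row a V = row (f a) (1%:M + N); last exact: rowV.
  apply/rowP => i; rewrite !mxE; case: ifP => [|iJ].
    by move=> /imsetP[b _ ->]; rewrite Vf (inj_eq f_inj) addr0.
  have -> : (f a == i) = false.
    by apply/negbTE; apply: contraFneq iJ => <-.
  by rewrite add0r -Nf ?iJ// mxE iJ.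
move=> x Lx i iJ.
have /submxP[c xc] : (map_mx rho x <= map_mx rho V)%MS.
  by rewrite redV; apply/AP; exists x.
have xf a : rho (x 0 (f a)) = c 0 a.
  move/matrixP/(_ 0 (f a)): xc; rewrite !mxE => ->.
  rewrite (bigD1 a)//= big1 => [|b ba]; rewrite mxE Vf ?eqxx ?(negPf ba).
    by rewrite rmorph1 mulr1 addr0.
  by rewrite rmorph0 mulr0.
rewrite mxE rmorph_sum (bigID (mem J))/= [X in _ + X]big1 ?addr0; last first.
  move=> j jJ; rewrite mxE (negPf iJ) big1 ?mulr0 ?rmorph0// => a /eqP fa.
  by rewrite -fa fJ in jJ.
rewrite big_imset/=; last by move=> a b _ _; exact: f_inj.
move/matrixP/(_ 0 i): xc; rewrite !mxE => ->.
by apply: eq_bigr => a _; rewrite Nf// rmorphM xf mxE.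
Qed.

End Echelon.

(** * Lattices and division by the uniformizer *)

Section Lattices.
Variables (o : idomainType) (u : uniformized o).
Local Notation k := (res_field u).
Local Notation rho := (res_map u).
Local Notation pi := (uniformizer u).
Local Notation q := #|res_field u|.

Lemma res_uniformizer : rho pi = 0.
Proof. by apply/(res_eq0 u); exists 1; rewrite mulr1. Qed.

Lemma card_res_gt1 : (1 < q)%N.
Proof. by rewrite (cardD1 0) (cardD1 1) !inE oner_eq0. Qed.

(** The subgroup L + pi V. *)
Definition mod_uniformizer (V : lmodType o) (L : set V) : set V :=
  sum_range ( *:%R pi : {additive V -> V}) L.

(** Division by pi shortens every elementary divisor of L by one step; lattices
    are studied by iterating it, which replaces the elementary divisor theorem. *)
Definition pi_div (V : lmodType o) (L : set V) : set V :=
  [set x | L (pi *: x)].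

Definition lattice (V : lmodType o) (L : set V) := submod L /\ finite_index L.

Lemma latticeP (V : lmodType o) (L : set V) :
  finite_index_submodules L <-> lattice L.
Proof. by split=> [[/submodP]|[sL fL]] //; split=> //; apply/submodP. Qed.

Section AnyModule.
Variable V : lmodType o.
Implicit Types L : set V.

Lemma submod_pi_div L : submod L -> submod (pi_div L).
Proof.
move=> [L0 Lcl]; split=> [|a x y Lx Ly]; rewrite /pi_div/= ?scaler0//.
by rewrite scalerDr scalerA mulrC -scalerA; exact: Lcl.
Qed.

Lemma sub_pi_div L : submod L -> L `<=` pi_div L.
Proof. by move=> sL x Lx; exact: submodZ. Qed.

Lemma index_pi_div L a b : submod L ->
  has_index (mod_uniformizer L) a -> has_index (pi_div L) b ->
  has_index L (a * b).
Proof. by move=> /submod_subgroup gL; exact: index_split. Qed.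

Lemma lattice_index L : lattice L -> has_index L (subgroup_index L).
Proof. by move=> [/submod_subgroup gL fL]; exact: finite_has_index. Qed.

Lemma latticeT : lattice [set: V].
Proof.
split; first by split.
exact: (has_index_finite (has_index_setT V)).1.
Qed.

Lemma subgroup_indexT : subgroup_index [set: V] = 1%N.
Proof. exact: (has_index_finite (has_index_setT V)).2. Qed.

Lemma lattice_pi_div L : lattice L -> lattice (pi_div L).
Proof.
move=> latL; have [sL _] := latL; split; first exact: submod_pi_div.
have [a [b [_ + _]]] := index_split_inv ( *:%R pi : {additive V -> V})
  (submod_subgroup sL) (lattice_index latL).
by move=> /has_index_finite[].
Qed.

End AnyModule.

Section RowSpace.
Variable n : nat.
Implicit Types (L : set 'rV[o]_n) (J : {set 'I_n}) (N : 'M[o]_n).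

Lemma echelon_mulmx L J N (x : 'rV[o]_n) i : echelon u L J N ->
  (x *m N) 0 i = if i \in J then 0 else \sum_(j in J) x 0 j * N j i.
Proof.
move=> eL; rewrite mxE; case: ifP => iJ.
  by rewrite big1// => j _; rewrite (echelon_supp eL) ?iJ ?andbF ?mulr0.
rewrite [LHS](bigID (mem J))/= [X in _ + X]big1 ?addr0// => j jJ.
by rewrite (echelon_supp eL) ?mulr0// (negPf jJ).
Qed.

Lemma echelon_lift L J N (x : 'rV[o]_n) : submod L -> echelon u L J N ->
  L (\sum_(j in J) x 0 j *: row j (1%:M + N)).
Proof.
move=> sL eL; apply: submod_sum => // j jJ.
by apply: submodZ => //; exact: (echelon_row eL).
Qed.

Lemma echelon_liftE L J N (x : 'rV[o]_n) i : echelon u L J N ->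
  (\sum_(j in J) x 0 j *: row j (1%:M + N)) 0 i =
  if i \in J then x 0 i else (x *m N) 0 i.
Proof.
move=> eL; rewrite summxE.
rewrite (eq_bigr (fun j => x 0 j * (j == i)%:R + x 0 j * N j i)); last first.
  by move=> j _; rewrite !mxE mulrDr.
rewrite big_split/=; case: ifP => iJ.
  rewrite [X in _ + X]big1 ?addr0 => [|j _]; last first.
    by rewrite (echelon_supp eL) ?iJ ?andbF ?mulr0.
  rewrite (bigD1 i)//= eqxx mulr1 big1 ?addr0// => j /andP[_ /negPf->].
  by rewrite mulr0.
rewrite (echelon_mulmx _ _ eL) iJ [X in X + _]big1 ?add0r// => j jJ;
  case: eqP => [ji|_]; last by rewrite mulr0.
by rewrite -ji jJ in iJ.
Qed.

Lemma echelon_modP L J N (x : 'rV[o]_n) : submod L -> echelon u L J N ->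
  mod_uniformizer L x <->
  forall i, i \notin J -> rho (x 0 i) = rho ((x *m N) 0 i).
Proof.
move=> sL eL; split=> [[z Lz] i iJ|x_red].
  have := echelon_red eL Lz iJ; rewrite mulmxBl -scalemxAl !mxE.
  by rewrite !(rmorphB, rmorphM) res_uniformizer !mul0r !subr0.
set y := \sum_(j in J) x 0 j *: row j (1%:M + N).
have [z zE] : exists z, x - y = pi *: z.
  apply: red_eq0; apply/rowP => i; rewrite !mxE (echelon_liftE _ _ eL).
  by case: ifPn => iJ; rewrite rmorphB ?subrr// x_red// subrr.
exists z; rewrite /= -zE opprB addrC subrK.
exact: echelon_lift.
Qed.

Lemma echelon_index L J N : submod L -> echelon u L J N ->
  has_index (mod_uniformizer L) (q ^ #|~: J|).
Proof.
move=> sL eL; pose T := {ffun {i | i \notin J} -> k}.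
pose c (x : 'rV[o]_n) : T := [ffun i => rho ((x - x *m N) 0 (val i))].
exists T, c; split; last first.
  rewrite card_ffun card_sig; congr (_ ^ _)%N.
  by apply: eq_card => i; rewrite [RHS]finset.in_setC.
split=> [t|x y].
  have [s sP] := choice (res_surj u).
  exists (\row_i if insub i is Some i' then s (t i') else 0).
  apply/ffunP => i; rewrite ffunE; set x := \row__ _.
  have -> : (x - x *m N) 0 (val i) = x 0 (val i).
    rewrite mxE [X in _ + X]mxE (echelon_mulmx _ _ eL) (negPf (valP i)).
    rewrite big1 ?subr0// => j jJ; rewrite mxE insubF ?mul0r//.
    by rewrite jJ.
  by rewrite mxE valK sP.
have swap (a b c' d : k) : (a - b == c' - d) = (a - c' == b - d).
  by rewrite !subr_eq addrAC [c' + b]addrC addrAC.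
rewrite (echelon_modP _ sL eL); split=> [/ffunP cxy i iJ|xy].
  have /eqP := cxy (Sub i iJ); rewrite !ffunE/= mulmxBl !mxE !rmorphB.
  by rewrite swap => /eqP.
apply/ffunP => -[i iJ]; rewrite !ffunE/=; have /eqP := xy i iJ.
by rewrite mulmxBl !mxE !rmorphB -swap => /eqP.
Qed.

(** The dimension of o^n / (L + pi o^n) over the residue field. *)
Definition corank L := trunc_log q (subgroup_index (mod_uniformizer L)).

Lemma echelon_corank L J N : submod L -> echelon u L J N -> corank L = #|~: J|.
Proof.
move=> sL /(echelon_index sL)/has_index_finite[_ idx].
by rewrite /corank idx trunc_expnK ?card_res_gt1.
Qed.

Lemma corank_index L : submod L -> has_index (mod_uniformizer L) (q ^ corank L).
Proof.
move=> sL; have [J [N eL]] := echelon_exists u sL.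
by rewrite (echelon_corank sL eL); exact: (echelon_index sL eL).
Qed.

Lemma corank_le L : submod L -> (corank L <= n)%N.
Proof.
move=> sL; have [J [N eL]] := echelon_exists u sL.
by rewrite (echelon_corank sL eL) (leq_trans (max_card _))// card_ord.
Qed.

(** Nakayama's lemma. *)
Lemma corank0 L : submod L -> corank L = 0%N -> L = setT.
Proof.
move=> sL; have [J [N eL]] := echelon_exists u sL.
rewrite (echelon_corank sL eL) => /cards0_eq J0.
have JT i : i \in J by rewrite -[J]finset.setCK J0 !inE.
apply/seteqP; split=> // x _.
have -> : x = \sum_(j in J) x 0 j *: row j (1%:M + N).
  by apply/rowP => i; rewrite (echelon_liftE _ _ eL) JT.
exact: echelon_lift.
Qed.

Lemma corankT : corank [set: 'rV[o]_n] = 0%N.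
Proof.
have sT : submod [set: 'rV[o]_n] by split.
have := corank_index sT; have -> : mod_uniformizer [set: 'rV[o]_n] = setT.
  by apply/seteqP; split=> // x _; exists 0.
move=> /has_index_unique/(_ (has_index_setT _)) /(@expnI _ card_res_gt1 _ 0).
by [].
Qed.

Lemma lattice_index_pi_div L : lattice L ->
  subgroup_index L = (q ^ corank L * subgroup_index (pi_div L))%N.
Proof.
move=> latL; have [sL _] := latL.
apply: has_index_unique (lattice_index latL) _.
by apply: index_pi_div (corank_index sL) (lattice_index (lattice_pi_div latL)).
Qed.

(** Dividing by the uniformizer decreases the index, until the whole space is
    reached. *)
Lemma lattice_ind (Q : set 'rV[o]_n -> Prop) : Q setT ->
  (forall L, lattice L -> (0 < corank L)%N -> Q (pi_div L) -> Q L) ->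
  forall L, lattice L -> Q L.
Proof.
move=> QT QS L; have [l] := ubnP (subgroup_index L).
elim: l L => // l IHl L; rewrite ltnS => leL latL.
have [c0|c_gt0] := posnP (corank L).
  by rewrite (corank0 _ c0)//; exact: latL.1.
apply: QS => //; apply: IHl; last exact: lattice_pi_div.
apply: leq_trans leL; rewrite (lattice_index_pi_div latL) ltn_Pmull//.
  by rewrite -(exp1n (corank L)) ltn_exp2r// card_res_gt1.
exact: has_index_gt0 (lattice_index (lattice_pi_div latL)).
Qed.

(** In the coordinates of a basis of pi_div L, the lattice L contains pi o^n, and
    then the pivot rows together with pi times the remaining basis vectors form
    a basis of it. *)
Lemma lattice_basis L : lattice L -> exists B : 'M[o]_n,
  (forall x : 'rV[o]_n, x *m B = 0 -> x = 0) /\ L = range (mulmxr B).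
Proof.
elim/lattice_ind => [|L' latL' _ [B [B_inj BE]]].
  exists 1%:M; split=> [x|]; first by rewrite mulmx1.
  by apply/seteqP; split=> // x _; exists x; rewrite //= mulmx1.
have [sL _] := latL'.
pose M : set 'rV[o]_n := [set y | L' (y *m B)].
have sM : submod M := submod_preimage (mulmxr B) sL.
have piM y : M (pi *: y).
  rewrite /M/= -scalemxAl; have : pi_div L' (y *m B) by rewrite BE; exists y.
  by [].
have [J [N eM]] := echelon_exists u sM.
pose d (i : 'I_n) := if i \in J then 1 else pi.
pose h (y : 'rV[o]_n) : 'rV[o]_n := \row_i (y 0 i * d i + (y *m N) 0 i).
pose C : 'M[o]_n := diag_mx (\row_i d i) + N.
have hE y i : h y 0 i = y 0 i * d i + (y *m N) 0 i by rewrite mxE.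
have hC y : y *m C = h y.
  by apply/rowP => i; rewrite mulmxDr mxE mul_mx_diag hE; congr (_ + _); rewrite !mxE.
clearbody h.
exists (C *m B); split=> [x|].
  rewrite mulmxA => /B_inj; rewrite hC => /rowP hx0.
  have hx i : h x 0 i = 0 by rewrite hx0 mxE.
  have xJ i : i \in J -> x 0 i = 0.
    move=> iJ; have := hx i; rewrite hE (echelon_mulmx _ _ eM) iJ addr0 /d iJ.
    by rewrite mulr1.
  apply/rowP => i; rewrite [RHS]mxE; case: (boolP (i \in J)) => [/xJ//|iJ].
  have := hx i; rewrite hE (echelon_mulmx _ _ eM) (negPf iJ) big1 ?addr0.
    by rewrite /d (negPf iJ) => /eqP;
      rewrite mulf_eq0 (negPf (uniformizer_neq0 u)) orbF => /eqP.
  by move=> j /xJ ->; rewrite mul0r.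
apply/seteqP; split=> [x Lx|_ [y _ <-]]; last first.
  rewrite /= mulmxA; suff : M (h y) by rewrite hC.
  have -> : h y = \sum_(j in J) y 0 j *: row j (1%:M + N) +
      pi *: \row_i (if i \in J then 0 else y 0 i).
    apply/rowP => i; rewrite hE [RHS]mxE (echelon_liftE _ _ eM).
    rewrite [X in _ = _ + X]mxE [X in _ = _ + _ * X]mxE /d.
    case: ifP => iJ.
      by rewrite mulr1 mulr0 (echelon_mulmx _ _ eM) iJ.
    by rewrite mulrC addrC.
  by apply: submodD => //; exact: echelon_lift.
have [z _ zx] : range (mulmxr B) x by rewrite -BE; exact: sub_pi_div.
have Mz : M z by rewrite /M/= -[_ *m _]/(mulmxr B z) zx.
have [w wE] : exists w : 'rV[o]_n, forall i, i \notin J ->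
    z 0 i - (z *m N) 0 i = pi * w 0 i.
  have : forall i, exists y, i \notin J -> z 0 i - (z *m N) 0 i = pi * y.
    move=> i; case: (boolP (i \in J)) => iJ; first by exists 0.
    have : rho (z 0 i - (z *m N) 0 i) = 0.
      by rewrite rmorphB (echelon_red eM Mz iJ) subrr.
    by move=> /(res_eq0 u)[y ->]; exists y.
  by move=> /choice[f fP]; exists (\row_i f i) => i /fP ->; rewrite mxE.
exists (\row_i if i \in J then z 0 i else w 0 i) => //=.
rewrite mulmxA hC -zx; congr (_ *m B); apply/rowP => i.
set y := \row_i _; rewrite hE.
have -> : (y *m N) 0 i = (z *m N) 0 i.
  rewrite !(echelon_mulmx _ _ eM); case: ifP => // _.
  by apply: eq_bigr => j jJ; rewrite mxE jJ.
rewrite mxE /d; case: ifPn => iJ.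
  by rewrite mulr1 (echelon_mulmx _ _ eM) iJ addr0.
by rewrite mulrC -wE// subrK.
Qed.

End RowSpace.
End Lattices.

(** * The fibres of division by the uniformizer *)

Section LatticeFibers.
Variables (o : idomainType) (u : uniformized o) (n : nat).
Local Notation k := (res_field u).
Local Notation rho := (res_map u).
Local Notation pi := (uniformizer u).
Local Notation q := #|res_field u|.
Local Notation red := (map_mx rho).
Implicit Types L N : set 'rV[o]_n.

Definition red_preimage (A : 'M[k]_n) : set 'rV[o]_n := [set y | (red y <= A)%MS].

Lemma submod_red_preimage A : submod (red_preimage A).
Proof.
split=> [|a x y]; rewrite /red_preimage/= ?raddf0 ?sub0mx// => xA yA.
by rewrite raddfD/= map_mxZ addmx_sub// scalemx_sub.
Qed.

Lemma red_preimage_index A : has_index (red_preimage A) (q ^ (n - \rank A)).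
Proof.
pose K := cokermx A; pose c (y : 'rV[o]_n) := red y *m col_base K.
exists 'rV[k]_(\rank K), c; split; last by rewrite card_mx mul1n mxrank_coker.
split=> [t|x y].
  have /submxP[w wt] := submx_full t (col_base_full K).
  have [y yw] := red_surj w; exists y.
  by rewrite /c yw wt.
rewrite /red_preimage/= submxE raddfB/=; split=> [cxy|].
  by rewrite -/K -[K]mulmx_base mulmxA mulmxBl -/(c x) -/(c y) cxy subrr mul0mx.
rewrite -/K -{1}[K]mulmx_base mulmxA => /eqP xyK; apply/eqP.
rewrite -subr_eq0 -mulmxBl; apply/eqP/(row_free_inj (row_base_free K)).
by rewrite xyK mul0mx.
Qed.

Lemma scale_uniformizer_inj m : injective ( *:%R pi : 'rV[o]_m -> 'rV[o]_m).
Proof.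
move=> x y /rowP xy; apply/rowP => i; apply: (mulfI (uniformizer_neq0 u)).
by have := xy i; rewrite !mxE.
Qed.

Lemma pi_range_index : has_index (range ( *:%R pi : 'rV[o]_n -> 'rV[o]_n)) (q ^ n).
Proof.
have := red_preimage_index 0; rewrite mxrank0 subn0.
have -> // : red_preimage 0 = range ( *:%R pi : 'rV[o]_n -> 'rV[o]_n).
apply/seteqP; split=> [y|_ [x _ <-]]; rewrite /red_preimage/= submx0.
  by move=> /eqP /red_eq0[x ->]; exists x.
by rewrite red_pi.
Qed.

(** Lattices L with pi_div L = N lie between pi N and N, hence are given by
    subspaces A of N / pi N; the equality pi_div L = N says that A meets
    trivially the image U of the intersection of N with pi o^n. *)
Lemma lattice_fiber N : lattice N -> exists (U : 'M[k]_n)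
    (Phi : 'M[k]_n -> set 'rV[o]_n),
  [/\ \rank U = corank u N,
      forall A, (A :&: U)%MS = 0 ->
        [/\ lattice (Phi A), pi_div u (Phi A) = N &
            corank u (Phi A) = (n - \rank A)%N],
      forall A A', Phi A = Phi A' -> (A :=: A')%MS &
      forall L, lattice L -> pi_div u L = N ->
        exists A, [/\ <<A>>%MS = A, (A :&: U)%MS = 0 & L = Phi A]].
Proof.
move=> latN; have [B [B_inj NB]] := lattice_basis u latN.
have mulB_inj : injective (mulmxr B : 'rV[o]_n -> 'rV[o]_n).
  move=> x y /eqP; rewrite -subr_eq0 -mulmxBl => /eqP/B_inj/eqP.
  by rewrite subr_eq0 => /eqP.
pose piZ : set 'rV[o]_n := range ( *:%R pi : 'rV[o]_n -> 'rV[o]_n).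
have piZ_sub : submod piZ.
  split=> [|a _ _ [x _ <-] [y _ <-]]; first by exists 0; rewrite ?scaler0.
  by exists (a *: x + y); rewrite // scalerDr !scalerA mulrC.
pose M0 : set 'rV[o]_n := [set y | piZ (y *m B)].
have M0_sub : submod M0 := submod_preimage (mulmxr B) piZ_sub.
have [U UP] := submod_red_mx u M0_sub.
have UE y : (red y <= U)%MS <-> M0 y.
  rewrite UP; split=> [[y' My' yy']|My]; last by exists y.
  have [z zE] : exists z, y - y' = pi *: z.
    by apply: red_eq0; rewrite raddfB/= yy' subrr.
  rewrite -[y](subrK y') zE; apply: submodD => //.
  by exists (z *m B) => //=; rewrite scalemxAl.
pose Phi (A : 'M[k]_n) : set 'rV[o]_n :=
  [set x | exists2 y, (red y <= A)%MS & x = y *m B].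
have PhiB A y : Phi A (y *m B) <-> (red y <= A)%MS.
  by split=> [[y' yA] /mulB_inj->|yA] //; exists y.
have rankU : \rank U = corank u N.
  have h1 : has_index (mulmxr B @^-1` piZ) (q ^ (n - \rank U)).
    have <- : red_preimage U = mulmxr B @^-1` piZ.
      by apply/seteqP; split=> y /UE.
    exact: red_preimage_index.
  have h2 : has_index (sum_range (mulmxr B) piZ) (q ^ corank u N).
    have <- : mod_uniformizer u N = sum_range (mulmxr B) piZ.
      rewrite NB; apply/seteqP; split=> x.
        move=> [z [y _ /= yx]]; exists y, z => //=.
        by rewrite yx opprB addrC subrK.
      move=> [y [z _ /= zx]]; exists z, y => //=.
      by rewrite zx opprB addrC subrK.
    exact: corank_index latN.1.
  have := index_split (submod_subgroup piZ_sub) h2 h1.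
  move=> /has_index_unique/(_ pi_range_index); rewrite -expnD.
  move=> /(@expnI _ (card_res_gt1 u)).
  have := corank_le u latN.1; have := rank_leq_row U.
  by set a := \rank U; set b := corank u N; lia.
have Phi_sub A : submod (Phi A).
  split; first by exists 0; rewrite ?raddf0 ?sub0mx ?mul0mx.
  move=> a _ _ [x xA ->] [y yA ->]; exists (a *: x + y).
    exact: (submod_red_preimage A).2.
  by rewrite mulmxDl scalemxAl.
have Phi_sum A : sum_range (mulmxr B) (Phi A) = N.
  rewrite NB; apply/seteqP; split=> [x [z [y _ xy]]|_ [y _ <-]].
    by exists (y + z) => //=; rewrite mulmxDl -xy subrK.
  by exists y; rewrite subrr; exact: (Phi_sub A).1.
have Phi_pre A : mulmxr B @^-1` Phi A = red_preimage A.
  by apply/seteqP; split=> y /PhiB.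
have Phi_index A : has_index (Phi A) (subgroup_index N * q ^ (n - \rank A)).
  apply: (@index_split _ _ (mulmxr B)); first exact: submod_subgroup.
    by rewrite Phi_sum; exact: lattice_index.
  by rewrite Phi_pre; exact: red_preimage_index.
exists U, Phi; split=> // [A AU|A A' AA'|L latL LN].
- have divPhi : pi_div u (Phi A) = N.
    rewrite NB; apply/seteqP; split=> [x [y yA xy]|_ [y _ <-]]; last first.
      by exists (pi *: y); rewrite ?red_pi ?sub0mx// -scalemxAl.
    have /eqP: red y = 0.
      apply/eqP; rewrite -submx0 -AU sub_capmx yA/=; apply/UE.
      by exists x.
    move=> /eqP/red_eq0[w yw]; exists w => //.
    by apply: scale_uniformizer_inj; rewrite xy yw /= scalemxAl.
  have latPhi : lattice (Phi A).
    by split=> //; exact: (has_index_finite (Phi_index A)).1.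
  split=> //; have := lattice_index_pi_div u latPhi.
  rewrite (has_index_finite (Phi_index A)).2 divPhi mulnC.
  move=> /eqP; rewrite eqn_pmul2r ?(has_index_gt0 (lattice_index latN))//.
  by move=> /eqP/(@expnI _ (card_res_gt1 u)) ->.
- apply/eqmxP/andP; split; apply/row_subP => i.
    have [y yE] := red_surj (row i A).
    by rewrite -yE; apply/PhiB; rewrite -AA'; apply/PhiB; rewrite yE row_sub.
  have [y yE] := red_surj (row i A').
  by rewrite -yE; apply/PhiB; rewrite AA'; apply/PhiB; rewrite yE row_sub.
pose P : set 'rV[o]_n := [set y | L (y *m B)].
have P_sub : submod P := submod_preimage (mulmxr B) latL.1.
have P_pi y : P (pi *: y).
  rewrite /P/= -scalemxAl; have : pi_div u L (y *m B) by rewrite LN NB; exists y.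
  by [].
have [A AP] := submod_red_mx u P_sub.
have AE y : (red y <= A)%MS <-> P y.
  rewrite AP; split=> [[y' Py' yy']|Py]; last by exists y.
  have [z zE] : exists z, y - y' = pi *: z.
    by apply: red_eq0; rewrite raddfB/= yy' subrr.
  by rewrite -[y](subrK y') zE; apply: submodD.
exists <<A>>%MS; split; first by rewrite genmx_id.
- apply/eqP; rewrite -submx0; apply/row_subP => i.
  have := row_sub i (<<A>> :&: U)%MS; rewrite sub_capmx genmxE.
  have [y <-] := red_surj (row i (<<A>> :&: U)%MS).
  move=> /andP[/AE Py /UE[z _ zy]].
  have : N z by rewrite -LN /pi_div/=; move: Py; rewrite /P/= -zy.
  rewrite NB => -[w _ wz].
  have -> : y = pi *: w by apply: mulB_inj; rewrite /= -scalemxAl -zy -wz.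
  by rewrite red_pi sub0mx.
apply/seteqP; split=> [x Lx|_ [y + ->]].
  have : N x by rewrite -LN; exact: sub_pi_div latL.1 _ Lx.
  rewrite NB => -[y _ yx]; exists y; last by rewrite -yx.
  by rewrite genmxE; apply/AE; rewrite /P/= -[_ *m _]/(mulmxr B y) yx.
by rewrite genmxE => /AE.
Qed.

Local Notation latt := (@finite_index_submodules o ('rV[o]_n : lmodType o)).

Lemma latt_lattice (x : latt) : lattice (val x).
Proof. by apply/latticeP; exact: set_mem (valP x). Qed.

Lemma lattice_latt L : lattice L -> exists x : latt, val x = L.
Proof. by move=> /latticeP/mem_set LP; exists (Sub L LP). Qed.

Lemma latt_div_subproof (x : latt) : pi_div u (val x) \in latt.
Proof. by apply/mem_set/latticeP/lattice_pi_div/latt_lattice. Qed.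

Definition latt_div (x : latt) : latt := Sub (pi_div u (val x)) (latt_div_subproof x).

(** With U of rank corank N, the lattices of corank c above N are the subspaces
    of dimension n - c of k^n that meet U trivially. The crude bound on the size
    of the fibre serves the convergence of the sums. *)
Lemma latt_fiber (y : latt) : exists F : {fset latt},
  [/\ forall x, (x \in F) = (latt_div x == y),
      (#|` F| <= q ^ (n * n))%N &
   forall c, (c <= n)%N ->
   ((\sum_(x <- F) (corank u (val x) == c)) *
     \prod_(i < n - c) (q ^ (n - c) - q ^ i) =
     \prod_(i < n - c) (q ^ n - q ^ (corank u (val y) + i)))%N].
Proof.
have [U [Phi [rankU PhiP Phi_inj Phi_surj]]] := lattice_fiber (latt_lattice y).
pose D := finset (fun A : 'M[k]_n => (<<A>>%MS == A) && ((A :&: U)%MS == 0)).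
have /choice[g gP] : forall A, exists x : latt, A \in D -> val x = Phi A.
  move=> A; case: (boolP (A \in D)) => [|_]; last by exists y.
  rewrite finset.in_set => /andP[_ /eqP/PhiP[/lattice_latt[x xA] _ _]].
  by exists x.
have g_inj : {in D &, injective g}.
  move=> A A' AD AD' gA; have PhiA : Phi A = Phi A' by rewrite -!gP// gA.
  move: AD AD'; rewrite !finset.in_set => /andP[/eqP <- _] /andP[/eqP <- _].
  by apply/genmxP/eqmxP; exact: Phi_inj.
exists [fset g A | A in D]%fset; split=> [x||c cn].
- apply/imfsetP/eqP => [[A /= AD ->]|xy].
    apply: val_inj; rewrite /= gP//; move: AD.
    by rewrite finset.in_set => /andP[_ /eqP/PhiP[]].
  have [|A [gA AU xA]] := Phi_surj (val x) (latt_lattice x).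
    by rewrite -[pi_div _ _]/(val (latt_div x)) xy.
  have AD : A \in D by rewrite finset.in_set gA AU !eqxx.
  by exists A => //; apply: val_inj; rewrite /= gP.
- rewrite card_in_imfset//=; apply: leq_trans (_ : #|D| <= _)%N.
    by rewrite cardE.
  by rewrite -(card_mx k n n) max_card.
rewrite big_imfset//= -rankU -card_subspaces; congr (_ * _)%N.
rewrite big_enum/= -sum1dep_card [RHS]big_mkcond [LHS]big_mkcond/=.
apply: eq_bigr => A _; rewrite finset.in_set.
case: (boolP (A \in D)) => AD; have := AD; rewrite finset.in_set.
  move=> /andP[gA AU]; have [_ _ cA] := PhiP _ (eqP AU).
  rewrite gA AU andbT/= gP// cA.
  have := rank_leq_row A; set a := \rank A => an.
  have -> : (a == (n - c)%N) = ((n - a)%N == c) by apply/eqP/eqP; lia.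
  by case: eqP.
move=> /nandP[] /negPf->; by rewrite ?andbF.
Qed.

End LatticeFibers.

(** * Sums over lattices *)

Section LatticeSums.
Variables (o : idomainType) (u : uniformized o) (n : nat).
Local Notation q := #|res_field u|.
Local Notation latt := (@finite_index_submodules o ('rV[o]_n : lmodType o)).
Local Notation corank := (corank u).
Local Notation latt_div := (@latt_div o u n).

(** The shape of every summand below: the weight is multiplicative along the
    chain L, pi_div L, pi_div (pi_div L), and so on. *)
Definition multiplicative_weight (K : nzRingType) (Y : nat -> K) (W : latt -> K) :=
  (forall x : latt, corank (val x) = 0%N -> W x = 1) /\
  (forall x : latt, (0 < corank (val x))%N ->
     W x = Y (corank (val x)) * W (latt_div x)).

Lemma corank_latt_le (x : latt) : (corank (val x) <= n)%N.
Proof. exact: corank_le (latt_lattice x).1. Qed.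

Lemma card_res_exp_gt1 c : (0 < c)%N -> (1 < q ^ c)%N.
Proof. by move=> c0; rewrite -{1}(exp1n c) ltn_exp2r// card_res_gt1. Qed.

Lemma index_latt_div (x : latt) : (0 < corank (val x))%N ->
  (subgroup_index (val (latt_div x)) < subgroup_index (val x))%N.
Proof.
move=> c_gt0; have latx := latt_lattice x.
rewrite (lattice_index_pi_div u latx) ltn_Pmull ?card_res_exp_gt1//.
exact: has_index_gt0 (lattice_index (lattice_pi_div u latx)).
Qed.

(** The sum over a fibre of L -> pi_div L is at most half the weight of its
    base, so the sums over lattices of bounded index satisfy s <= 1 + s / 2. *)
Lemma weight_bounded (R : realType) (W : latt -> R) (y : R) :
  (forall x, 0 <= W x) -> (forall x : latt, corank (val x) = 0%N -> W x = 1) ->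
  (forall x : latt, (0 < corank (val x))%N -> W x <= y * W (latt_div x)) ->
  0 <= y -> y * (q ^ (n * n))%:R <= 1 / 2 ->
  forall F : {fset latt}, \sum_(x <- F) W x <= 2.
Proof.
move=> W0 W1 WS y0 y_le F.
have [l lF] : exists l, forall x, x \in F -> (subgroup_index (val x) < l)%N.
  exists (\max_(x <- F) subgroup_index (val x)).+1 => x xF.
  by rewrite ltnS (big_rem x)//= leq_maxl.
elim: l F lF => [|l IHl] F lF.
  by rewrite big_seq big1// => x /lF.
rewrite (bigID (fun x => corank (val x) == 0%N))/=.
have -> : 2 = 1 + 1 :> R by [].
apply: lerD.
  have top (x x' : latt) : corank (val x) = 0%N -> corank (val x') = 0%N -> x = x'.
    move=> x0 x'0; apply: val_inj.
    by rewrite (corank0 (latt_lattice x).1 x0) (corank0 (latt_lattice x').1 x'0).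
  case: (pselect (exists2 x, x \in F & corank (val x) = 0%N)) => [[x xF x0]|no].
    rewrite big_mkcond (bigD1_seq x) ?fset_uniq//= x0 eqxx W1// big1 ?addr0//.
    move=> x' /negPf x'x; case: eqP => // x'0.
    by rewrite (top x' x x'0 x0) eqxx in x'x.
  rewrite big_seq_cond big1 ?ler01// => x /andP[xF /eqP x0]; case: no.
  by exists x.
pose F1 := [fset x in F | corank (val x) != 0%N]%fset.
pose F' := [fset latt_div x | x in F1]%fset.
have /choice[fib fibP] := @latt_fiber o u n.
apply: (@le_trans _ _ (\sum_(x <- F1) y * W (latt_div x))).
  rewrite big_fset_condE/= big_seq [leRHS]big_seq; apply: ler_sum => x.
  rewrite !inE/= => /andP[_ x0].
  by apply: WS; rewrite lt0n.
apply: (@le_trans _ _ (\sum_(z <- F') y * (q ^ (n * n))%:R * W z)).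
  rewrite (partition_big_imfset _ latt_div)/=; apply: ler_sum => z _.
  apply: (@le_trans _ _ (\sum_(x <- fib z) y * W z)).
    have [fz _ _] := fibP z.
    rewrite [leRHS](bigID (fun x => x \in F1))/= -[leLHS]addr0.
    apply: lerD; last by apply: sumr_ge0 => x _; rewrite mulr_ge0.
    rewrite le_eqVlt; apply/orP; left; apply/eqP.
    rewrite [LHS]big_fset_condE [RHS]big_fset_condE/=; apply: eq_fbig => [x|x].
      by rewrite !inE/= fz andbC.
    by rewrite !inE/= => /andP[_ /eqP->].
  rewrite big_const_seq count_predT iter_addr_0 -[leLHS]mulr_natr [leRHS]mulrAC.
  rewrite ler_wpM2l ?mulr_ge0// ler_nat.
  by have [_ + _] := fibP z.
rewrite -mulr_sumr; apply: (@le_trans _ _ (1 / 2 * 2)); last first.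
  by rewrite divfK.
apply: ler_pM => //; first by rewrite mulr_ge0.
  by apply: sumr_ge0.
apply: IHl => _ /imfsetP[x /= + ->]; rewrite !inE/= -lt0n => /andP[/lF].
by rewrite ltnS => xl x0; exact: leq_trans (index_latt_div x0) xl.
Qed.

Section Recursion.
Variables (K : numFieldType) (Y : nat -> K) (W : latt -> K) (G : nat -> K).
Hypothesis W_mult : multiplicative_weight Y W.
Hypothesis G_sum : forall c, (c <= n)%N ->
  has_sum (fun x : latt => W x * (corank (val x) == c)%:R) (G c).

Local Notation qi := ((q%:R : K)^-1).

Lemma q_neq0 : (q%:R : K) != 0.
Proof. by rewrite pnatr_eq0 -lt0n (ltn_trans _ (card_res_gt1 u)). Qed.

Lemma qi_lt1 i : (0 < i)%N -> qi ^+ i < 1.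
Proof.
move=> i0; rewrite exprVn invf_lt1 ?exprn_gt0 ?ltr0n ?(ltn_trans _ (card_res_gt1 u))//.
by rewrite exprn_egt1 ?ltr1n ?card_res_gt1// -lt0n.
Qed.

Lemma qi_nroot i : (0 < i)%N -> 1 - qi ^+ i != 0.
Proof. by move=> /qi_lt1 lt1; rewrite subr_eq0 eq_sym (lt_eqF lt1). Qed.

Lemma qfact_gt0 i : 0 < qfact qi i.
Proof.
rewrite /qfact big_seq; apply: prodr_gt0 => j; rewrite mem_index_iota => /andP[j0 _].
by rewrite subr_gt0 qi_lt1.
Qed.

Lemma prod_qpow_sub N a r : (r <= a <= N)%N ->
  (\prod_(i < r) (q ^ N - q ^ (N - a + i)))%:R * qfact qi (a - r) =
  (q%:R : K) ^+ (N * r) * qfact qi a.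
Proof.
move=> /andP[+ aN]; elim: r => [|r IHr] ra.
  by rewrite big_ord0 muln0 expr0 subn0.
rewrite big_ord_recr/= natrM mulnS exprD -[RHS]mulrA -IHr ?(ltnW ra)//.
have -> : (a - r = (a - r.+1).+1)%N by lia.
rewrite [qfact qi (a - r.+1).+1]/qfact big_nat_recr//= -/(qfact qi (a - r.+1)).
have -> : ((q ^ N - q ^ (N - a + r))%N%:R : K) =
    q%:R ^+ N * (1 - qi ^+ (a - r.+1).+1).
  have e : N = ((N - a + r) + (a - r.+1).+1)%N by lia.
  rewrite natrB; last by rewrite leq_exp2l ?card_res_gt1//; lia.
  rewrite mulrBr mulr1 !natrX; congr (_ - _).
  have -> : (q%:R : K) ^+ N = q%:R ^+ (N - a + r) * q%:R ^+ (a - r.+1).+1.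
    by rewrite -exprD -e.
  by rewrite -mulrA -exprMn mulfV ?q_neq0// expr1n mulr1.
ring.
Qed.

(** The number of lattices of corank c in the fibre of pi_div over a lattice of
    corank c'. *)
Definition fiber_count c c' : K :=
  (\prod_(i < n - c) (q ^ n - q ^ (c' + i)))%:R /
  (\prod_(i < n - c) (q ^ (n - c) - q ^ i))%:R.

Lemma fiber_count_gt c c' : (c < c' <= n)%N -> fiber_count c c' = 0.
Proof.
move=> /andP[cc' c'n]; have lt : (n - c' < n - c)%N by lia.
rewrite /fiber_count (bigD1 (Ordinal lt))//= subnKC// subnn mul0n.
by rewrite mul0r.
Qed.

Lemma fiber_count_denom c :
  (\prod_(i < n - c) (q ^ (n - c) - q ^ i))%:R =
  (q%:R : K) ^+ ((n - c) * (n - c)) * qfact qi (n - c).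
Proof.
have := @prod_qpow_sub (n - c) (n - c) (n - c); rewrite leqnn => /(_ isT).
by rewrite subnn qfact0 mulr1.
Qed.

Lemma fiber_count_denom_neq0 c :
  (\prod_(i < n - c) (q ^ (n - c) - q ^ i))%:R != 0 :> K.
Proof.
by rewrite fiber_count_denom mulf_neq0 ?expf_neq0 ?q_neq0// gt_eqF ?qfact_gt0.
Qed.

Lemma fiber_count_le c c' : (c' <= c <= n)%N ->
  fiber_count c c' = q%:R ^+ (c * (n - c)) *
    (qfact qi (n - c') / (qfact qi (n - c) * qfact qi (c - c'))).
Proof.
move=> /andP[c'c cn]; have := @prod_qpow_sub n (n - c') (n - c).
have -> : (n - c' - (n - c) = c - c')%N by lia.
have -> : (n - (n - c') = c')%N by lia.
have -> : (n - c <= n - c' <= n)%N by apply/andP; split; lia.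
move=> /(_ isT); rewrite /fiber_count; set P := (\prod_(i < _) _)%:R => e.
have f0 i : qfact qi i != 0 by rewrite gt_eqF ?qfact_gt0.
have -> : P = q%:R ^+ (n * (n - c)) * qfact qi (n - c') / qfact qi (c - c').
  by rewrite -e mulfK.
rewrite fiber_count_denom.
have -> : (n * (n - c) = (n - c) * (n - c) + c * (n - c))%N.
  by rewrite -mulnDl subnK.
rewrite exprD; field.
by rewrite !f0 expf_neq0 ?q_neq0.
Qed.

(** Regrouping the lattices of corank c along pi_div: each fibre contributes the
    same multiple Y c of the weight of its base, as often as fiber_count says. *)
Lemma sum_corank_rec c : (0 < c <= n)%N ->
  G c = Y c * \sum_(0 <= c' < n.+1) fiber_count c c' * G c'.
Proof.
move=> /andP[c_gt0 cn]; have [fib fibP] := choice (@latt_fiber o u n).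
have fib_div x y : (x \in fib y) = (latt_div x == y) by have [->] := fibP y.
have fib_count y : \sum_(x <- fib y) W x * (corank (val x) == c)%:R =
    Y c * (fiber_count c (corank (val y)) * W y).
  have [_ _ /(_ c cn) cnt] := fibP y.
  transitivity (\sum_(x <- fib y) Y c * W y * (corank (val x) == c)%:R).
    rewrite big_seq [RHS]big_seq; apply: eq_bigr => x.
    rewrite fib_div => /eqP xy; case: eqP => [xc|_]; last by rewrite !mulr0.
    by rewrite W_mult.2 xc// xy.
  rewrite -mulr_sumr -mulrA -natr_sum; congr (_ * _); rewrite mulrC.
  congr (_ * _); rewrite /fiber_count -cnt natrM mulfK//.
  exact: fiber_count_denom_neq0.
have h1 := has_sum_fibers fib_div (G_sum cn).
apply: has_sum_unique h1 _.
apply: (@eq_has_sum _ _ (fun y : latt => Y c * \sum_(c' <- index_iota 0 n.+1)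
    fiber_count c c' * (W y * (corank (val y) == c')%:R))).
  move=> y; rewrite fib_count (bigD1_seq (corank (val y))) ?iota_uniq//=.
    rewrite eqxx mulr1 big1 ?addr0// => c' /negPf c'y.
    by rewrite eq_sym c'y !mulr0.
  by rewrite mem_index_iota ltnS corank_latt_le.
apply: has_sumZ; apply: has_sum_sum => c'; rewrite mem_index_iota => /andP[_ c'n].
by apply: has_sumZ; exact: G_sum.
Qed.

Lemma sum_corank0 : G 0%N = 1.
Proof.
have [top topE] := lattice_latt (latticeT 'rV[o]_n).
have top0 : corank (val top) = 0%N by rewrite topE corankT.
have := @has_sum_point _ _ (fun x : latt => W x * (corank (val x) == 0%N)%:R) top.
rewrite top0 eqxx mulr1 W_mult.1// => h.
apply: has_sum_unique (G_sum (leq0n _)) (h _) => x x_top.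
case: eqP => [x0|_]; last by rewrite mulr0.
case/eqP: x_top; apply: val_inj.
by rewrite topE; apply: corank0 x0; exact: (latt_lattice x).1.
Qed.

(** The factor q^(c (n - c)) of fiber_count joins the step Y c of the weight. *)
Definition igusa_var c : K := Y c * q%:R ^+ (c * (n - c)).

(** The lattices of the same corank c on both sides of the recursion produce the
    factor 1 - X c. *)
Lemma igusa_var_rec c : (0 < c <= n)%N ->
  (1 - igusa_var c) * (G c * qfact qi (n - c)) =
  igusa_var c * \sum_(0 <= j < c) (G j * qfact qi (n - j)) / qfact qi (c - j).
Proof.
move=> /andP[c_gt0 cn]; have f0 i : qfact qi i != 0 by rewrite gt_eqF ?qfact_gt0.
have h : G c * qfact qi (n - c) = igusa_var c *
    \sum_(0 <= j < c.+1) (G j * qfact qi (n - j)) / qfact qi (c - j).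
  rewrite {1}sum_corank_rec ?c_gt0// (@big_cat_nat _ _ _ c.+1)//= ?ltnS//.
  rewrite [X in _ + X]big_nat_cond [X in _ + X]big1 ?addr0; last first.
    by move=> j /andP[/andP[cj jn] _]; rewrite fiber_count_gt ?mul0r// cj.
  rewrite /igusa_var -!mulrA; congr (_ * _); rewrite mulr_sumr mulr_suml.
  apply: eq_big_nat => j /andP[_ jc]; rewrite fiber_count_le; last first.
    by rewrite cn andbT -ltnS.
  by field; rewrite !f0.
move: h; rewrite big_nat_recr//= subnn qfact0 divr1.
set g := G c * _ => h.
by rewrite mulrBl mul1r {1}h mulrDr addrK.
Qed.

Lemma sum_corank_igusa : (forall c, (0 < c <= n)%N -> 1 - igusa_var c != 0) ->
  has_sum W (igusa n qi igusa_var).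
Proof.
move=> X1; have f0 i : qfact qi i != 0 by rewrite gt_eqF ?qfact_gt0.
rewrite -(@igusa_recursion K qi qi_nroot n igusa_var
    (fun c => G c * qfact qi (n - c))) => //; last 2 first.
- by rewrite sum_corank0 mul1r subn0.
- exact: igusa_var_rec.
apply: (@eq_has_sum _ _ (fun x : latt => \sum_(c <- index_iota 0 n.+1)
    W x * (corank (val x) == c)%:R)).
  move=> x; rewrite (bigD1_seq (corank (val x))) ?iota_uniq//=.
    rewrite eqxx mulr1 big1 ?addr0// => c /negPf cx.
    by rewrite eq_sym cx mulr0.
  by rewrite mem_index_iota ltnS corank_latt_le.
rewrite (eq_bigr G); last by move=> c _; rewrite mulfK.
apply: has_sum_sum => c; rewrite mem_index_iota => /andP[_ cn].
exact: G_sum.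
Qed.

End Recursion.

(** The sums G c are finite and nonnegative and G 0 = 1, so the right-hand side
    of the recursion is positive, and hence so is 1 - X c. *)
Lemma igusa_var_lt1 (R : realType) (Y : nat -> R) (W : latt -> R) (G : nat -> R) :
  multiplicative_weight Y W ->
  (forall c, (c <= n)%N ->
     has_sum (fun x : latt => W x * (corank (val x) == c)%:R) (G c)) ->
  (forall x, 0 <= W x) -> (forall c, 0 < Y c) ->
  forall c, (0 < c <= n)%N -> igusa_var Y c < 1.
Proof.
move=> W_mult G_sum W0 Y0 c cn.
have G0 j : (j <= n)%N -> 0 <= G j.
  move=> /G_sum Gj; rewrite leNgt; apply/negP => Gj_lt0.
  have [F hF] := Gj (- G j) ltac:(by rewrite oppr_gt0).
  have := hF F (fsubset_refl _); rewrite ltNge => /negP; apply.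
  rewrite ger0_norm; last first.
    by rewrite addr_ge0 ?oppr_ge0 ?(ltW Gj_lt0)// sumr_ge0// => x _; rewrite mulr_ge0.
  by rewrite lerDr sumr_ge0// => x _; rewrite mulr_ge0.
have X0 : 0 < igusa_var Y c.
  by rewrite mulr_gt0// exprn_gt0// ltr0n (ltn_trans _ (card_res_gt1 u)).
have := igusa_var_rec W_mult G_sum cn.
set S := \sum_(_ <= _ < _) _ => eS.
have [c_gt0 c_le] := andP cn.
have S0 : 0 < S.
  rewrite /S -(subnKC c_gt0) add1n big_nat_recl//= (sum_corank0 W_mult G_sum).
  rewrite ltr_pwDl ?mul1r ?divr_gt0 ?qfact_gt0//.
  rewrite big_nat_cond sumr_ge0// => j /andP[/andP[_ jc] _].
  rewrite !mulr_ge0 ?invr_ge0 ?(ltW (qfact_gt0 _ _))//.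
  by apply: G0; lia.
rewrite ltNge; apply/negP => X1; have := mulr_gt0 X0 S0; rewrite -eS ltNge.
move=> /negP; apply; rewrite mulr_le0_ge0 ?subr_le0//.
by rewrite mulr_ge0 ?G0// ltW ?qfact_gt0.
Qed.
End LatticeSums.

(** * Exponent vectors *)

Section TuplesOfSum.
Local Open Scope set_scope.
Variable n : nat.

Lemma tuples_of_sum_inj k (f g : tuples_of_sum n k) :
  (forall i, val f i = val g i :> nat) -> f = g.
Proof. by move=> fg; apply/val_inj/ffunP => i; apply: val_inj; exact: fg. Qed.

Lemma tuples_of_sum_exists k (h : 'I_n -> nat) : (\sum_i h i)%N = k ->
  exists f : tuples_of_sum n k, forall i, val f i = h i :> nat.
Proof.
move=> hk; have h_le i : (h i < k.+1)%N by rewrite ltnS -hk (bigD1 i)//= leq_addr.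
have fP : (\sum_i [ffun i => Ordinal (h_le i)] i == k)%N.
  by apply/eqP; rewrite -[RHS]hk; apply: eq_bigr => i _; rewrite ffunE.
by exists (Sub [ffun i => Ordinal (h_le i)] fP) => i; rewrite /= ffunE.
Qed.

Definition supported k (J : {set 'I_n}) (f : tuples_of_sum n k) :=
  [forall i, (i \notin J) ==> (val f i == 0 :> nat)%N].

Lemma supportedP k (J : {set 'I_n}) (f : tuples_of_sum n k) :
  reflect (forall i, i \notin J -> (val f i = 0 :> nat)%N) (supported J f).
Proof.
apply: (iffP forallP) => [fJ i iJ|fJ i]; last by apply/implyP => /fJ ->.
by have /implyP/(_ iJ)/eqP := fJ i.
Qed.

(** Stars and bars for the coordinates in J. *)
Lemma card_supported k (J : {set 'I_n}) :
  #|[set f : tuples_of_sum n k | supported J f]| = 'C((#|J| + k).-1, k).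
Proof.
have [J0|J_gt0] := posnP #|J|.
  rewrite J0 add0n; have JN i : i \notin J by rewrite (cards0_eq J0) finset.in_set0.
  have sum0 (f : tuples_of_sum n k) : supported J f -> k = 0%N.
    move=> /supportedP f0; have /eqP <- := valP f.
    by rewrite big1// => i _; exact: f0.
  case: (posnP k) => [k0|k_gt0].
    subst k; rewrite bin0; apply/eqP/cards1P.
    have [f fP] := @tuples_of_sum_exists 0 (fun=> 0%N) ltac:(by rewrite big1).
    exists f; apply/finset.setP => g; rewrite finset.in_set finset.in_set1.
    apply/supportedP/eqP => [g0|-> i _]; last exact: fP.
    by apply: tuples_of_sum_inj => i; rewrite fP g0.
  rewrite bin_small ?ltn_predL//; apply/eqP; rewrite cards_eq0;
    apply/eqP/finset.setP => f.
  rewrite finset.in_set finset.in_set0; apply/negP => /sum0 k0.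
  by rewrite k0 in k_gt0.
have [r Jr] : exists r, #|J| = r.+1 by exists #|J|.-1; rewrite prednK.
rewrite Jr addSn/= -bin_sub ?leq_addl// addnK.
rewrite -card_ord_partitions.
have Jr' : r.+1 = #|J| by rewrite Jr.
pose en (i : 'I_r.+1) : 'I_n := enum_val (cast_ord Jr' i).
pose h (f : tuples_of_sum n k) : r.+1.-tuple 'I_k.+1 := [tuple val f (en i) | i < r.+1].
have en_inj : injective en by move=> i j /enum_val_inj/cast_ord_inj.
have enJ i : en i \in J by exact: enum_valP.
have en_surj j : j \in J -> exists i, j = en i.
  move=> jJ; exists (cast_ord (esym Jr') (enum_rank_in jJ j)).
  by rewrite /en cast_ordKV enum_rankK_in.
have imJ : J = en @: 'I_r.+1.
  apply/finset.setP => j; apply/idP/imsetP => [/en_surj[i ->]|[i _ ->]];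
    last exact: enJ.
  by exists i.
have sum_en (F : 'I_n -> nat) : (forall i, i \notin J -> F i = 0%N) ->
    (\sum_i F i = \sum_(i < r.+1) F (en i))%N.
  move=> F0; rewrite (bigID (mem J))/= [X in (_ + X)%N]big1 ?addn0; last exact: F0.
  by rewrite imJ big_imset//= => i j _ _; exact: en_inj.
rewrite -(@card_in_imset _ _ h); last first.
  move=> f g; rewrite !finset.in_set => /supportedP fJ /supportedP gJ fg.
  apply: tuples_of_sum_inj => j; case: (boolP (j \in J)) => [/en_surj[i ->]|jJ].
    by have := congr1 (fun t => tnth t i) fg; rewrite !tnth_mktuple => ->.
  by rewrite fJ// gJ.
congr #|pred_of_set _|; apply/finset.setP => t; rewrite finset.in_set.
apply/imsetP/eqP => [[f + ->]|tk].
  rewrite finset.in_set => /supportedP fJ.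
  transitivity (\sum_i val f i)%N; last exact/eqP/(valP f).
  rewrite big_tuple (sum_en (fun i => val f i))//.
  by apply: eq_bigr => i _; rewrite tnth_mktuple.
pose F (j : 'I_n) : nat := if [pick i | en i == j] is Some i then tnth t i else 0%N.
have Fen i : F (en i) = tnth t i.
  rewrite /F; case: pickP => [i' /eqP/en_inj->//|/(_ i)].
  by rewrite eqxx.
have FJ j : j \notin J -> F j = 0%N.
  rewrite /F; case: pickP => // i /eqP <-.
  by rewrite enJ.
have [|f fF] := @tuples_of_sum_exists k F.
  rewrite sum_en// -tk big_tuple.
  by apply: eq_bigr => i _.
exists f; first by rewrite finset.in_set; apply/supportedP => i iJ;
  exact: etrans (fF i) (FJ i iJ).
by apply: eq_from_tnth => i; rewrite tnth_mktuple; apply: val_inj;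
  exact: etrans (esym (Fen i)) (esym (fF (en i))).
Qed.

Lemma card_tuples_of_sum k : #|{: tuples_of_sum n k}| = 'C((n + k).-1, k).
Proof.
have := card_supported k [set: 'I_n]; rewrite cardsT card_ord => <-.
rewrite -cardsT; congr #|pred_of_set _|; apply/finset.setP => f.
rewrite !finset.in_set; apply/esym/supportedP => i.
by rewrite finset.in_setT.
Qed.

End TuplesOfSum.

(** * Divided powers *)

Section AddStandard.
Variables (n l : nat).
Local Notation E := (tuples_of_sum n l).
Local Notation F := (tuples_of_sum n l.+1).

Lemma add_std_subproof (e : E) (i : 'I_n) : exists f : F,
  forall j, val f j = (val e j + (j == i))%N :> nat.
Proof.
apply: (@tuples_of_sum_exists n l.+1 (fun j => (val e j + (j == i))%N)).
rewrite big_split/= (eqP (valP e)) (bigD1 i)//= eqxx big1 ?addn0 ?addn1//.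
by move=> j /negPf->.
Qed.

Definition add_std (e : E) (i : 'I_n) : F := sval (cid (add_std_subproof e i)).

Lemma add_stdE e i j : val (add_std e i) j = (val e j + (j == i))%N :> nat.
Proof. by rewrite /add_std; case: cid. Qed.

Lemma differ_by_stdE (e : E) (f : F) i :
  @differ_by_std l.+1 n e f i = (add_std e i == f).
Proof.
apply/forallP/eqP => [ef|<- j]; last exact/eqP/add_stdE.
by apply: tuples_of_sum_inj => j; rewrite add_stdE; exact/esym/eqP/ef.
Qed.

Lemma add_std_inj i : injective (add_std^~ i).
Proof.
move=> e e' ee; apply: tuples_of_sum_inj => j.
by apply/eqP; rewrite -(eqn_add2r (j == i)) -!add_stdE ee.
Qed.

Lemma add_std_surj (f : F) i : (0 < val f i)%N -> exists e, f = add_std e i.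
Proof.
move=> fi; have [|e eE] := @tuples_of_sum_exists n l (fun j => (val f j - (j == i))%N).
  have sf := eqP (valP f); rewrite (bigD1 i)//= in sf.
  rewrite (bigD1 i)//= eqxx (eq_bigr (fun j => nat_of_ord (val f j))); last first.
    by move=> j /negPf->; rewrite subn0.
  by move: fi sf => /=; set a := nat_of_ord _; set S := (\sum_(_ | _) _)%N; lia.
exists e; apply: tuples_of_sum_inj => j; rewrite add_stdE eE.
by case: eqP => [->|_]; rewrite ?subn0 ?addn0// subnK.
Qed.

End AddStandard.

(** The divided power of a subspace given by pivots J and coefficients N: the
    vector w g has as coordinates the coefficients of the monomial g in the
    products of the linear forms v_i, where v = sum_(j in J) X_j v_j is the
    generic point of the span of the pivot rows v_j. *)
Lemma divided_power_basis (A : comNzRingType) (n l : nat) (J : {set 'I_n})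
    (N : 'M[A]_n) :
  exists w : tuples_of_sum n l.+1 -> tuples_of_sum n l.+1 -> A,
    (forall g f, supported J f -> w g f = (g == f)%:R) /\
    (forall g (e : tuples_of_sum n l) i, i \notin J ->
       w g (add_std e i) = \sum_(j in J) N j i * w g (add_std e j)).
Proof.
pose mon k (f : tuples_of_sum n k) := mpoly.Multinom [tuple nat_of_ord (val f i) | i < n].
have monE k (f : tuples_of_sum n k) i : mpoly.fun_of_multinom (mon k f) i = val f i.
  by rewrite mpoly.multinomE tnth_mktuple.
pose X i : mpoly.mpoly n A := mpoly.mpolyX A (mpoly.mnm1 i).
pose ell i := if i \in J then X i else \sum_(j in J) N j i *: X j.
pose P k (f : tuples_of_sum n k) := \prod_i ell i ^+ val f i.
have PS e i : P l.+1 (add_std e i) = P l e * ell i.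
  rewrite /P (eq_bigr (fun j => ell j ^+ val e j * ell j ^+ (j == i))); last first.
    by move=> j _; rewrite add_stdE exprD.
  rewrite big_split/=; congr (_ * _); rewrite (bigD1 i)//= eqxx expr1 big1 ?mulr1//.
  by move=> j /negPf->; rewrite expr0.
exists (fun g f => mpoly.mcoeff (mon _ g) (P _ f));
  split=> [g f /supportedP fJ|g e i iJ].
  have -> : P _ f = mpoly.mpolyX A (mon _ f).
    rewrite mpoly.mpolyXE_id; apply: eq_bigr => i _; rewrite monE /ell.
    by case: ifPn => // /fJ ->; rewrite !expr0.
  rewrite mpoly.mcoeffX; suff -> : (mon _ f == mon _ g) = (g == f) by [].
  apply/eqP/eqP => [fg|->//].
  by apply: tuples_of_sum_inj => i; rewrite -!monE fg.
rewrite PS {1}/ell (negPf iJ) mulr_sumr raddf_sum/=; apply: eq_bigr => j jJ.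
by rewrite -scalerAr mpoly.mcoeffZ PS /ell jJ.
Qed.

(** * The stabilizer of a lattice of the centre *)

Section Stabilizer.
Variables (o : idomainType) (u : uniformized o) (n l : nat).
Local Notation k := (res_field u).
Local Notation rho := (res_map u).
Local Notation pi := (uniformizer u).
Local Notation q := #|res_field u|.
Local Notation E := (tuples_of_sum n l).
Local Notation F := (tuples_of_sum n l.+1).
Local Notation V := {ffun (E + F)%type -> o^o}.
Implicit Types (L : set 'rV[o]_n) (v : V).

(** The brackets of an element of the span of the x_e and y_f with the basis
    elements x_e, and, up to sign, with the basis elements y_f. *)
Definition bracket_x v (e : E) : 'rV[o]_n := \row_i v (inr (add_std e i)).
Definition bracket_y v (f : F) : 'rV[o]_n :=
  \row_i \sum_(e | add_std e i == f) v (inl e).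

(** The elements whose brackets with the whole Lie algebra have their central
    component in L. *)
Definition stab L : set V :=
  [set v | (forall e, L (bracket_x v e)) /\ (forall f, L (bracket_y v f))].

Lemma bracket_x_linear a v w e :
  bracket_x (a *: v + w) e = a *: bracket_x v e + bracket_x w e.
Proof. by apply/rowP => i; rewrite !mxE !ffunE. Qed.

Lemma bracket_y_linear a v w f :
  bracket_y (a *: v + w) f = a *: bracket_y v f + bracket_y w f.
Proof.
apply/rowP => i; rewrite !mxE mulr_sumr -big_split/=.
by apply: eq_bigr => e _; rewrite !ffunE.
Qed.

Lemma bracket_x0 e : bracket_x 0 e = 0.
Proof. by apply/rowP => i; rewrite !mxE ffunE. Qed.

Lemma bracket_y0 f : bracket_y 0 f = 0.
Proof. by apply/rowP => i; rewrite !mxE big1// => e _; rewrite ffunE. Qed.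

Lemma submod_stab L : submod L -> submod (stab L).
Proof.
move=> [L0 Lcl]; split=> [|a v w [vx vy] [wx wy]].
  by split=> [e|f]; rewrite ?bracket_x0 ?bracket_y0.
by split=> [e|f]; rewrite ?bracket_x_linear ?bracket_y_linear; apply: Lcl.
Qed.

Lemma stabT : stab setT = setT.
Proof. by apply/seteqP; split. Qed.

Lemma pi_div_stab L : pi_div u (stab L) = stab (pi_div u L).
Proof.
have bx v e : bracket_x (pi *: v) e = pi *: bracket_x v e.
  by rewrite -[pi *: v]addr0 bracket_x_linear bracket_x0 addr0.
have by_ v f : bracket_y (pi *: v) f = pi *: bracket_y v f.
  by rewrite -[pi *: v]addr0 bracket_y_linear bracket_y0 addr0.
apply/seteqP; split=> v [vx vy]; split=> [e|f].
- by have := vx e; rewrite bx.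
- by have := vy f; rewrite by_.
- by rewrite bx; exact: vx.
- by rewrite by_; exact: vy.
Qed.

Section Echelon.
Variables (L : set 'rV[o]_n) (J : {set 'I_n}) (N : 'M[o]_n).
Hypotheses (L_sub : submod L) (L_ech : echelon u L J N).

Lemma res_echelon (x : 'rV[o]_n) i : L x -> i \notin J ->
  rho (x 0 i) = \sum_(j in J) rho (x 0 j) * rho (N j i).
Proof.
move=> Lx iJ; rewrite (echelon_red L_ech Lx iJ) (echelon_mulmx _ _ L_ech).
by rewrite (negPf iJ) rmorph_sum; apply: eq_bigr => j _; rewrite rmorphM.
Qed.

(** Modulo pi, the x-part of v lists the coefficients of a polynomial whose
    product with X_i - sum_j N_ji X_j is zero, because this linear form vanishes
    on the reduction of L. Hence the polynomial is zero, as its terms of highest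
    degree in X_i show first. *)
Lemma stab_res_x v i : stab L v -> i \notin J -> forall e, rho (v (inl e)) = 0.
Proof.
move=> [_ vy] iJ e; have [d] := ubnP (l - val e i).
elim: d e => // d IHd e; rewrite ltnS => ed.
have := res_echelon (vy (add_std e i)) iJ; rewrite mxE.
rewrite (big_pred1 e); last by move=> e'; rewrite (inj_eq (@add_std_inj _ _ i)).
move=> ->; rewrite big1// => j jJ; rewrite mxE rmorph_sum big1 ?mul0r// => e' /eqP ee.
have ij : (i == j) = false by apply/negbTE; apply: contraNneq iJ => ->.
have e'i : val e' i = (val e i).+1 :> nat.
  have := congr1 (fun f : F => val f i : nat) ee.
  by rewrite /= !add_stdE eqxx ij addn0 addn1.
apply: IHd; rewrite e'i; apply: leq_trans ed.
have : (val e' i < l.+1)%N by exact: ltn_ord.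
by rewrite e'i; lia.
Qed.

(** Each use of the recursion replaces an index outside J by indices in J. *)
Lemma res_y_unique (t : F -> k) :
  (forall e i, i \notin J ->
     t (add_std e i) = \sum_(j in J) t (add_std e j) * rho (N j i)) ->
  (forall f, supported J f -> t f = 0) -> forall f, t f = 0.
Proof.
move=> t_rec tJ f; have [d] := ubnP (\sum_(i | i \notin J) val f i)%N.
elim: d f => // d IHd f; rewrite ltnS => fd.
case: (pselect (exists i, i \notin J /\ (0 < val f i)%N)) => [[i [iJ fi]]|no];
  last first.
  apply/tJ/supportedP => i iJ; apply/eqP; rewrite -leqn0 leqNgt.
  by apply/negP => fi; apply: no; exists i.
have [e fe] := add_std_surj fi; rewrite fe t_rec// big1// => j jJ.
rewrite IHd ?mul0r//; apply: leq_trans fd.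
rewrite fe (eq_bigr (fun i => val e i + (i == j))%N); last by move=> ? _;
  rewrite add_stdE.
rewrite [ltnRHS](eq_bigr (fun i' => val e i' + (i' == i))%N); last first.
  by move=> ? _; rewrite add_stdE.
rewrite !big_split/= -addnS leq_add2l big1 => [|i' i'J]; last first.
  by case: eqP i'J => // ->; rewrite jJ.
by rewrite (bigD1 i)//= eqxx.
Qed.

Lemma res_eq0_ffun v : (forall a, rho (v a) = 0) -> exists z, v = pi *: z.
Proof.
move=> v0; have /choice[z zE] : forall a, exists y, v a = pi * y.
  by move=> a; apply/(res_eq0 u)/v0.
by exists [ffun a => z a]; apply/ffunP => a; rewrite !ffunE zE.
Qed.

Definition new_coordinate (a : E + F) : bool :=
  if a is inr f then ~~ supported J f else true.

(** The index of stab L + pi V: modulo pi, the x-part of stab L vanishes and its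
    y-part is the divided power of the reduction of L, which lifts. *)
Lemma stab_mod_index i0 : i0 \notin J ->
  has_index (mod_uniformizer u (stab L)) (q ^ #|[pred a | new_coordinate a]|).
Proof.
move=> i0J; have [w [wJ w_rec]] := divided_power_basis l J N.
pose ext v : V := [ffun a => if a is inr f then
  \sum_(g | supported J g) v (inr g) * w g f else 0].
have subE (x y : V) a : (x - y) a = x a - y a by rewrite !ffunE.
have ext_stab v : stab L (ext v).
  split=> [e|f]; last first.
    have -> : bracket_y (ext v) f = 0; last exact: L_sub.1.
    by apply/rowP => i; rewrite !mxE big1// => e _; rewrite ffunE.
  have -> : bracket_x (ext v) e = \sum_(j in J)
      bracket_x (ext v) e 0 j *: row j (1%:M + N); last exact: echelon_lift L_sub L_ech.
  apply/rowP => i; rewrite (echelon_liftE _ _ L_ech); case: ifPn => // iJ.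
  rewrite (echelon_mulmx _ _ L_ech) (negPf iJ) mxE ffunE.
  under eq_bigr do rewrite w_rec// mulr_sumr.
  rewrite exchange_big/=; apply: eq_bigr => j jJ.
  rewrite mxE ffunE mulr_suml; apply: eq_bigr => g _.
  by rewrite mulrA mulrAC.
have ext_good v f : supported J f -> ext v (inr f) = v (inr f).
  move=> fJ; rewrite ffunE (bigD1 f)//= wJ// eqxx mulr1 big1 ?addr0//.
  by move=> g /andP[_ /negPf gf]; rewrite wJ// gf mulr0.
have extB v v' : ext (v - v') = ext v - ext v'.
  apply/ffunP => -[e|f]; rewrite !ffunE ?subr0// -sumrB.
  by apply: eq_bigr => g _; rewrite !ffunE mulrBl.
have ext_pi z a : rho (ext (pi *: z) a) = 0.
  case: a => [e|f]; rewrite ffunE ?rmorph0// rmorph_sum big1// => g _.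
  by rewrite ffunE !rmorphM res_uniformizer !mul0r.
pose D v := v - ext v.
have DB v v' : D (v - v') = D v - D v' by rewrite /D extB !opprD addrACA.
have DE v a : D v a = v a - ext v a by rewrite !ffunE.
have modP v : mod_uniformizer u (stab L) v <-> forall a, rho (D v a) = 0.
  split=> [[z]|Dv]; last first.
    have [z zE] := res_eq0_ffun Dv.
    by exists z; rewrite /= -zE opprB addrC subrK.
  rewrite -[v in v - _]/v /=; set s := v - pi *: z => sz a.
  have -> : rho (D v a) = rho (D s a).
    rewrite /s DB subE rmorphB [D (pi *: z) a]DE rmorphB ext_pi.
    suff -> : rho ((pi *: z) a) = 0 by rewrite !subr0.
    by rewrite ffunE rmorphM res_uniformizer mul0r.
  have es := ext_stab s; rewrite DE rmorphB.
  case: a => [e|f]; first by rewrite (stab_res_x sz i0J) (stab_res_x es i0J) subrr.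
  apply: (res_y_unique (t := fun f => rho (s (inr f)) - rho (ext s (inr f)))).
    move=> e i iJ; have := res_echelon (sz.1 e) iJ; have := res_echelon (es.1 e) iJ.
    rewrite !mxE => -> ->; rewrite -sumrB; apply: eq_bigr => j _.
    by rewrite !mxE mulrBl.
  by move=> g gJ; rewrite ext_good// subrr.
pose T := {ffun {a | new_coordinate a} -> k}.
pose c v : T := [ffun a => rho (D v (val a))].
exists T, c; split; last by rewrite card_ffun card_sig.
split=> [t|v v'].
  have [s sP] := choice (res_surj u).
  exists [ffun a => if insub a is Some a' then s (t a') else 0].
  apply/ffunP => a; rewrite ffunE; set v : V := [ffun a => _].
  have ext0 : ext v = 0.
    apply/ffunP => -[e|f]; rewrite !ffunE// big1// => g gJ.
    by rewrite ffunE insubF ?mul0r// /new_coordinate gJ.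
  by rewrite /D ext0 subr0 ffunE valK sP.
have resD a : rho (D (v - v') a) = rho (D v a) - rho (D v' a).
  by rewrite DB subE rmorphB.
have cE x a : c x a = rho (D x (val a)) by rewrite ffunE.
rewrite modP; split=> [/ffunP cvv a|vv].
  case: (boolP (new_coordinate a)) => [new_a|].
    by have := cvv (Sub a new_a); rewrite !cE/= resD => ->; rewrite subrr.
  case: a => [//|f] /negPn fJ.
  by rewrite DE ext_good// subrr rmorph0.
apply/ffunP => a; rewrite !cE; apply/eqP; rewrite -subr_eq0 -resD.
by rewrite vv.
Qed.

End Echelon.
End Stabilizer.

(** * The index of the stabilizer *)

Section StabilizerIndex.
Variables (o : idomainType) (u : uniformized o) (n l : nat).
Local Notation q := #|res_field u|.
Local Notation E := (tuples_of_sum n l).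
Local Notation F := (tuples_of_sum n l.+1).

Lemma num_eE j : (0 < j)%N -> num_e l.+1 j = 'C((j + l).-1, l).
Proof.
move=> j0; rewrite /num_e -[RHS]bin_sub; last by lia.
by congr 'C(_, _); lia.
Qed.

Lemma card_E : (0 < n)%N -> #|{: E}| = num_e l.+1 n.
Proof. by move=> n0; rewrite card_tuples_of_sum num_eE. Qed.

Lemma card_F : (0 < n)%N -> #|{: F}| = num_f l.+1 n.
Proof.
move=> n0; rewrite card_tuples_of_sum /num_f -[LHS]bin_sub; last by lia.
by congr 'C(_, _); lia.
Qed.

Lemma hockey_stick r d :
  'C(r + d + l, l.+1) =
  ('C(r + l, l.+1) + \sum_(r.+1 <= j < (r + d).+1) num_e l.+1 j)%N.
Proof.
elim: d => [|d IHd]; first by rewrite addn0 big_geq ?addn0.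
rewrite addnS addSn binS IHd [in RHS]big_nat_recr/=; last by rewrite ltnS leq_addr.
by rewrite num_eE// addSn addnA.
Qed.

(** The exponent of the index of stab L + pi V, in terms of the corank of L. *)
Definition stab_exp (c : nat) : nat :=
  if c == 0%N then 0%N else
  (num_e l.+1 n + \sum_((n - c).+1 <= j < n.+1) num_e l.+1 j)%N.

Lemma card_new_coordinate (J : {set 'I_n}) i0 : i0 \notin J ->
  #|[pred a : E + F | new_coordinate J a]| = stab_exp #|~: J|.
Proof.
move=> i0J; have n0 : (0 < n)%N by rewrite (leq_ltn_trans _ (ltn_ord i0)).
have cJ0 : #|~: J| != 0%N.
  by rewrite cards_eq0; apply/set0Pn; exists i0; rewrite finset.in_setC.
have cJ : (#|J| + #|~: J| = n)%N by rewrite cardsC card_ord.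
rewrite /stab_exp (negPf cJ0).
have -> : (n - #|~: J| = #|J|)%N by lia.
have -> : #|[pred a : E + F | new_coordinate J a]| =
    (#|{: E}| + #|~: finset (fun f : F => supported J f)|)%N.
  rewrite -[LHS]sum1_card [LHS]big_sumType/= !sum1_card; congr (_ + _)%N.
  by apply: eq_card => f; rewrite [RHS]finset.in_setC finset.in_set.
rewrite card_E//; congr (_ + _)%N.
have := cardsC (finset (fun f : F => supported J f)).
rewrite card_supported card_tuples_of_sum.
have -> : ((n + l.+1).-1 = #|J| + #|~: J| + l)%N by rewrite cJ; lia.
have -> : ((#|J| + l.+1).-1 = #|J| + l)%N by lia.
rewrite hockey_stick cJ.
by move=> /eqP; rewrite eqn_add2l => /eqP.
Qed.

Lemma stab_div (L : set 'rV[o]_n) : lattice L -> lattice (stab (l := l) (pi_div u L)) ->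
  (0 < corank u L)%N ->
  has_index (stab (l := l) L)
    (q ^ stab_exp (corank u L) * subgroup_index (stab (l := l) (pi_div u L))).
Proof.
move=> [L_sub _] lat_div cL; have [J [N L_ech]] := echelon_exists u L_sub.
have [i0 i0J] : exists i0, i0 \notin J.
  move: cL; rewrite (echelon_corank L_sub L_ech) card_gt0 => /set0Pn[j].
  by rewrite finset.in_setC; exists j.
apply: (@index_pi_div _ u); first exact: submod_stab.
  rewrite (echelon_corank L_sub L_ech) -(card_new_coordinate i0J).
  exact: stab_mod_index L_sub L_ech _ i0J.
by rewrite pi_div_stab; exact: lattice_index.
Qed.

Lemma stab_lattice (L : set 'rV[o]_n) : lattice L -> lattice (stab (l := l) L).
Proof.
elim/(lattice_ind (u := u)) => [|L' latL' cL' lat_div].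
  by rewrite stabT; exact: latticeT.
split; first exact: submod_stab latL'.1.
exact: (has_index_finite (stab_div latL' lat_div cL')).1.
Qed.

Lemma stab_index_div (L : set 'rV[o]_n) : lattice L -> (0 < corank u L)%N ->
  subgroup_index (stab (l := l) L) =
  (q ^ stab_exp (corank u L) * subgroup_index (stab (l := l) (pi_div u L)))%N.
Proof.
move=> latL cL; have lat_div := stab_lattice (lattice_pi_div u latL).
exact: (has_index_finite (stab_div latL lat_div cL)).2.
Qed.

End StabilizerIndex.

(** * Ideals with given central and noncentral parts *)

Section IdealParts.
Variables (o : idomainType) (u : uniformized o) (n l : nat).
Local Notation E := (tuples_of_sum n l).
Local Notation F := (tuples_of_sum n l.+1).
Local Notation V := {ffun (E + F)%type -> o^o}.
Local Notation L := (Lmn l.+1 n o).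
Local Notation br := (@Lbracket l.+1 n o).
Implicit Types (x y : L) (v : V) (z : 'rV[o]_n).

Definition zpart x : 'rV[o]_n := \row_i x (inr i).
Definition vpart x : V := [ffun a => x (inl a)].
Definition zincl z : L := [ffun c => if c is inr i then z 0 i else 0].
Definition vincl v : L := [ffun c => if c is inl a then v a else 0].

Lemma zpart_linear : linear zpart.
Proof. by move=> a x y; apply/rowP => i; rewrite !mxE !ffunE. Qed.
HB.instance Definition _ := GRing.isLinear.Build o L 'rV[o]_n _ zpart zpart_linear.

Lemma vpart_linear : linear vpart.
Proof. by move=> a x y; apply/ffunP => i; rewrite !ffunE. Qed.
HB.instance Definition _ := GRing.isLinear.Build o L V _ vpart vpart_linear.

Lemma zincl_linear : linear zincl.
Proof.
move=> a x y; apply/ffunP => -[c|i]; rewrite !ffunE ?mxE//.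
by rewrite scaler0 addr0.
Qed.
HB.instance Definition _ := GRing.isLinear.Build o 'rV[o]_n L _ zincl zincl_linear.

Lemma vincl_linear : linear vincl.
Proof.
move=> a x y; apply/ffunP => -[c|i]; rewrite !ffunE//.
by rewrite scaler0 addr0.
Qed.
HB.instance Definition _ := GRing.isLinear.Build o V L _ vincl vincl_linear.

Lemma zpart_zincl z : zpart (zincl z) = z.
Proof. by apply/rowP => i; rewrite mxE ffunE. Qed.

Lemma vpart_zincl z : vpart (zincl z) = 0.
Proof. by apply/ffunP => a; rewrite !ffunE. Qed.

Lemma zpart_vincl v : zpart (vincl v) = 0.
Proof. by apply/rowP => i; rewrite !mxE ffunE. Qed.

Lemma vpart_vincl v : vpart (vincl v) = v.
Proof. by apply/ffunP => a; rewrite !ffunE. Qed.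

Lemma partsK x : vincl (vpart x) + zincl (zpart x) = x.
Proof. by apply/ffunP => -[a|i]; rewrite !ffunE ?mxE ?addr0 ?add0r. Qed.

Lemma vpart_bracket x y : vpart (br x y) = 0.
Proof.
apply/ffunP => a; rewrite !ffunE big1// => b _; rewrite big1// => c _.
by case: b c => [[?|?]|?] [[?|?]|?]; case: a => ?; rewrite /= mulr0.
Qed.

Lemma zpart_bracket x y : zpart (br x y) =
  \sum_e x (inl (inl e)) *: bracket_x (vpart y) e -
  \sum_f x (inl (inr f)) *: bracket_y (vpart y) f.
Proof.
apply/rowP => i; rewrite mxE ffunE.
rewrite big_sumType/= [X in _ + X]big1 ?addr0; last first.
  by move=> j _; rewrite big1// => b _; rewrite mulr0.
rewrite big_sumType/= mxE [X in _ = _ + X]mxE !summxE; congr (_ + _).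
  apply: eq_bigr => e _; rewrite big_sumType/= [X in _ + X]big1 ?addr0; last first.
    by move=> j _; rewrite mulr0.
  rewrite big_sumType/= big1 ?add0r; last by move=> e' _; rewrite mulr0.
  rewrite (bigD1 (add_std e i))//= differ_by_stdE eqxx big1 ?addr0; last first.
    by move=> f /negPf fe; rewrite differ_by_stdE eq_sym fe mulr0.
  by rewrite !mxE ffunE mulr1.
rewrite -sumrN; apply: eq_bigr => f _.
rewrite big_sumType/= [X in _ + X]big1 ?addr0; last first.
  by move=> j _; rewrite mulr0.
rewrite big_sumType/= [X in _ + X]big1 ?addr0; last by move=> f' _; rewrite mulr0.
rewrite !mxE mulr_sumr -sumrN [RHS]big_mkcond/=.
apply: eq_bigr => e _; rewrite differ_by_stdE ffunE mulrNz mulrN.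
by case: eqP => _; rewrite ?mulr1// mulr0 oppr0.
Qed.

(** Bracketing with single basis elements isolates the families bracket_x and
    bracket_y; the bracket with a general element combines them linearly. *)
Lemma bracket_in (M : set 'rV[o]_n) y : submod M ->
  (forall x, M (zpart (br x y))) <-> stab M (vpart y).
Proof.
move=> sM; split=> [My|[yx yy] x].
  split=> [e|f].
    have := My [ffun c => if c == inl (inl e) then 1 else 0].
    rewrite zpart_bracket (bigD1 e)//= !ffunE eqxx scale1r big1 ?addr0.
      by rewrite big1 ?subr0// => f _; rewrite ffunE scale0r.
    by move=> e' /negPf ee'; rewrite ffunE -[_ == _]/(e' == e) ee' scale0r.
  have := submodZ (-1) sM (My [ffun c => if c == inl (inr f) then 1 else 0]).
  rewrite scaleN1r zpart_bracket big1 ?sub0r ?opprK; last first.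
    by move=> e _; rewrite ffunE scale0r.
  rewrite (bigD1 f)//= !ffunE eqxx scale1r big1 ?addr0//.
  by move=> f' /negPf ff'; rewrite ffunE -[_ == _]/(f' == f) ff' scale0r.
rewrite zpart_bracket; apply: (submod_subgroup sM).2.
  by apply: submod_sum => // e _; apply: submodZ.
by apply: submod_sum => // f _; apply: submodZ.
Qed.

Definition ideal_lattice (I : set L) :=
  [/\ submod I, forall x y, I y -> I (br x y) & finite_index I].

Lemma ideal_latticeP (I : set L) : finite_index_ideals br I <-> ideal_lattice I.
Proof. by split=> -[/submodP sI Ibr fI]; split=> //; apply/submodP. Qed.

Definition zideal (I : set L) : set 'rV[o]_n := zincl @^-1` I.
Definition videal (I : set L) : set V := vpart @` I.

Lemma submod_videal (I : set L) : submod I -> submod (videal I).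
Proof.
move=> [I0 Icl]; split=> [|a _ _ [x Ix <-] [y Iy <-]].
  by exists 0 => //; rewrite linear0.
by exists (a *: x + y); [exact: Icl | rewrite linearP].
Qed.

Lemma videal_stab I : ideal_lattice I -> videal I `<=` stab (zideal I).
Proof.
move=> [sI Ibr _] _ [y Iy <-]; apply/bracket_in => [|x].
  exact: (submod_preimage zincl).
rewrite /zideal/= -[zincl _]add0r -[0]/(0 : L).
have -> : (0 : L) = vincl (vpart (br x y)) by rewrite vpart_bracket linear0.
by rewrite partsK; exact: Ibr.
Qed.

Lemma zideal_lattice I : ideal_lattice I -> lattice (zideal I).
Proof.
move=> [sI _ fI]; split; first exact: (submod_preimage zincl).
have kI := finite_has_index (submod_subgroup sI) fI.
have [a [b [_ /has_index_finite[fb _] _]]] :=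
  index_split_inv zincl (submod_subgroup sI) kI.
exact: fb.
Qed.

Lemma videal_lattice I : ideal_lattice I -> lattice (videal I).
Proof.
move=> [sI _ fI]; split; first exact: submod_videal.
have kI := finite_has_index (submod_subgroup sI) fI.
have sv := submod_subgroup (submod_videal sI).
have [k hk] : exists k, has_index (vpart @^-1` videal I) k.
  apply: has_index_sup kI _ _; first exact: subgroup_preimage.
  by move=> x Ix; exists x.
have vsurj (v : V) : exists x, vpart x = v.
  by exists (vincl v); rewrite vpart_vincl.
exact: (has_index_finite (proj2 (@index_preimage _ _ vpart _ sv k vsurj) hk)).1.
Qed.

(** Ideals I with given intersection M with the centre span of the z_i and given
    image h(o^d) in the quotient correspond to the linear maps from o^d to
    o^n / M, that is to d-tuples of classes modulo M. *)
Lemma ideal_fiber (M : set 'rV[o]_n) d (h : {linear 'rV[o]_d -> V}) k :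
  lattice M -> injective h -> range h `<=` stab M -> has_index (range h) k ->
  exists (T : finType) (I_ : {ffun 'I_d -> T} -> set L),
  [/\ #|T| = subgroup_index M, injective I_,
      forall phi, [/\ ideal_lattice (I_ phi), zideal (I_ phi) = M,
        videal (I_ phi) = range h &
        subgroup_index (I_ phi) = (k * subgroup_index M)%N] &
      forall I, ideal_lattice I -> zideal I = M -> videal I = range h ->
        exists phi, I = I_ phi].
Proof.
move=> latM h_inj h_stab hk; have [M_sub _] := latM.
have M_grp := submod_subgroup M_sub.
have [T [c [[c_surj cP] cardT]]] := lattice_index latM.
have [rep repK] := choice c_surj.
pose s (phi : {ffun 'I_d -> T}) (y : 'rV[o]_d) := \sum_i y 0 i *: rep (phi i).
have sP phi a (y y' : 'rV[o]_d) : s phi (a *: y + y') = a *: s phi y + s phi y'.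
  rewrite scaler_sumr -big_split/=; apply: eq_bigr => i _.
  by rewrite !mxE scalerDl scalerA.
have s0 phi : s phi 0 = 0.
  by apply: big1 => i _; rewrite mxE scale0r.
have s_delta phi i : s phi (delta_mx 0 i) = rep (phi i).
  rewrite /s (bigD1 i)//= big1 => [|j ji]; rewrite mxE eqxx/= ?eqxx ?(negPf ji).
    by rewrite scale1r addr0.
  by rewrite scale0r.
pose I_ phi : set L :=
  [set x | exists2 y : 'rV[o]_d, vpart x = h y & M (zpart x - s phi y)].
have I_sub phi : submod (I_ phi).
  split=> [|a x x' [y xy Mx] [y' xy' Mx']].
    by exists 0; rewrite ?linear0// s0 subr0; exact: M_sub.1.
  exists (a *: y + y'); first by rewrite !linearP/= xy xy'.
  have -> : zpart (a *: x + x') - s phi (a *: y + y') =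
      a *: (zpart x - s phi y) + (zpart x' - s phi y').
    by rewrite linearP sP scalerBr opprD addrACA.
  exact: M_sub.2.
have zI phi : zideal (I_ phi) = M.
  apply/seteqP; split=> z; rewrite /zideal/I_/=.
    move=> [y]; rewrite vpart_zincl zpart_zincl -(linear0 h) => /h_inj <-.
    by rewrite s0 subr0.
  by move=> Mz; exists 0; rewrite ?vpart_zincl ?linear0// zpart_zincl s0 subr0.
have vI phi : videal (I_ phi) = range h.
  apply/seteqP; split=> [_ [x [y xy _] <-]|_ [y _ <-]]; first by exists y.
  exists (vincl (h y) + zincl (s phi y)).
    exists y; rewrite linearD/= ?vpart_vincl ?vpart_zincl ?addr0//.
    by rewrite zpart_vincl zpart_zincl add0r subrr; exact: M_sub.1.
  by rewrite linearD/= vpart_vincl vpart_zincl addr0.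
have range_grp : subgroup (range h) := has_index_subgroup hk.
have vsurj (v : V) : exists x, vpart x = v.
  by exists (vincl v); rewrite vpart_vincl.
have I_index phi : has_index (I_ phi) (k * subgroup_index M).
  apply: (@index_split _ _ zincl); first exact: submod_subgroup.
    have -> : sum_range zincl (I_ phi) = vpart @^-1` range h.
      rewrite -(vI phi); apply/seteqP; split=> [x [z Ixz]|x [y Iy yx]].
        by exists (x - zincl z) => //; rewrite linearB/= vpart_zincl subr0.
      exists (zpart x - zpart y).
      suff -> : x - zincl (zpart x - zpart y) = y by [].
      rewrite -[RHS]partsK -{1}[x]partsK -yx (raddfB zincl) opprB -addrA.
      by rewrite [zincl (zpart x) + _]addrC subrK.
    exact: (proj1 (@index_preimage _ _ vpart _ range_grp k vsurj) hk).
  by rewrite -/(zideal _) zI; exact: lattice_index.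
exists T, I_; split=> // [phi phi' II|phi|I latI zIM vIh].
- apply/ffunP => i.
  have : I_ phi (vincl (h (delta_mx 0 i)) + zincl (rep (phi i))).
    exists (delta_mx 0 i); rewrite linearD/= ?vpart_vincl ?vpart_zincl ?addr0//.
    by rewrite zpart_vincl zpart_zincl add0r s_delta subrr; exact: M_sub.1.
  rewrite II => -[y]; rewrite linearD/= vpart_vincl vpart_zincl addr0 => /h_inj <-.
  rewrite linearD/= zpart_vincl zpart_zincl add0r s_delta => /cP.
  by rewrite !repK.
- have fI := has_index_finite (I_index phi).
  split=> //; last exact: fI.2.
  split=> //; last exact: fI.1.
  move=> x y Iy; exists 0; first by rewrite vpart_bracket linear0.
  rewrite s0 subr0; apply: (proj2 (bracket_in y M_sub)); apply: h_stab.
  by rewrite -(vI phi); exists y.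
have [I_sub' _ _] := latI; have I_grp := submod_subgroup I_sub'.
have /choice[z zP] : forall i, exists z, I (vincl (h (delta_mx 0 i)) + zincl z).
  move=> i; have : videal I (h (delta_mx 0 i)) by rewrite vIh; exists (delta_mx 0 i).
  by move=> [x Ix xi]; exists (zpart x); rewrite -xi partsK.
have Iz w : I (zincl w) <-> M w by rewrite -zIM.
pose phi := [ffun i => c (z i)]; exists phi.
pose t (y : 'rV[o]_d) := \sum_i y 0 i *: z i.
have It (y : 'rV[o]_d) : I (vincl (h y) + zincl (t y)).
  have -> : vincl (h y) + zincl (t y) =
      \sum_i y 0 i *: (vincl (h (delta_mx 0 i)) + zincl (z i)).
    rewrite {1}[y]row_sum_delta /t !linear_sum/= -big_split/=.
    by apply: eq_bigr => i _; rewrite scalerDr !linearZ.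
  by apply: submod_sum => // i _; apply: submodZ.
have st (y : 'rV[o]_d) : M (t y - s phi y).
  rewrite /t /s -sumrB; apply: submod_sum => // i _.
  rewrite -scalerBr; apply: submodZ => //; apply/cP.
  by rewrite ffunE repK.
apply/seteqP; split=> [x Ix|x [y xy Mx]].
  have [y _ yx] : range h (vpart x) by rewrite -vIh; exists x.
  exists y; first by rewrite yx.
  rewrite -[zpart x](subrK (t y)) -addrA; apply: submodD => //.
  apply/Iz; have := I_grp.2 _ _ Ix (It y).
  by rewrite -{1}[x]partsK yx opprD addrACA subrr add0r -linearB.
rewrite -[x]partsK xy -[zpart x](subrK (t y)) linearD/= addrCA.
apply: submodD => //; apply/Iz.
have := M_grp.2 _ _ Mx (st y).
by rewrite opprB addrA subrK.
Qed.

End IdealParts.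

(** * The parametrization of ideals *)

Section IdealFibers.
Variables (o : idomainType) (u : uniformized o) (n l d : nat).
Local Notation E := (tuples_of_sum n l).
Local Notation F := (tuples_of_sum n l.+1).
Local Notation V := {ffun (E + F)%type -> o^o}.
Local Notation L := (Lmn l.+1 n o).
Local Notation br := (@Lbracket l.+1 n o).
Local Notation latt n := (@finite_index_submodules o ('rV[o]_n : lmodType o)).
Local Notation ideals := (finite_index_ideals br).

Hypothesis card_EF : #|{: E + F}| = d.

Definition coord_map (x : 'rV[o]_d) : V :=
  [ffun a => x 0 (cast_ord card_EF (enum_rank a))].

Lemma coord_map_linear : linear coord_map.
Proof. by move=> a x y; apply/ffunP => i; rewrite !ffunE !mxE. Qed.
HB.instance Definition _ :=
  GRing.isLinear.Build o 'rV[o]_d V _ coord_map coord_map_linear.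

Lemma coord_map_inj : injective coord_map.
Proof.
move=> x y /ffunP xy; apply/rowP => i.
have := xy (enum_val (cast_ord (esym card_EF) i)).
by rewrite !ffunE enum_valK cast_ordKV.
Qed.

Lemma coord_map_surj v : exists x, coord_map x = v.
Proof.
exists (\row_i v (enum_val (cast_ord (esym card_EF) i))).
by apply/ffunP => a; rewrite !ffunE mxE cast_ordK enum_rankK.
Qed.

(** The lattice stab M is free of the same rank d as the whole space, so its
    sublattices are enumerated by those of o^d. *)
Lemma stab_param (M : set 'rV[o]_n) : lattice M ->
  exists g : {linear 'rV[o]_d -> V}, injective g /\ range g = stab M.
Proof.
move=> latM; have [sub_stab _] := stab_lattice u l latM.
have grp := submod_subgroup sub_stab.
have idx := lattice_index (stab_lattice u l latM).
have latP : lattice (coord_map @^-1` stab M).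
  split; first exact: submod_preimage.
  exact: (has_index_finite (proj1 (@index_preimage _ _ coord_map _ grp _
    coord_map_surj) idx)).1.
have [B [B_inj BE]] := lattice_basis u latP.
exists (coord_map \o mulmxr B : {linear 'rV[o]_d -> V}); split.
  move=> x y /coord_map_inj /eqP; rewrite -subr_eq0 -linearB => /eqP/B_inj/eqP.
  by rewrite subr_eq0 => /eqP.
apply/seteqP; split=> [_ [x _ <-]|v sv].
  have : range (mulmxr B) (mulmxr B x) by exists x.
  by rewrite -BE.
have [x xv] := coord_map_surj v.
have : range (mulmxr B) x by rewrite -BE /= xv.
by move=> [y _ yx]; exists y => //=; rewrite -[_ *m _]/(mulmxr B y) yx.
Qed.

(** The map p sends an ideal to its intersection with the centre span of the z_i
    and to its image in the quotient, the latter in coordinates of stab. *)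
Lemma ideal_fibers :
  exists (p : ideals -> latt n * latt d) (fib : latt n * latt d -> {fset ideals}),
  (forall I x, (I \in fib x) = (p I == x)) /\
  forall x, #|` fib x| = (subgroup_index (val x.1) ^ d)%N /\
    forall I : ideals, I \in fib x -> subgroup_index (val I) =
      (subgroup_index (stab (l := l) (val x.1)) * subgroup_index (val x.2) *
       subgroup_index (val x.1))%N.
Proof.
have /choice[g gP] : forall M : latt n, exists g : {linear 'rV[o]_d -> V},
    injective g /\ range g = stab (val M).
  by move=> M; apply: stab_param; exact: latt_lattice.
have latI (I : ideals) : ideal_lattice (val I).
  by apply/ideal_latticeP; exact: set_mem (valP I).
have /choice[p pP] : forall I : ideals, exists x : latt n * latt d,
    val x.1 = zideal (val I) /\ val x.2 = g x.1 @^-1` videal (val I).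
  move=> I; have [M ME] := lattice_latt (zideal_lattice (latI I)).
  have latv := videal_lattice (latI I); have vgrp := submod_subgroup latv.1.
  have [|M' M'E] := @lattice_latt _ _ (g M @^-1` videal (val I)).
    split; first exact: (submod_preimage _ latv.1).
    have [a [b [_ /has_index_finite[fb _] _]]] :=
      index_split_inv (g M) vgrp (lattice_index latv).
    exact: fb.
  by exists (M, M').
have fibE (x : latt n * latt d) : exists A : {fset ideals},
  [/\ forall I, (I \in A) = (p I == x),
    #|` A| = (subgroup_index (val x.1) ^ d)%N &
    forall I : ideals, I \in A -> subgroup_index (val I) =
      (subgroup_index (stab (l := l) (val x.1)) * subgroup_index (val x.2) *
       subgroup_index (val x.1))%N].
  case: x => M M'; have [g_inj gM] := gP M.
  have latM := latt_lattice M; have latM' := latt_lattice M'.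
  have [C [C_inj CE]] := lattice_basis u latM'.
  pose h : {linear 'rV[o]_d -> V} := g M \o mulmxr C.
  have h_inj : injective h.
    move=> x y /g_inj /eqP; rewrite -subr_eq0 -linearB => /eqP/C_inj/eqP.
    by rewrite subr_eq0 => /eqP.
  have hM' : range h = g M @` val M'.
    rewrite CE; apply/seteqP; split=> [_ [y _ <-]|_ [_ [y _ <-] <-]].
      by exists (mulmxr C y) => //; exists y.
    by exists y.
  have h_stab : range h `<=` stab (val M).
    by rewrite hM' -gM => _ [y _ <-]; exists y.
  have h_sub : submod (range h).
    split=> [|a _ _ [x _ <-] [y _ <-]]; first by exists 0; rewrite ?linear0.
    by exists (a *: x + y); rewrite ?linearP.
  have pre_h : g M @^-1` range h = val M'.
    rewrite hM'; apply/seteqP; split=> [y [z Mz /g_inj <-]|y My] //.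
    by exists y.
  have h_idx : has_index (range h)
      (subgroup_index (stab (l := l) (val M)) * subgroup_index (val M')).
    apply: (@index_split _ _ (g M)); first exact: submod_subgroup.
      have -> : sum_range (g M) (range h) = stab (val M).
        rewrite -gM; apply/seteqP; split=> [v [y [z _ zv]]|_ [y _ <-]].
          by exists (mulmxr C z + y) => //; rewrite linearD -[g M _]/(h z) zv subrK.
        by exists y; rewrite subrr; exact: h_sub.1.
      exact: lattice_index (stab_lattice u l latM).
    by rewrite pre_h; exact: lattice_index.
  have [T [I_ [cardT I_inj I_P I_surj]]] := ideal_fiber latM h_inj h_stab h_idx.
  have /choice[J JP] : forall phi, exists I : ideals, val I = I_ phi.
    move=> phi; have [/ideal_latticeP/mem_set idI _ _ _] := I_P phi.
    by exists (Sub (I_ phi) idI).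
  have J_inj : injective J.
    by move=> phi phi' JJ; apply: I_inj; rewrite -!JP JJ.
  exists [fset J phi | phi in {ffun 'I_d -> T}]%fset; split.
  - move=> I; apply/imfsetP/eqP => [[phi _ ->]|pI].
      have [zp vp] := pP (J phi); have [_ zI vI _] := I_P phi.
      have p1 : (p (J phi)).1 = M by apply: val_inj; rewrite zp JP zI.
      rewrite p1 in vp; have p2 : (p (J phi)).2 = M'.
        by apply: val_inj; rewrite vp JP vI pre_h.
      by rewrite [p _]surjective_pairing p1 p2.
    have [zp0 vp0] := pP I; rewrite pI in zp0 vp0.
    have zp : val M = zideal (val I) := zp0.
    have vp : val M' = g M @^-1` videal (val I) := vp0.
    have [phi phiE] : exists phi, val I = I_ phi.
      apply: I_surj => //; rewrite hM' vp; apply/seteqP; split=> [v Iv|_ [y Iy <-]] //.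
      have [y _ yv] : range (g M) v by rewrite gM zp; exact: videal_stab Iv.
      by exists y => //=; rewrite yv.
    by exists phi => //; apply: val_inj; rewrite JP.
  - rewrite card_imfset//=;
    have <- : #|{ffun 'I_d -> T}| = (subgroup_index (val M) ^ d)%N.
      by rewrite card_ffun cardT card_ord.
    by rewrite cardE.
  move=> I /imfsetP[phi _ ->]; rewrite JP.
  by have [_ _ _ ->] := I_P phi.
have [fib fibP] := choice fibE.
exists p, fib; split=> [I x|x]; first by have [->] := fibP x.
by have [_] := fibP x.
Qed.

End IdealFibers.

(** * Complex powers and weights *)

Section ComplexPowers.
Variable R : realType.
Local Open Scope complex_scope.
Implicit Types (z w s : R[i]) (x : R) (k : nat).

Lemma cexpD z w : cexp (z + w) = cexp z * cexp w.
Proof.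
case: z w => [a b] [c e]; rewrite /cexp/= expRD cosD sinD; simpc.
by congr (_ +i* _); ring.
Qed.

Lemma cexp0 : cexp (0 : R[i]) = 1.
Proof. by rewrite /cexp/= expR0 cos0 sin0; simpc. Qed.

Lemma norm_cexp z : `|cexp z| = (expR (complex.Re z))%:C.
Proof.
case: z => a b; rewrite /cexp/= normrM normc_def/= normc_def/=.
rewrite expr0n/= addr0 sqrtr_sqr (ger0_norm (expR_ge0 _)) cos2Dsin2 sqrtr1.
by rewrite mulr1.
Qed.

Lemma cpowD x z w : cpow x (z + w) = cpow x z * cpow x w.
Proof. by rewrite /cpow mulrDr cexpD. Qed.

Lemma cpowM x y z : 0 < x -> 0 < y -> cpow (x * y) z = cpow x z * cpow y z.
Proof.
move=> x0 y0; rewrite /cpow lnM ?posrE// rmorphD mulrDl.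
exact: cexpD.
Qed.

Lemma cpow1 z : cpow 1 z = 1.
Proof. by rewrite /cpow ln1 mul0r cexp0. Qed.

Lemma cpow0 x : cpow x 0 = 1.
Proof. by rewrite /cpow mulr0 cexp0. Qed.

Lemma cpowMn x z k : cpow x (z * k%:R) = cpow x z ^+ k.
Proof.
elim: k => [|k IHk]; first by rewrite mulr0 cpow0 expr0.
by rewrite -natr1 mulrDr mulr1 cpowD IHk exprSr.
Qed.

Lemma cpow_nat x k : 0 < x -> cpow x k%:R = x%:C ^+ k.
Proof.
move=> x0; rewrite -[k%:R]mul1r cpowMn; congr (_ ^+ _).
by rewrite /cpow mulr1 /cexp/= lnK ?posrE// cos0 sin0; simpc.
Qed.

(** The term k^(-s) of a Dirichlet series, and its modulus. *)
Definition chiC s k : R[i] := cpow k%:R (- s).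
Definition chiR s k : R := expR (- (ln k%:R * complex.Re s)).

Lemma norm_chiC s k : `|chiC s k| = (chiR s k)%:C.
Proof.
rewrite /chiC /cpow norm_cexp; congr (expR _)%:C.
by case: s => a b /=; rewrite mul0r subr0 mulrN.
Qed.

Lemma chiCM s k k' : (0 < k)%N -> (0 < k')%N ->
  chiC s (k * k') = chiC s k * chiC s k'.
Proof. by move=> k0 k'0; rewrite /chiC natrM cpowM ?ltr0n. Qed.

Lemma chiC1 s : chiC s 1 = 1.
Proof. by rewrite /chiC cpow1. Qed.

Lemma chiRM s k k' : (0 < k)%N -> (0 < k')%N ->
  chiR s (k * k') = chiR s k * chiR s k'.
Proof.
move=> k0 k'0; rewrite /chiR natrM lnM ?posrE ?ltr0n// mulrDl opprD.
exact: expRD.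
Qed.

Lemma chiR1 s : chiR s 1 = 1.
Proof. by rewrite /chiR ln1 mul0r oppr0 expR0. Qed.

Lemma chiR_gt0 s k : 0 < chiR s k.
Proof. exact: expR_gt0. Qed.

End ComplexPowers.

Section Weights.
Variables (o : idomainType) (u : uniformized o) (n l d : nat).
Variables (K : numFieldType) (chi : nat -> K).
Hypothesis chi1 : chi 1 = 1.
Hypothesis chiM : forall a b, (0 < a)%N -> (0 < b)%N -> chi (a * b) = chi a * chi b.
Local Notation q := #|res_field u|.
Local Notation latt n := (@finite_index_submodules o ('rV[o]_n : lmodType o)).

(** The contribution of the intersection M of an ideal with the span of the
    z_i. *)
Definition center_weight (M : latt n) : K :=
  (subgroup_index (val M) ^ d)%:R *
  chi (subgroup_index (stab (l := l) (val M)) * subgroup_index (val M)).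

Definition index_weight (M : latt d) : K := chi (subgroup_index (val M)).

Definition center_step (c : nat) : K :=
  q%:R ^+ (d * c) * chi q ^+ (c + stab_exp n l c).
Definition index_step (c : nat) : K := chi q ^+ c.

Lemma card_res_gt0 : (0 < q)%N.
Proof. exact: ltn_trans (card_res_gt1 u). Qed.

Lemma chiX c : chi (q ^ c) = chi q ^+ c.
Proof.
elim: c => [|c IHc]; first by rewrite expn0 chi1.
by rewrite expnS chiM ?expn_gt0 ?card_res_gt0// IHc exprS.
Qed.

Lemma lattice_index_gt0 (V : lmodType o) (M : set V) :
  lattice M -> (0 < subgroup_index M)%N.
Proof. by move=> /lattice_index/has_index_gt0. Qed.

Lemma index_weight_mult : multiplicative_weight u index_step index_weight.
Proof.
split=> M cM; have latM := latt_lattice M.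
  by rewrite /index_weight (corank0 latM.1 cM) subgroup_indexT.
have i0 := lattice_index_gt0 (lattice_pi_div u latM).
rewrite /index_weight (lattice_index_pi_div u latM) chiM ?expn_gt0 ?card_res_gt0//.
by rewrite chiX.
Qed.

Lemma center_weight_mult : multiplicative_weight u center_step center_weight.
Proof.
split=> M cM; have latM := latt_lattice M.
  rewrite /center_weight (corank0 latM.1 cM) stabT !subgroup_indexT.
  by rewrite exp1n muln1 chi1 mulr1.
have i0 := lattice_index_gt0 (lattice_pi_div u latM).
have s0 := lattice_index_gt0 (stab_lattice u l (lattice_pi_div u latM)).
rewrite /center_weight (lattice_index_pi_div u latM) (stab_index_div l latM cM).
set c := corank u (val M); set i := subgroup_index (pi_div u _).
set st := subgroup_index _.
have -> : (q ^ stab_exp n l c * st * (q ^ c * i) = q ^ (c + stab_exp n l c) * (st * i))%N.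
  by rewrite mulnACA -expnD [(_ + c)%N]addnC.
rewrite [chi _]chiM ?expn_gt0 ?card_res_gt0 ?muln_gt0 ?s0 ?i0//.
rewrite chiX expnMn natrM -expnM [(c * d)%N]mulnC natrX /center_step.
by rewrite -!mulrA; congr (_ * _); rewrite mulrCA.
Qed.

End Weights.

(** * The zeta function of the ideals *)

Section SumBounds.
Variable R : realType.
Implicit Types I J : choiceType.

Lemma bounded_fibers I J (p : I -> J) (fib : J -> {fset I}) (f : I -> R) B :
  (forall i j, (i \in fib j) = (p i == j)) -> (forall i, 0 <= f i) ->
  (forall F : {fset I}, \sum_(i <- F) f i <= B) <->
  (forall G : {fset J}, \sum_(j <- G) \sum_(i <- fib j) f i <= B).
Proof.
move=> fibP f0; split=> [fB G|fB F]; first by rewrite (sum_fibers _ _ fibP).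
apply: le_trans (fB [fset p i | i in F]%fset); rewrite (sum_fibers _ _ fibP).
apply: fset_sum_le => //; apply/fsubsetP => i Fi.
apply/bigfcupP; exists (p i); last by rewrite fibP.
by rewrite andbT; apply/imfsetP; exists i.
Qed.

Lemma bounded_prod I J (f : I -> R) (g : J -> R) A B :
  (forall i, 0 <= f i) -> (forall j, 0 <= g j) ->
  (forall F : {fset I}, \sum_(i <- F) f i <= A) ->
  (forall F : {fset J}, \sum_(i <- F) g i <= B) ->
  forall F : {fset I * J}, \sum_(x <- F) f x.1 * g x.2 <= A * B.
Proof.
move=> f0 g0 fA gB F.
pose F1 := [fset x.1 | x in F]%fset; pose F2 := [fset x.2 | x in F]%fset.
apply: (@le_trans _ _ (\sum_(x <- (F1 `*` F2)%fset) f x.1 * g x.2)).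
  apply: fset_sum_le => [x|]; first exact: mulr_ge0.
  apply/fsubsetP => x Fx; rewrite in_fsetM.
  by apply/andP; split; apply/imfsetP; exists x.
rewrite sum_fsetM ler_pM ?sumr_ge0//.
Qed.

End SumBounds.

Lemma igusa_ext (F : fieldType) n (Y : F) (X X' : nat -> F) :
  (forall c, (0 < c <= n)%N -> X c = X' c) -> igusa n Y X = igusa n Y X'.
Proof.
move=> XX'; rewrite /igusa; apply: eq_bigr => I I0; congr (_ * _).
apply: eq_bigr => i iI; rewrite XX'//; apply/andP; split; last by rewrite -ltnS.
rewrite lt0n; apply: contraNneq I0 => i0; suff <- : i = ord0 by [].
exact: val_inj.
Qed.

Section ZetaIdeals.
Variables (R : realType) (o : idomainType) (u : uniformized o) (n l : nat).
Hypothesis n_gt0 : (0 < n)%N.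
Local Notation q := #|res_field u|.
Local Notation d := (num_d l.+1 n).
Local Notation latt n := (@finite_index_submodules o ('rV[o]_n : lmodType o)).
Local Notation ideals := (finite_index_ideals (@Lbracket l.+1 n o)).
Local Notation cweight := (@center_weight o n l d _).
Local Notation iweight := (@index_weight o d _).
Local Notation cstep := (@center_step o u n l d _).
Local Notation istep := (@index_step o u _).
Implicit Types s : R[i].

Lemma card_basis : #|{: tuples_of_sum n l + tuples_of_sum n l.+1}| = d.
Proof. by rewrite card_sum card_E// card_F. Qed.

Lemma cweight_ge0 s M : 0 <= cweight (chiR s) M.
Proof. by rewrite mulr_ge0// ltW// chiR_gt0. Qed.

Lemma iweight_ge0 s M : 0 <= iweight (chiR s) M.
Proof. by rewrite ltW// chiR_gt0. Qed.

Lemma norm_cweight s M : `|cweight (chiC s) M| = (cweight (chiR s) M)%:C%C.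
Proof.
by rewrite normrM norm_chiC normr_nat rmorphM rmorph_nat.
Qed.

Lemma norm_iweight s M : `|iweight (chiC s) M| = (iweight (chiR s) M)%:C%C.
Proof. exact: norm_chiC. Qed.

(** All ideals of a fibre have the same index, and their number is the power of
    |o^n : M| that enters the centre weight. *)
Lemma fiber_sum (K : numFieldType) (chi : nat -> K) (fib : {fset ideals})
    (x : latt n * latt d) :
  (forall a b, (0 < a)%N -> (0 < b)%N -> chi (a * b)%N = chi a * chi b) ->
  #|` fib| = (subgroup_index (val x.1) ^ d)%N ->
  (forall I : ideals, I \in fib -> subgroup_index (val I) =
      (subgroup_index (stab (l := l) (val x.1)) * subgroup_index (val x.2) *
       subgroup_index (val x.1))%N) ->
  \sum_(I <- fib) chi (subgroup_index (val I)) = cweight chi x.1 * iweight chi x.2.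
Proof.
move=> chiM card_fib idx.
have i1 := lattice_index_gt0 (latt_lattice x.1).
have i2 := lattice_index_gt0 (latt_lattice x.2).
have i3 := lattice_index_gt0 (stab_lattice u l (latt_lattice x.1)).
rewrite big_seq (eq_bigr (fun=> chi (subgroup_index (stab (l := l) (val x.1)) *
  subgroup_index (val x.2) * subgroup_index (val x.1))%N)); last first.
  by move=> I /idx ->.
rewrite -big_seq big_const_seq count_predT iter_addr_0 card_fib.
rewrite mulnAC chiM ?muln_gt0 ?i1 ?i2 ?i3//.
by rewrite /center_weight /index_weight -[LHS]mulr_natl mulrA.
Qed.

(** For small t = q^(-Re s) both weights shrink fast enough along pi_div. *)
Lemma weights_bounded : exists sigma : R, forall s, sigma < complex.Re s ->
  (forall F : {fset latt n}, \sum_(M <- F) cweight (chiR s) M <= 2) /\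
  (forall F : {fset latt d}, \sum_(M <- F) iweight (chiR s) M <= 2).
Proof.
(* For t <= 1 / b, the constant of weight_bounded is at most q^(d * n) * t for
   the centre weight and t for the index weight, and the fibres have at most
   q^(n * n) and q^(d * d) elements: all of it is absorbed by b. *)
pose A := (d * n + (n * n + d * d))%N.
pose b : R := 2 * q%:R ^+ A.
have q_gt1 : 1 < q%:R :> R by rewrite ltr1n card_res_gt1.
have q_gt0 : 0 < q%:R :> R by apply: lt_trans q_gt1.
have b_gt0 : 0 < b by rewrite mulr_gt0// exprn_gt0.
have lnq_gt0 : 0 < ln (q%:R : R) by rewrite ln_gt0.
exists (ln b / ln q%:R) => s s_gt; set t := chiR s q.
have t0 : 0 <= t by rewrite ltW// chiR_gt0.
have t_lt : t <= b^-1.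
  rewrite /t /chiR expRN lef_pV2 ?posrE ?expR_gt0//.
  rewrite -{1}(lnK (x := b)) ?posrE// ler_expR mulrC -ler_pdivrMr//.
  exact: ltW.
have qA_ge1 e : 1 <= q%:R ^+ e :> R by rewrite exprn_ege1// ltW.
have t1 : t <= 1.
  apply: le_trans t_lt _; rewrite invf_le1// /b.
  by apply: (@le_trans _ _ 2) => //; rewrite ?ler1n// ler_pMr.
have tX c e : (0 < c)%N -> t ^+ (c + e) <= t.
  move=> c0; rewrite -(prednK c0) addSn exprS ler_piMr// exprn_ile1//.
have bound (e : nat) : (e <= A)%N -> q%:R ^+ e * t <= 1 / 2.
  move=> eA; rewrite mul1r; apply: (@le_trans _ _ (q%:R ^+ A * b^-1)).
    by apply: ler_pM => //; rewrite ler_weXn2l// ltW.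
  by rewrite /b invfM mulrC mulfVK// expf_neq0// gt_eqF.
have chi_mul a c : (0 < a)%N -> (0 < c)%N -> chiR s (a * c) = chiR s a * chiR s c.
  exact: chiRM.
split.
  have [W1 WS] := center_weight_mult u n l d (chiR1 s) chi_mul.
  apply: (@weight_bounded _ u _ _ _ (q%:R ^+ (d * n) * t)) => //.
  - by move=> x; exact: cweight_ge0.
  - move=> M cM; rewrite WS// ler_wpM2r ?cweight_ge0//.
    apply: ler_pM; [by rewrite exprn_ge0// ltW|by rewrite exprn_ge0| |exact: tX].
    by rewrite ler_weXn2l ?leq_mul2l ?corank_latt_le ?orbT// ltW.
  - by rewrite mulr_ge0// exprn_ge0// ltW.
  by rewrite natrX mulrAC -exprD bound// /A; lia.
have [W1 WS] := index_weight_mult u d (chiR1 s) chi_mul.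
apply: (@weight_bounded _ u _ _ _ t) => //.
- by move=> x; exact: iweight_ge0.
- move=> M cM; rewrite WS// ler_wpM2r ?iweight_ge0//.
  by rewrite /index_step -[corank _ _]addn0 tX.
by rewrite natrX mulrC bound// /A; lia.
Qed.

Lemma zeta_term_chi (V : zmodType) (P : set (set V)) s (M : P) :
  zeta_term s M = chiC s (subgroup_index (val M)).
Proof. by []. Qed.

Lemma zeta_convergesP (V : zmodType) (P : set (set V)) s :
  zeta_converges P s <->
  exists B, forall F : {fset P}, \sum_(M <- F) chiR s (subgroup_index (val M)) <= B.
Proof.
have termE : (fun M : P => (complex.Re `|zeta_term s M|)%:E) =
    fun M => (chiR s (subgroup_index (val M)))%:E.
  by apply/funext => M; rewrite zeta_term_chi norm_chiC.
rewrite /zeta_converges termE; split=> [/summableP|B].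
  by apply=> M; rewrite ltW// chiR_gt0.
by apply/summableP => // M; rewrite ltW// chiR_gt0.
Qed.

Lemma zeta_has_sum (V : zmodType) (P : set (set V)) s z :
  has_sum (fun M : P => chiC s (subgroup_index (val M))) z -> zeta P s = z.
Proof. exact: sum_has_sum. Qed.

Lemma chiC_has_sum (V : zmodType) (P : set (set V)) s : zeta_converges P s ->
  has_sum (fun M : P => chiC s (subgroup_index (val M))) (zeta P s).
Proof.
move=> /zeta_convergesP[B bB].
have [|z sz] := @has_sum_abs R P (fun M => chiC s (subgroup_index (val M))) B.
  by move=> F; under eq_bigr do rewrite norm_chiC/=.
by rewrite (zeta_has_sum sz).
Qed.

Lemma zeta_ideals_converges : exists sigma : R, forall s,
  sigma < complex.Re s -> zeta_converges ideals s.
Proof.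
have [sigma bounded] := weights_bounded; exists sigma => s /bounded[cB iB].
have [p [fib [fibP fibE]]] := ideal_fibers u card_basis.
apply/zeta_convergesP; exists (2 * 2).
have chi_ge0 (I : ideals) : 0 <= chiR s (subgroup_index (val I)).
  by rewrite ltW// chiR_gt0.
apply: (proj2 (@bounded_fibers _ _ _ p fib _ _ fibP chi_ge0)) => G.
rewrite (eq_bigr (fun x => cweight (chiR s) x.1 * iweight (chiR s) x.2)).
  apply: bounded_prod => // ?; [exact: cweight_ge0 | exact: iweight_ge0].
by move=> x _; have [cx ix] := fibE x; apply: fiber_sum => //; exact: chiRM.
Qed.

(** The sum over the ideals is a product of two sums over lattices. Their
    absolute convergence, and that of the subsums with given corank, follows from
    the convergence of the sum over the ideals, all terms being bounded by a
    subsum of it. *)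
Lemma zeta_ideals_igusa s : zeta_converges ideals s ->
  zeta ideals s = zeta (latt d) s * igusa n (q%:R)^-1
    (fun c => igusa_var u n (cstep (chiC s)) c).
Proof.
move=> conv; have := chiC_has_sum conv.
have /zeta_convergesP[B bB] := conv.
have [p [fib [fibP fibE]]] := ideal_fibers u card_basis.
move=> /(has_sum_fibers fibP) sum_ideals.
have fib_sum (K : numFieldType) (chi : nat -> K) x :
    (forall a b, (0 < a)%N -> (0 < b)%N -> chi (a * b)%N = chi a * chi b) ->
    \sum_(I <- fib x) chi (subgroup_index (val I)) = cweight chi x.1 * iweight chi x.2.
  by move=> chiM; have [cx ix] := fibE x; exact: fiber_sum.
have prod_sum : has_sum (fun x => cweight (chiC s) x.1 * iweight (chiC s) x.2)
    (zeta ideals s).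
  by apply: eq_has_sum sum_ideals => x; apply: fib_sum; exact: chiCM.
have chi_ge0 (I : ideals) : 0 <= chiR s (subgroup_index (val I)).
  by rewrite ltW// chiR_gt0.
have bound (G : {fset latt n * latt d}) :
    \sum_(x <- G) cweight (chiR s) x.1 * iweight (chiR s) x.2 <= B.
  rewrite (eq_bigr (fun x => \sum_(I <- fib x) chiR s (subgroup_index (val I)))).
    exact: (proj1 (@bounded_fibers _ _ _ p fib _ _ fibP chi_ge0)).
  by move=> x _; rewrite fib_sum//; exact: chiRM.
have chiM a c : (0 < a)%N -> (0 < c)%N -> chiC s (a * c) = chiC s a * chiC s c.
  exact: chiCM.
have chiRM' a c : (0 < a)%N -> (0 < c)%N -> chiR s (a * c) = chiR s a * chiR s c.
  exact: chiRM.
have W_multC := center_weight_mult u n l d (chiC1 s) chiM.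
have W_multR := center_weight_mult u n l d (chiR1 s) chiRM'.
have [topn topnE] := lattice_latt (latticeT 'rV[o]_n).
have [topd topdE] := lattice_latt (latticeT 'rV[o]_d).
(* Fixing one factor of the product to be the whole space bounds the sums of
   the other factor. *)
have cbound (F : {fset latt n}) : \sum_(M <- F) cweight (chiR s) M <= B.
  have i1 : \sum_(M <- [fset topd]%fset) iweight (chiR s) M = 1.
    by rewrite big_seq_fset1 /index_weight topdE subgroup_indexT chiR1.
  rewrite -[leLHS]mulr1 -i1 -sum_fsetM.
  exact: bound.
have ibound (F : {fset latt d}) : \sum_(M <- F) iweight (chiR s) M <= B.
  have c1 : \sum_(M <- [fset topn]%fset) cweight (chiR s) M = 1.
    by rewrite big_seq_fset1; apply: W_multR.1; rewrite topnE corankT.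
  rewrite -[leLHS]mul1r -c1 -sum_fsetM.
  exact: bound.
have [zd sum_d] : exists z, has_sum (iweight (chiC s)) z.
  apply: (has_sum_abs (B := B)) => F.
  by under eq_bigr do rewrite norm_iweight/=; exact: ibound.
have [G sum_G] : exists G : nat -> R[i], forall c,
    has_sum (fun M : latt n => cweight (chiC s) M * (corank u (val M) == c)%:R) (G c).
  suff /choice[G GP] : forall c, exists g, has_sum (fun M : latt n =>
      cweight (chiC s) M * (corank u (val M) == c)%:R) g by exists G.
  move=> c; apply: (has_sum_abs (B := B)) => F.
  apply: le_trans (cbound F); apply: ler_sum => M _.
  by rewrite normrM norm_cweight; case: eqP => _;
    rewrite ?normr1 ?normr0 ?mulr1 ?mulr0 ?cweight_ge0.
have [g sum_g] : exists g : nat -> R, forall c,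
    has_sum (fun M : latt n => cweight (chiR s) M * (corank u (val M) == c)%:R) (g c).
  suff /choice[g gP] : forall c, exists x, has_sum (fun M : latt n =>
      cweight (chiR s) M * (corank u (val M) == c)%:R) x by exists g.
  move=> c; apply: (has_sum_abs_real (B := B)) => F.
  apply: le_trans (cbound F); apply: ler_sum => M _.
  by case: eqP => _; rewrite ?mulr1 ?mulr0 ?normr0 ?ger0_norm ?cweight_ge0.
have var_lt1 c : (0 < c <= n)%N -> igusa_var u n (cstep (chiR s)) c < 1.
  apply: igusa_var_lt1 W_multR (fun c _ => sum_g c) _ _ _ => [M|c'].
    exact: cweight_ge0.
  by rewrite mulr_gt0 ?exprn_gt0 ?chiR_gt0// ltr0n card_res_gt0.
have norm_var c : `|igusa_var u n (cstep (chiC s)) c| =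
    (igusa_var u n (cstep (chiR s)) c)%:C%C.
  rewrite /igusa_var /center_step !normrM !normrX norm_chiC !normr_nat.
  by rewrite !rmorphM !rmorphXn/= !rmorph_nat.
have var_neq1 c : (0 < c <= n)%N -> 1 - igusa_var u n (cstep (chiC s)) c != 0.
  move=> /var_lt1 lt1; rewrite subr_eq0; apply/eqP => var1.
  by have := norm_var c; rewrite -var1 normr1 => /(congr1 (@complex.Re R))/= v1;
    rewrite -v1 ltxx in lt1.
have sum_c := sum_corank_igusa W_multC (fun c _ => sum_G c) var_neq1.
rewrite (has_sum_prod sum_c sum_d prod_sum) mulrC; congr (_ * _).
exact/esym/zeta_has_sum.
Qed.

End ZetaIdeals.

Theorem theorem1p1 (R : realType) (m n : nat) (m_gt0 : (0 < m)%N)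
    (n_gt0 : (0 < n)%N) (o : idomainType) (o_dvr : compact_dvr o) (q : nat)
    (q_card : (cosets (@max_ideal o) #= `I_q)%card) :
  let ideals := finite_index_ideals (@Lbracket m n o) in
  let submodules :=
    @finite_index_submodules o ('rV[o]_(num_d m n) : lmodType o) in
  let x (s : R[i]) (i : nat) : R[i] :=
    cpow q%:R ((num_a m n i)%:R - s * (num_b m n i)%:R) in
  (exists sigma : R, forall s : R[i],
     sigma < complex.Re s -> zeta_converges ideals s) /\
  (forall s : R[i], zeta_converges ideals s ->
     zeta ideals s =
     zeta submodules s * igusa n (q%:R)^-1 (fun k => x s (n - k)%N)).
Proof.
move=> ideals submodules x; have [dvr _] := o_dvr.
have [k [rho [pi [pi0 rho0 rho_surj rho_unit card_k]]]] :=
  discrete_valuation_residue dvr q_card.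
pose u := Uniformized pi0 rho0 rho_surj rho_unit.
case: m m_gt0 @ideals @submodules @x => // l _ ideals submodules x.
split=> [|s conv]; first exact: (zeta_ideals_converges R u l n_gt0).
rewrite (zeta_ideals_igusa u n_gt0 conv) -card_k; congr (_ * _).
apply: igusa_ext => c /andP[c0 cn]; have q0 : (0 < #|k|)%N := card_res_gt0 u.
have nc : (n - (n - c) = c)%N by lia.
rewrite /x cpowD cpow_nat ?card_k ?ltr0n -?card_k// -mulNr cpowMn.
rewrite -[cpow _ (- s)]/(chiC s #|k|) rmorph_nat /igusa_var /center_step.
rewrite mulrAC -exprD; congr (_ ^+ _ * _ ^+ _).
  by rewrite /num_a nc; lia.
rewrite /stab_exp /num_b nc; case: eqP => [c00|_]; first by rewrite c00 in c0.
by rewrite addnA.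
Qed.
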